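(* Let $f$ be an analytic function on $\{z\in\mathbb{C}:\mathrm{Re}\,z>0\}$. Suppose there exists $p\in\mathbb{N}$ such that (1) $f\in\mathcal{T}^{(p-1)}_{-2\pi,0;2\pi,0}$; (2) $\lim_{t\to\infty}f^{(p)}(t+\mathrm{i}\xi)=0$ ($t$ real), locally uniformly in $\xi\in\mathbb{R}$. Then for every $z\in\mathbb{C}$ with $\mathrm{Re}\,z>-1$ we have $$(\mathrm{MS})\text{-}\sum_{k=1}^{z}f(k)=\int_{\mathrm{B}}^{\mathrm{B}+z}f(k)\,\mathrm{d}k$$ (in particular, both sides are defined).
   Context: $\mathbb{N}=\{0,1,2,\dots\}$. **Müller–Schleicher (MS) fractional sum.** Let $U\subseteq\mathbb{C}$ with $U+1\subseteq U$ and $1\in U$, and $f:U\to\mathbb{C}$ (here $U=\{\mathrm{Re}\,z>0\}$). Suppose there is a sequence of polynomials $(P_n)_{n\in\mathbb{N}}$ such that: (i) the degrees of the $P_n$ are uniformly bounded; (ii) for all $y$ with $y+1\in U$ the limit $\lim_{n\to\infty}\left(\sum_{k=1}^n(f(k+y)-f(k))-P_n(y)\right)=:-Q(y)$ exists; (iii) for all $y$ with $y+1\in U$, $Q(y+1)-Q(y)=f(y+1)$. Then $(\mathrm{MS})\text{-}\sum_{k=x}^{y}f(k):=Q(y)-Q(x-1)$ for $x,y+1\in U$ (this does not depend on the choice of $(P_n)$). **The class $\mathcal{T}^{(p-1)}_{a,k;b,l}$.** It consists of the analytic functions $f$ on $\{\mathrm{Re}\,z>0\}$ such that: (1) for every $t\in\mathbb{C}$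 with $\mathrm{Re}\,t>0$, $\xi\mapsto|f(t+\mathrm{i}\xi)|\mathrm{e}^{-b\xi}(1+|\xi|)^l$ is in $L^1(0,\infty)$, and $\lim_{\mathrm{Re}\,t\to\infty}\int_0^\infty\left|f(t+\mathrm{i}\xi)-\sum_{j=0}^{p-1}\frac{f^{(j)}(t)}{j!}(\mathrm{i}\xi)^j\right|\mathrm{e}^{-b\xi}(1+|\xi|)^l\,\mathrm{d}\xi=0$ locally uniformly with respect to $\mathrm{Im}\,t$; (2) for every $t\in\mathbb{C}$ with $\mathrm{Re}\,t>0$, $\xi\mapsto|f(t+\mathrm{i}\xi)|\mathrm{e}^{-a\xi}(1+|\xi|)^k$ is in $L^1(-\infty,0)$, and $\lim_{\mathrm{Re}\,t\to\infty}\int_{-\infty}^0\left|f(t+\mathrm{i}\xi)-\sum_{j=0}^{p-1}\frac{f^{(j)}(t)}{j!}(\mathrm{i}\xi)^j\right|\mathrm{e}^{-a\xi}(1+|\xi|)^k\,\mathrm{d}\xi=0$ locally uniformly with respect to $\mathrm{Im}\,t$; (3) there are $s\in\mathbb{R}$ and a locally bounded $C:(0,\infty)\to[0,\infty)$ with $|f(z)|\le C(\mathrm{Re}\,z)\mathrm{e}^{s|\mathrm{Im}\,z|}$. For $p=0$ the sums over $j$ are empty. **Evaluation at the Bernoulli umbra $\mathrm{B}$.** Let $\mathcal{B}(w)=\frac{w\mathrm{e}^w}{\mathrm{e}^w-1}$ (with $\mathcal{B}(0)=1$) on $|\mathrm{Im}\,w|<2\pi$. For $\xi\in\mathbb{R}$,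 $s\in(0,1)$ put $\hat{\mathcal{B}}(\xi-\mathrm{i}s)=\frac{1}{\sqrt{2\pi}}\int_{-\infty}^{\infty}\mathcal{B}(x)\mathrm{e}^{-\mathrm{i}(\xi-\mathrm{i}s)x}\,\mathrm{d}x$. For $F$ analytic on $\{\mathrm{Re}\,w>0\}$ and $\mathrm{Re}\,z>-1$, define $$F(\mathrm{B}+z):=\frac{1}{\sqrt{2\pi}}\int_{-\infty-\mathrm{i}t}^{\infty-\mathrm{i}t}\hat{\mathcal{B}}(w)F(\mathrm{i}w+z)\,\mathrm{d}w,$$ where $t\in(0,1)$, $t+\mathrm{Re}\,z>0$. This is defined when the integrand is Lebesgue integrable on the line for each such $t$ and $F$ satisfies a bound $|F(w)|\le C(\mathrm{Re}\,w)\mathrm{e}^{s|\mathrm{Im}\,w|}$ with $C$ locally bounded; the value is then independent of $t$. Finally $\int_{\mathrm{B}}^{\mathrm{B}+z}f(k)\,\mathrm{d}k:=F(\mathrm{B}+z)-F(\mathrm{B})$ with $F(w)=\int_1^w f(u)\,\mathrm{d}u$. *)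

(* Defs.v *)
From HB Require Import structures.
From mathcomp Require Import all_boot all_order all_algebra.
From mathcomp Require Import all_classical all_reals all_analysis.
From mathcomp Require Export complex.

Set Implicit Arguments.
Unset Strict Implicit.
Unset Printing Implicit Defensive.

Import Order.TTheory GRing.Theory Num.Theory.
Import numFieldNormedType.Exports.
Export numFieldNormedType.Exports.

Local Open Scope classical_set_scope.
Local Open Scope ring_scope.
Local Open Scope complex_scope.

(* R[i] as a normed space over itself: complex differentiability of
   f : R[i] -> R[i] at z is then [derivable f z 1], and [derive1n j f] is its
   j-th complex derivative. *)
HB.instance Definition _ (R : realType) := GRing.ComAlgebra.copy R[i] R[i]^o.
HB.instance Definition _ (R : realType) := Vector.copy R[i] R[i]^o.
HB.instance Definition _ (R : realType) := NormedModule.copy R[i] R[i]^o.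

Section Definitions.
Variable R : realType.
Implicit Types (f F : R[i] -> R[i]) (z w : R[i]).

Local Notation normc := ComplexField.Normc.normc.
Local Notation mu := (@lebesgue_measure R).
Local Notation Re := (@complex.Re R).
Local Notation Im := (@complex.Im R).

Definition right_half_plane : set R[i] := [set z | 0 < Re z].

Definition analytic_on (U : set R[i]) f := forall z, U z -> derivable f z 1.

Definition cexp z : R[i] := (expR (Re z))%:C * (cos (Im z) +i* sin (Im z)).

Definition cintegrable (D : set R) (g : R -> R[i]) : Prop :=
  mu.-integrable D (fun x => (Re (g x))%:E) /\
  mu.-integrable D (fun x => (Im (g x))%:E).

Definition cintegral (D : set R) (g : R -> R[i]) : R[i] :=
  (\int[mu]_(x in D) Re (g x)) +i* (\int[mu]_(x in D) Im (g x)).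

Definition cvg_locally_uniformly (V : uniformType) (G : R -> R -> V)
    (g : R -> V) : Prop :=
  forall y : R, exists2 A : set R, nbhs y A &
    {uniform A, G @ (pinfty_nbhs R) --> g}.

Definition exponentially_bounded f : Prop :=
  exists (s : R) (C : R -> R),
    [/\ forall x, 0 < x -> 0 <= C x,
        [locally [bounded C x | x in [set x : R | 0 < x]]]
      & forall z, 0 < Re z -> normc (f z) <= C (Re z) * expR (s * `|Im z|)].

Definition taylor_remainder (p : nat) f (t : R[i]) (xi : R) : R[i] :=
  f (t + 'i * xi%:C) -
  \sum_(j < p) derive1n j f t / (j`!)%:R * ('i * xi%:C) ^+ j.

Definition weight (c m xi : R) : R := expR (- (c * xi)) * (1 + `|xi|) `^ m.

(* [p] Taylor terms (orders 0 to p - 1). *)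
Record T_class (p : nat) (a k b l : R) f : Prop := {
  T_analytic : analytic_on right_half_plane f;
  T_integrable_pos : forall t : R[i], 0 < Re t ->
    mu.-integrable `]0, +oo[
      (fun xi => (normc (f (t + 'i * xi%:C)) * weight b l xi)%:E);
  T_limit_pos : cvg_locally_uniformly
    (fun x y : R => \int[mu]_(xi in `]0%R, +oo[)
       (normc (taylor_remainder p f (x +i* y) xi) * weight b l xi)%:E)%E
    (fun=> 0%E);
  T_integrable_neg : forall t : R[i], 0 < Re t ->
    mu.-integrable `]-oo, 0[
      (fun xi => (normc (f (t + 'i * xi%:C)) * weight a k xi)%:E);
  T_limit_neg : cvg_locally_uniformly
    (fun x y : R => \int[mu]_(xi in `]-oo, 0%R[)
       (normc (taylor_remainder p f (x +i* y) xi) * weight a k xi)%:E)%E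
    (fun=> 0%E);
  T_bounded : exponentially_bounded f
}.

(* The sequence (P_n) and the function Q of a Mueller-Schleicher sum; only the
   values Q y with y + 1 in U matter. *)
Record MS_data (U : set R[i]) f (P : nat -> {poly R[i]}) (Q : R[i] -> R[i])
    : Prop := {
  MS_degree : exists d : nat, forall n, (size (P n) <= d)%N;
  MS_limit : forall y : R[i], U (y + 1) ->
    (fun n : nat => \sum_(1 <= k < n.+1) (f (k%:R + y) - f k%:R) - (P n).[y])
      @ \oo --> - Q y;
  MS_shift : forall y : R[i], U (y + 1) -> Q (y + 1) - Q y = f (y + 1)
}.

(* The sum of f from x to y exists and has value v, whatever the choice of
   (P_n). *)
Record MS_sum (U : set R[i]) f (x y v : R[i]) : Prop := {
  MS_domain1 : U 1;
  MS_domainD1 : forall u, U u -> U (u + 1);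
  MS_lower : U x;
  MS_upper : U (y + 1);
  MS_exists : exists P Q, MS_data U f P Q;
  MS_value : forall P Q, MS_data U f P Q -> Q y - Q (x - 1) = v
}.

Definition bernoulli_fun w : R[i] :=
  if w == 0 then 1 else w * cexp w / (cexp w - 1).

Definition bernoulli_hat w : R[i] :=
  ((Num.sqrt (2 * pi))^-1)%:C *
  cintegral setT (fun x => bernoulli_fun x%:C * cexp (- ('i * w * x%:C))).

(* The integrand of F(B + z) on the line Im w = - t, parametrized by
   w = u - i t with u real. *)
Definition umbra_integrand F z (t u : R) : R[i] :=
  let w := u -i* t in bernoulli_hat w * F ('i * w + z).

(* F(B + z) is defined and has value v, on every admissible line. *)
Record umbra_eval F z (v : R[i]) : Prop := {
  umbra_domain : -1 < Re z;
  umbra_analytic : analytic_on right_half_plane F;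
  umbra_bounded : exponentially_bounded F;
  umbra_integrable : forall t : R, 0 < t < 1 -> 0 < t + Re z ->
    cintegrable setT (umbra_integrand F z t);
  umbra_value : forall t : R, 0 < t < 1 -> 0 < t + Re z ->
    ((Num.sqrt (2 * pi))^-1)%:C * cintegral setT (umbra_integrand F z t) = v
}.

(* Integral of f along the segment from z to w. *)
Definition segment_integral f z w : R[i] :=
  (w - z) * cintegral `[0, 1] (fun s => f (z + s%:C * (w - z))).

Definition umbra_integral f z (v : R[i]) : Prop :=
  let F := segment_integral f 1 in
  exists v1 v0, [/\ umbra_eval F z v1, umbra_eval F 0 v0 & v = v1 - v0].

End Definitions.

(* Main.v *)
(* Write [kap w = - 2 pi q / (1 - q)^2] with [q = exp (2 pi w)].  Shifting the
   contour of the Bernoulli transform by [2 pi 'i] shows that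
   [bernoulli_hat w = sqrt (2 pi) * kap w] for [-1 < Im w < 0], so that
   [F(B + y) = Q y], the integral of [kap w * F ('i w + y)] along [Im w = v].
   The kernel has period ['i], total mass 1 and a double pole at [- 'i], whence
   [Q (y + 1) - Q y = F' (y + 1) = f (y + 1)] by moving the contour across the
   pole: this telescopes [\sum_(k <= n) f (k + y)] to [Q (y + n) - Q y].  The
   hypothesis on the Taylor remainders of [f] carries over to the primitive [F]
   by a Hardy inequality with weight [exp (- 2 pi |u|)], so [Q (y + n)] is
   asymptotically a fixed linear combination of [F], [f], ..., [f^(p-1)] at
   [n + y + 1/2]; since [f^(p)] tends to 0, each of these is asymptotically its
   Taylor polynomial at [n], which provides the polynomials [P_n].  Two
   admissible choices of [Q] differ by a 1-periodic function which is a pointwise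
   limit of polynomials of bounded degree; by Lagrange interpolation at integers
   it is constant. *)
Require Import Defs.
From mathcomp Require Import all_boot all_order all_algebra.
From mathcomp Require Import all_classical all_reals all_analysis.
From mathcomp Require Import measurable_realfun complex.
From mathcomp Require Import ring lra.
Import Order.TTheory GRing.Theory Num.Theory.
Import numFieldNormedType.Exports.
Set Implicit Arguments.
Unset Strict Implicit.
Unset Printing Implicit Defensive.
Local Open Scope classical_set_scope.
Local Open Scope ring_scope.
Local Open Scope complex_scope.

Local Notation normc := ComplexField.Normc.normc.

(** The weight in the hypothesis decays exactly like the kernel, so there is no room for estimates
    that lose part of the exponential. Pointwise, only a bound [exp (s * |Im w|)] is known, and [s]
    may exceed [2 pi]. Two choices follow from this. The primitive [F] is controlled in weighted
    [L^1], by an integration by parts that keeps the weight. The vertical sides of a contour are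
    removed by a Gaussian factor, since the decay of the kernel need not beat the growth of [F].

    Residues are never computed. Wherever a pole meets a contour, a Taylor polynomial is subtracted
    first, the quotient is written as an integral of a derivative ([analytic_factor]), and the
    resulting holomorphic function is moved by Goursat's theorem. Since that integral has to be
    differentiated in turn, derivatives of analytic functions must be known to be analytic. This is
    the purpose of the Cauchy formula established before.

    The coefficients of the linear combination in [Q (y + n)] are moments of [kap] on the line
    [Im w = - 1/2]; the point [n + y + 1/2] is where the rotated line meets the horizontal through
    [y]. *)

Lemma ltr02 (R : numDomainType) : (0 : R) < 2.
Proof. exact: ltr0Sn. Qed.
Arguments ltr02 {R}.

(** * Complex differentiability *)

Section ComplexBasics.
Variable R : realType.
Local Notation C := R[i].
Implicit Types (z w h : C) (f g : C -> C).

Lemma norm_normc z : `|z| = (normc z)%:C.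
Proof. by case: z. Qed.

Lemma normc_ge0 z : 0 <= normc z.
Proof. by rewrite -ler0c -norm_normc. Qed.

Lemma normc_eq0 z : (normc z == 0) = (z == 0).
Proof. by rewrite -[z == 0]normr_eq0 norm_normc -(inj_eq (@complexI R)). Qed.

Lemma normc_gt0 z : (0 < normc z) = (z != 0).
Proof. by rewrite lt_def normc_eq0 normc_ge0 andbT. Qed.

Lemma normcD z w : normc (z + w) <= normc z + normc w.
Proof. exact: le_normcD. Qed.

Lemma normcM z w : normc (z * w) = normc z * normc w.
Proof. exact: ComplexField.Normc.normcM. Qed.

Lemma normcN z : normc (- z) = normc z.
Proof. exact: normcN. Qed.

Lemma normcV z : normc z^-1 = (normc z)^-1.
Proof. exact: ComplexField.Normc.normcV. Qed.

Lemma normcX z n : normc (z ^+ n) = normc z ^+ n.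
Proof.
by elim: n => [|n IH]; rewrite ?expr0 ?ComplexField.Normc.normc1// !exprS normcM IH.
Qed.

Lemma normc0 : normc (0 : C) = 0.
Proof. exact: ComplexField.Normc.normc0. Qed.

Lemma normc1 : normc (1 : C) = 1.
Proof. exact: ComplexField.Normc.normc1. Qed.

Lemma normc_real (x : R) : normc x%:C = `|x|.
Proof. by rewrite /= expr0n /= addr0 sqrtr_sqr. Qed.

Lemma normci : normc ('i : C) = 1.
Proof. by rewrite /= expr0n /= add0r expr1n sqrtr1. Qed.

Lemma normcB z w : normc (z - w) = normc (w - z).
Proof. by rewrite -normcN opprB. Qed.

Lemma normc_sub z w : normc (z - w) <= normc z + normc w.
Proof. by rewrite -(normcN w) normcD. Qed.

Lemma Re_le_normc z : `|complex.Re z| <= normc z.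
Proof. by rewrite -lecR -norm_normc normc_ge_Re. Qed.

Lemma Im_le_normc z : `|complex.Im z| <= normc z.
Proof.
case: z => x y /=; rewrite -sqrtr_sqr ler_sqrt ?addr_ge0 ?sqr_ge0//.
by rewrite lerDr sqr_ge0.
Qed.

Lemma normc_le_ReIm z : normc z <= `|complex.Re z| + `|complex.Im z|.
Proof.
rewrite {1}[z]complexE (le_trans (normcD _ _))// normcM !normc_real normci mul1r//.
Qed.

Lemma nbhs_normc z (A : set C) :
  nbhs z A <-> exists2 e : R, 0 < e & forall w, normc (w - z) < e -> A w.
Proof.
split=> [/nbhs_ballP[e /= e0 eA]|[e e0 eA]].
- have /complex_realP[d ed] : e \is Num.real by rewrite gtr0_real.
  move: e0 eA; rewrite ed ltcR => d0 dA; exists d => // w wd; apply: dA.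
  by rewrite -ball_normE /= norm_normc ltcR normcB.
- apply/nbhs_ballP; exists e%:C => /=; first by rewrite ltcR.
  by move=> w; rewrite -ball_normE /= norm_normc ltcR normcB => /eA.
Qed.

Lemma cvg_normc (T : Type) (F : set_system T) (FF : Filter F) (g : T -> C) l :
  g @ F --> l <-> forall e : R, 0 < e -> \forall x \near F, normc (g x - l) < e.
Proof.
split=> [gl e e0|gl].
- by apply: (gl [set w | normc (w - l) < e]); apply/nbhs_normc; exists e.
- move=> A /nbhs_normc[e e0 eA]; have := gl e e0.
  by apply: filterS => x /eA.
Qed.

Lemma cvg_ReIm (T : Type) (F : set_system T) (FF : Filter F) (g : T -> C) l :
  g @ F --> l <-> (complex.Re (g x) @[x --> F] --> complex.Re l) /\
                  (complex.Im (g x) @[x --> F] --> complex.Im l).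
Proof.
split=> [/cvg_normc gl|[gr gi]].
- split; apply/cvgrPdist_lt => e e0; apply: filterS (gl e e0) => x;
    apply: le_lt_trans; rewrite normcB.
    by have := Re_le_normc (l - g x); case: (g x) => a b; case: l {gl}.
  by have := Im_le_normc (l - g x); case: (g x) => a b; case: l {gl}.
- apply/cvg_normc => e e0.
  have e2 : 0 < e / 2 by rewrite divr_gt0.
  move/cvgrPdist_lt : gr => /(_ _ e2) gr; move/cvgrPdist_lt : gi => /(_ _ e2) gi.
  apply: filterS2 gr gi => x gr gi; rewrite normcB.
  apply: le_lt_trans (normc_le_ReIm _) _; rewrite [e]splitr ltrD//.
  - by move: gr; case: (g x) => a b; case: l {gi}.
  - by move: gi; case: (g x) => a b; case: l {gr}.
Qed.

(** The error is compared with [e * normc h], without a quotient, so that [h = 0] needs no separate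
    treatment. *)
Definition cderiv f z l := forall e : R, 0 < e -> exists2 d : R, 0 < d &
    forall h, normc h < d -> normc (f (z + h) - f z - l * h) <= e * normc h.

Lemma is_derive_cderiv f z l : is_derive z (1 : C) f l <-> cderiv f z l.
Proof.
have eqv h : h != 0 -> normc (h^-1 *: ((f \o shift z) (h *: 1) - f z) - l) * normc h
   = normc (f (z + h) - f z - l * h).
  move=> h0; rewrite -normcM; congr normc.
  rewrite /= [h *: 1]mulr1 (addrC h) mulrBl; congr (_ - _).
  by rewrite mulrAC mulVf// mul1r.
split=> [[df dl] e e0|H].
- have /cvg_normc /(_ e e0) : h^-1 *: ((f \o shift z) (h *: 1) - f z) @[h --> 0^'] --> l by rewrite -dl.
  move=> /nbhs_normc[d d0 dP]; exists d => // h hd.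
  have [->|h0] := eqVneq h 0; first by rewrite addr0 subrr mulr0 subr0 normc0 mulr0.
  have := dP h; rewrite subr0 => /(_ hd h0) hh.
  by rewrite -(eqv _ h0) ler_wpM2r ?normc_ge0// ltW.
- have lim : h^-1 *: ((f \o shift z) (h *: 1) - f z) @[h --> 0^'] --> l.
    apply/cvg_normc => e e0; have e2 : 0 < e / 2 by rewrite divr_gt0.
    have [d d0 dP] := H _ e2; apply/nbhs_normc; exists d => // h.
    rewrite subr0 => hd h0; have := dP _ hd; rewrite -(eqv _ h0).
    rewrite ler_pM2r ?normc_gt0// => /le_lt_trans; apply.
    by rewrite ltr_pdivrMr// mulr2n mulrDr mulr1 ltrDl.
  by apply: DeriveDef; [apply/cvg_ex; exists l | apply: cvg_lim].
Qed.

Lemma derivable_cderiv f z : derivable f z (1 : C) -> cderiv f z ('D_1 f z).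
Proof. by move/derivableP/is_derive_cderiv. Qed.

Lemma cderiv_derivable f z l : cderiv f z l -> derivable f z (1 : C).
Proof. by move/is_derive_cderiv => []. Qed.

Lemma cderiv_derive1 f z l : cderiv f z l -> derive1 f z = l.
Proof. by move/is_derive_cderiv => [? <-]; rewrite derive1E. Qed.

Lemma cderiv_cont f z l : cderiv f z l -> {for z, continuous f}.
Proof.
by move=> /is_derive_cderiv[/derivable1_diffP /differentiable_continuous].
Qed.

Lemma cderiv_eq f z l l' : cderiv f z l -> l = l' -> cderiv f z l'.
Proof. by move=> df <-. Qed.

Lemma cderiv_ext f g z l : (forall w, f w = g w) -> cderiv f z l -> cderiv g z l.
Proof. by move=> /funext ->. Qed.

Lemma cderiv_near f g z l : (exists2 d : R, 0 < d & forall w, normc (w - z) < d -> f w = g w) ->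
  cderiv f z l -> cderiv g z l.
Proof.
move=> [d d0 fg] df e e0; have [d' d'0 dP] := df e e0.
exists (Num.min d d') => [|h]; first by rewrite lt_min d0.
rewrite lt_min => /andP[hd hd'].
have <- : f z = g z by apply: fg; rewrite subrr normc0.
have <- : f (z + h) = g (z + h) by apply: fg; rewrite (addrC z) addrK.
exact: dP.
Qed.

Lemma cderiv_cst (a z : C) : cderiv (fun=> a) z 0.
Proof. by apply/is_derive_cderiv. Qed.

Lemma cderiv_id z : cderiv (fun w => w) z 1.
Proof. by apply/is_derive_cderiv. Qed.

Lemma cderivD f g z l m : cderiv f z l -> cderiv g z m ->
  cderiv (fun w => f w + g w) z (l + m).
Proof.
by move=> /is_derive_cderiv df /is_derive_cderiv dg; apply/is_derive_cderiv.
Qed.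

Lemma cderivM f g z l m : cderiv f z l -> cderiv g z m ->
  cderiv (fun w => f w * g w) z (l * g z + f z * m).
Proof.
move=> /is_derive_cderiv df /is_derive_cderiv dg.
have /is_derive_cderiv H := is_deriveM df dg.
by apply: (cderiv_eq H); rewrite addrC [l * _]mulrC.
Qed.

Lemma cderivZ f z l a : cderiv f z l -> cderiv (fun w => a * f w) z (a * l).
Proof. by move=> df; apply: (cderiv_eq (cderivM (cderiv_cst a z) df)); rewrite mul0r add0r. Qed.

Lemma cderivN f z l : cderiv f z l -> cderiv (fun w => - f w) z (- l).
Proof. by move=> /is_derive_cderiv df; apply/is_derive_cderiv. Qed.

Lemma cderivB f g z l m : cderiv f z l -> cderiv g z m ->
  cderiv (fun w => f w - g w) z (l - m).
Proof. by move=> df /cderivN; exact: cderivD. Qed.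

Lemma cderiv_affine (a b z : C) : cderiv (fun w => a + b * w) z b.
Proof.
by apply: (cderiv_eq (cderivD (cderiv_cst a z) (cderivZ b (cderiv_id z)))); rewrite add0r mulr1.
Qed.

Lemma cderiv_sqr z : cderiv (fun w => w ^+ 2) z (2 * z).
Proof.
by apply: (cderiv_eq (cderivM (cderiv_id z) (cderiv_id z))); rewrite mul1r mulr1 mulr_natl.
Qed.

Lemma cderiv_comp f g z l m : cderiv f z l ->
  cderiv g (f z) m -> cderiv (fun w => g (f w)) z (m * l).
Proof.
move=> df dg e e0.
pose L := normc l + 1; pose M := normc m + 1.
have L0 : 0 < L by rewrite ltr_wpDl ?normc_ge0.
have M0 : 0 < M by rewrite ltr_wpDl ?normc_ge0.
have [d1 d10 Hf1] := df 1 ltr01.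
have [d2 d20 Hf2] := df (e / 2 / M) (divr_gt0 (divr_gt0 e0 ltr02) M0).
have [d3 d30 Hg] := dg (e / 2 / L) (divr_gt0 (divr_gt0 e0 ltr02) L0).
exists (Num.min (Num.min d1 d2) (d3 / L)) => [|h].
  by rewrite !lt_min d10 d20 divr_gt0.
rewrite !lt_min ltr_pdivlMr// => /andP[/andP[hd1 hd2] hd3].
set k := f (z + h) - f z.
have kL : normc k <= L * normc h.
  rewrite -[k](subrK (l * h)) (le_trans (normcD _ _))// mulrDl mul1r normcM.
  by rewrite addrC lerD2l (le_trans (Hf1 _ hd1))// mul1r.
(* The error of [g] at the increment [k], plus [m] times the error of [f]; each part receives half
   of [e]. *)
have -> : g (f (z + h)) - g (f z) - m * l * h =
  (g (f z + k) - g (f z) - m * k) + m * (k - l * h).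
  by rewrite /k (addrC (f z)) subrK; ring.
apply: le_trans (normcD _ _) _; rewrite (splitr e) mulrDl lerD//.
- apply: le_trans (Hg _ _) _; first by rewrite (le_lt_trans kL)// mulrC.
  have := ler_wpM2l (ltW (divr_gt0 (divr_gt0 e0 ltr02) L0)) kL.
  by move/le_trans; apply; rewrite mulrA divfK// gt_eqF.
- rewrite normcM (@le_trans _ _ (M * (e / 2 / M * normc h)))//.
    by rewrite ler_pM ?normc_ge0// ?Hf2// /M lerDl.
  by rewrite mulrA (mulrC M) divfK// gt_eqF.
Qed.

Lemma cderiv_sqr_comp f z l : cderiv f z l -> cderiv (fun w => f w ^+ 2) z (2 * f z * l).
Proof. by move=> df; apply: (cderiv_comp df (cderiv_sqr _)). Qed.

Lemma cderivX f z l n : cderiv f z l ->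
  cderiv (fun w => f w ^+ n.+1) z (n.+1%:R * f z ^+ n * l).
Proof.
move=> df; elim: n => [|n IH]; first by rewrite mul1r expr0 mul1r.
have := cderivM df IH; congr (cderiv _ z _).
  by rewrite [n.+2%:R]mulrS !exprS; ring.
Qed.

Lemma cderiv_inv z : z != 0 -> cderiv (fun w => w^-1) z (- (z ^- 2)).
Proof.
move=> z0 e e0; have nz : 0 < normc z by rewrite normc_gt0.
exists (Num.min (normc z / 2) (e * normc z ^+ 3 / 2)) => [|h].
  by rewrite lt_min !divr_gt0 ?mulr_gt0 ?exprn_gt0.
rewrite lt_min => /andP[h1 h2].
have hz : normc z / 2 <= normc (z + h).
  have := normc_sub (z + h) h; rewrite addrK; lra.
have zh0 : z + h != 0 by rewrite -normc_gt0 (lt_le_trans _ hz)// divr_gt0.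
(* The remainder is exactly quadratic in [h]. The first bound in the minimum keeps [normc (z + h)]
   above [normc z / 2], the second then makes the quotient at most [e]. *)
have -> : (z + h)^-1 - z^-1 - - z ^- 2 * h = (h / (z ^+ 2 * (z + h))) * h.
  by field; rewrite z0 zh0.
rewrite normcM ler_wpM2r ?normc_ge0// normcM normcV normcM normcX.
rewrite ler_pdivrMr ?mulr_gt0 ?exprn_gt0 ?normc_gt0//.
apply: le_trans (ltW h2) _.
have -> : e * normc z ^+ 3 / 2 = e * (normc z ^+ 2 * (normc z / 2)) by ring.
apply: ler_wpM2l; first exact: ltW.
apply: ler_wpM2l => //; exact: (exprn_ge0 _ (normc_ge0 _)).
Qed.

Lemma cderivV f z l : f z != 0 -> cderiv f z l ->
  cderiv (fun w => (f w)^-1) z (- (f z ^- 2) * l).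
Proof. by move=> fz0 df; apply: (cderiv_comp df (cderiv_inv fz0)). Qed.

Lemma ccontD (T : topologicalType) (u v : T -> C) x : {for x, continuous u} ->
  {for x, continuous v} -> {for x, continuous (fun y => u y + v y)}.
Proof. by move=> uc vc; apply: cvgD; [exact: uc | exact: vc]. Qed.

Lemma ccontB (T : topologicalType) (u v : T -> C) x : {for x, continuous u} ->
  {for x, continuous v} -> {for x, continuous (fun y => u y - v y)}.
Proof. by move=> uc vc; apply: cvgB; [exact: uc | exact: vc]. Qed.

Lemma ccontM (T : topologicalType) (u v : T -> C) x : {for x, continuous u} ->
  {for x, continuous v} -> {for x, continuous (fun y => u y * v y)}.
Proof. by move=> uc vc; apply: cvgM; [exact: uc | exact: vc]. Qed.

Lemma ccont_cst (T : topologicalType) (a : C) (x : T) :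
  {for x, continuous (fun=> a)}.
Proof. exact: cvg_cst. Qed.

Lemma ccont_comp (T : topologicalType) (h : T -> C) f (t : T) :
  {for t, continuous h} ->
  {for h t, continuous f} -> {for t, continuous (fun s => f (h s))}.
Proof. by move=> hc fc; exact: (cvg_comp h f hc fc). Qed.

Lemma ccontP f z : {for z, continuous f} <->
  forall e : R, 0 < e -> exists2 d : R, 0 < d &
    forall w, normc (w - z) < d -> normc (f w - f z) < e.
Proof.
split=> [fc e e0|H].
- have /(@cvg_normc _ (nbhs z) _ f (f z)) /(_ e e0) : f @ nbhs z --> f z := fc.
  by move=> /nbhs_normc.
- have /(@cvg_normc _ (nbhs z) _ f (f z)) // : forall e, 0 < e -> \forall x \near z, normc (f x - f z) < e.
  by move=> e /H ?; apply/nbhs_normc.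
Qed.

End ComplexBasics.

(** * Real derivatives, real and imaginary parts, the complex exponential *)

Section RealComplexBridge.
Variable R : realType.
Local Notation C := R[i].
Implicit Types (z w h : C) (f g : C -> C).
Local Notation Re := (@complex.Re R).
Local Notation Im := (@complex.Im R).

Lemma is_derive_realP (f : R -> R) x l : is_derive x (1 : R) f l <->
  forall e : R, 0 < e -> exists2 d : R, 0 < d &
    forall h : R, `|h| < d -> `|f (x + h) - f x - l * h| <= e * `|h|.
Proof.
have eqv (h : R) : h != 0 -> `|h^-1 *: ((f \o shift x) (h *: 1) - f x) - l| * `|h|
   = `|f (x + h) - f x - l * h|.
  move=> h0; rewrite -normrM; congr (`|_|).
  rewrite /= [h *: 1]mulr1 (addrC h) mulrBl; congr (_ - _).
  by rewrite [_ *: _]mulrC mulfVK.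
split=> [[df dl] e e0|H].
- have : h^-1 *: ((f \o shift x) (h *: 1) - f x) @[h --> 0^'] --> l by rewrite -dl.
  move=> /cvgrPdist_lt /(_ e e0) /nbhs_ballP[d /= d0 dP]; exists d => // h hd.
  have [->|h0] := eqVneq h 0; first by rewrite addr0 subrr mulr0 subr0 normr0 mulr0.
  have := dP h; rewrite -ball_normE /= sub0r normrN => /(_ hd h0) hh.
  by rewrite -(eqv _ h0) ler_wpM2r// distrC ltW.
- have lim : h^-1 *: ((f \o shift x) (h *: 1) - f x) @[h --> 0^'] --> l.
    apply/cvgrPdist_lt => e e0; have e2 : 0 < e / 2 by rewrite divr_gt0.
    have [d d0 dP] := H _ e2; apply/nbhs_ballP; exists d => //= h.
    rewrite -ball_normE /= sub0r normrN => hd h0; have := dP _ hd; rewrite -(eqv _ h0).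
    rewrite ler_pM2r ?normr_gt0// distrC => /le_lt_trans; apply.
    by rewrite ltr_pdivrMr// mulr2n mulrDr mulr1 ltrDl.
  by apply: DeriveDef; [apply/cvg_ex; exists l | apply: cvg_lim].
Qed.

Lemma cReD z w : Re (z + w) = Re z + Re w. Proof. by case: z; case: w. Qed.
Lemma cImD z w : Im (z + w) = Im z + Im w. Proof. by case: z; case: w. Qed.
Lemma cReN z : Re (- z) = - Re z. Proof. by case: z. Qed.
Lemma cImN z : Im (- z) = - Im z. Proof. by case: z. Qed.
Lemma cReM z w : Re (z * w) = Re z * Re w - Im z * Im w.
Proof. by case: z; case: w. Qed.
Lemma cImM z w : Im (z * w) = Re z * Im w + Im z * Re w.
Proof. by case: z => a b; case: w => c d /=; rewrite (mulrC b). Qed.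
Lemma cRe0 : Re 0 = 0. Proof. by []. Qed.
Lemma cIm0 : Im 0 = 0. Proof. by []. Qed.
Lemma cRe1 : Re 1 = 1. Proof. by []. Qed.
Lemma cIm1 : Im 1 = 0. Proof. by []. Qed.
Definition cReImE := (cReD, cImD, cReN, cImN, cReM, cImM).

Lemma Re_real (x : R) : Re x%:C = x. Proof. by []. Qed.
Lemma Im_real (x : R) : Im x%:C = 0. Proof. by []. Qed.
Lemma Re_i : Re 'i = 0. Proof. by []. Qed.
Lemma Im_i : Im 'i = 1. Proof. by []. Qed.
Definition cRI := (cReImE, Re_real, Im_real, Re_i, Im_i, cRe1, cIm1, cRe0, cIm0,
  @mul0r R, @mulr0 R, @mul1r R, @mulr1 R, @oppr0 R, @subr0 R, @addr0 R, @add0r R, @sub0r R, @opprK R).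

Lemma cderiv_ReIm f (t : R) l : cderiv f t%:C l ->
  is_derive t (1 : R) (fun x => Re (f x%:C)) (Re l) /\
  is_derive t (1 : R) (fun x => Im (f x%:C)) (Im l).
Proof.
move=> df; split; apply/is_derive_realP => e e0;
  have [d d0 dP] := df e e0; exists d => // r hd;
  have := dP r%:C; rewrite normc_real => /(_ hd); apply: le_trans;
  rewrite -raddfD.
- by apply: le_trans (Re_le_normc _); rewrite !cReImE /= mulr0 subr0.
- by apply: le_trans (Im_le_normc _); rewrite !cReImE /= mulr0 add0r.
Qed.

Lemma complex_eqP z w : Re z = Re w -> Im z = Im w -> z = w.
Proof. by case: z => a b; case: w => c d /= -> ->. Qed.

Lemma cexpD z w : cexp (z + w) = cexp z * cexp w.
Proof.
rewrite /cexp !cReImE expRD sinD cosD.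
by apply: complex_eqP; rewrite !cReImE /=; ring.
Qed.

Lemma cexp0 : cexp (0 : C) = 1.
Proof. by rewrite /cexp /= expR0 cos0 sin0 mul1r. Qed.

Lemma normc_cexp z : normc (cexp z) = expR (Re z).
Proof.
by rewrite /cexp normcM normc_real /= cos2Dsin2 sqrtr1 mulr1 ger0_norm ?expR_ge0.
Qed.

Lemma cexp_neq0 z : cexp z != 0.
Proof. by rewrite -normc_eq0 normc_cexp gt_eqF ?expR_gt0. Qed.

Lemma cexpN z : cexp (- z) = (cexp z)^-1.
Proof.
by apply: (mulfI (cexp_neq0 z)); rewrite divff ?cexp_neq0// -cexpD subrr cexp0.
Qed.

Lemma cexp_real (x : R) : cexp x%:C = (expR x)%:C.
Proof. by rewrite /cexp /= cos0 sin0 mulr1. Qed.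

(** The addition theorem reduces everything to [z = 0], where first-order expansions of [expR],
    [cos] and [sin] suffice. Of the constant 6, three units come from the real part and three from
    the imaginary part: two each from the trigonometric error times [expR (Re h) <= 2], one each
    from the error of [expR]. *)
Lemma cderiv_cexp z : cderiv (@cexp R) z (cexp z).
Proof.
move=> e e0.
pose e' := Num.min (e / 6 / expR (Re z)) 1.
have e'0 : 0 < e' by rewrite lt_min ltr01 andbT !divr_gt0 ?expR_gt0.
have e'1 : e' <= 1 by rewrite ge_min lexx orbT.
have [d1 d10 H1] := (is_derive_realP _ _ _).1 (is_derive_expR (0 : R)) e' e'0.
have [d2 d20 H2] := (is_derive_realP _ _ _).1 (is_derive_cos (0 : R)) e' e'0.
have [d3 d30 H3] := (is_derive_realP _ _ _).1 (is_derive_sin (0 : R)) e' e'0.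
exists (Num.min (Num.min d1 d2) (Num.min d3 (e' / 2))) => [|h].
  by rewrite !lt_min d10 d20 d30 divr_gt0.
rewrite !lt_min => /andP[/andP[hd1 hd2] /andP[hd3 hd4]].
have hr := Re_le_normc h; have hi := Im_le_normc h.
have {H1}H1 := H1 _ (le_lt_trans hr hd1).
have {H2}H2 := H2 _ (le_lt_trans hi hd2).
have {H3}H3 := H3 _ (le_lt_trans hi hd3).
move: H1 H2 H3; rewrite !add0r expR0 cos0 sin0 mul1r oppr0 mul0r subr0 addr0 mul1r.
move=> H1 H2 H3.
rewrite cexpD -[X in _ - X - _]mulr1 -!mulrBr normcM normc_cexp.
suff H : normc (cexp h - 1 - h) <= 6 * e' * normc h.
  apply: le_trans (ler_wpM2l (expR_ge0 _) H) _.
  rewrite mulrA ler_wpM2r ?normc_ge0//.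
  have : e' <= e / 6 / expR (Re z) by rewrite ge_min lexx.
  rewrite ler_pdivlMr ?expR_gt0// => ?; lra.
have n0 := normc_ge0 h.
have hr4 : `|Re h| <= e' / 2 by rewrite (le_trans hr)// ltW.
have E1 : `|expR (Re h) - 1| <= e'.
  rewrite -[_ - 1](subrK (Re h)) (le_trans (ler_normD _ _))//.
  have := ler_wpM2r (normr_ge0 (Re h)) e'1; lra.
have E2 : expR (Re h) <= 2 by move: E1; rewrite ler_norml => /andP[_]; lra.
have E0 := expR_ge0 (Re h).
apply: le_trans (normc_le_ReIm _) _; rewrite /cexp !cReImE /=.
have -> : expR (Re h) * cos (Im h) - 0 * sin (Im h) + -1 - Re h =
  expR (Re h) * (cos (Im h) - 1) + (expR (Re h) - 1 - Re h) by ring.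
have -> : expR (Re h) * sin (Im h) + 0 * cos (Im h) - 0 - Im h =
  expR (Re h) * (sin (Im h) - Im h) + Im h * (expR (Re h) - 1) by ring.
have := ler_normD (expR (Re h) * (cos (Im h) - 1)) (expR (Re h) - 1 - Re h).
have := ler_normD (expR (Re h) * (sin (Im h) - Im h)) (Im h * (expR (Re h) - 1)).
rewrite !normrM (ger0_norm E0).
have : expR (Re h) * `|cos (Im h) - 1| <= 2 * (e' * normc h).
  by apply: ler_pM => //; apply: le_trans H2 _; rewrite ler_wpM2l// ltW.
have : expR (Re h) * `|sin (Im h) - Im h| <= 2 * (e' * normc h).
  by apply: ler_pM => //; apply: le_trans H3 _; rewrite ler_wpM2l// ltW.
have : `|Im h| * `|expR (Re h) - 1| <= normc h * e' by apply: ler_pM.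
have : e' * `|Re h| <= e' * normc h by rewrite ler_wpM2l// ltW.
lra.
Qed.

End RealComplexBridge.

Arguments ComplexField.Normc.normc : simpl never.
Arguments cexp : simpl never.
Arguments cintegral : simpl never.
Arguments real_complex_def : simpl never.

(** * Integrals of complex-valued functions of a real variable *)

Section Integrals.
Variable R : realType.
Local Notation C := R[i].
Local Notation mu := (@lebesgue_measure R).
Implicit Types (z w : C) (f g : R -> C) (D : set (measurableTypeR R)).
Local Notation Re := (@complex.Re R).
Local Notation Im := (@complex.Im R).

Lemma cintegrableD D f g : measurable D -> cintegrable D f -> cintegrable D g ->
  cintegrable D (fun x => f x + g x).
Proof.
move=> mD [f1 f2] [g1 g2]; split.
- apply: (eq_integrable mD _ _ _ (integrableD mD f1 g1)) => x _.
  by rewrite /= cReD EFinD.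
- apply: (eq_integrable mD _ _ _ (integrableD mD f2 g2)) => x _.
  by rewrite /= cImD EFinD.
Qed.

Lemma cintegrableZ D (c : C) f : measurable D -> cintegrable D f ->
  cintegrable D (fun x => c * f x).
Proof.
move=> mD [f1 f2]; split.
- have := integrableB mD (integrableZl mD (Re c) f1) (integrableZl mD (Im c) f2).
  by apply: (eq_integrable mD) => x _; rewrite /= cReM EFinB !EFinM.
- have := integrableD mD (integrableZl mD (Re c) f2) (integrableZl mD (Im c) f1).
  by apply: (eq_integrable mD) => x _; rewrite /= cImM EFinD !EFinM.
Qed.

Lemma cintegrableN D f : measurable D -> cintegrable D f ->
  cintegrable D (fun x => - f x).
Proof.
move=> mD /(cintegrableZ (-1) mD); congr (cintegrable D).
by apply/funext => x; rewrite mulN1r.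
Qed.

Lemma cintegrableB D f g : measurable D -> cintegrable D f -> cintegrable D g ->
  cintegrable D (fun x => f x - g x).
Proof. by move=> mD fi gi; apply: cintegrableD => //; apply: cintegrableN. Qed.

Lemma cintegrable_sum D (n : nat) (F : nat -> R -> C) : measurable D ->
  (forall i, (i < n)%N -> cintegrable D (F i)) ->
  cintegrable D (fun x => \sum_(i < n) F i x).
Proof.
move=> mD; elim: n => [|n IH] H.
  have -> : (fun x => \sum_(i < 0) F i x) = (fun=> 0).
    by apply/funext => x; rewrite big_ord0.
  by split; exact: integrable0.
have -> : (fun x => \sum_(i < n.+1) F i x) =
          (fun x => \sum_(i < n) F i x + F n x).
  by apply/funext => x; rewrite big_ord_recr.
by apply: cintegrableD => //; [apply: IH => i ?; apply: H; rewrite ltnS ltnW | exact: H].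
Qed.

Lemma eq_cintegral D f g : {in D, f =1 g} -> cintegral D f = cintegral D g.
Proof.
by move=> fg; congr (_ +i* _); apply: eq_Rintegral => x /fg ->.
Qed.

Lemma eq_cintegrable D f g : measurable D -> {in D, f =1 g} ->
  cintegrable D f -> cintegrable D g.
Proof.
by move=> mD fg [f1 f2]; split; [move: f1|move: f2]; apply: (eq_integrable mD) =>
  x /fg ->.
Qed.

Lemma cintegralD D f g : measurable D -> cintegrable D f -> cintegrable D g ->
  cintegral D (fun x => f x + g x) = cintegral D f + cintegral D g.
Proof.
move=> mD [f1 f2] [g1 g2].
apply: complex_eqP => /=.
- under eq_Rintegral do rewrite cReD.
  exact: (RintegralD mD f1 g1).
- under eq_Rintegral do rewrite cImD.
  exact: (RintegralD mD f2 g2).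
Qed.

Lemma cintegralZ D (c : C) f : measurable D -> cintegrable D f ->
  cintegral D (fun x => c * f x) = c * cintegral D f.
Proof.
move=> mD [f1 f2].
apply: complex_eqP; rewrite /= !cReImE /=.
- under eq_Rintegral do rewrite cReM.
  rewrite (@RintegralB _ _ _ _ D (fun x => Re c * Re (f x)) (fun x => Im c * Im (f x)))//.
  + by rewrite !RintegralZl.
  + exact: (integrableZl mD (Re c) f1).
  + exact: (integrableZl mD (Im c) f2).
- under eq_Rintegral do rewrite cImM.
  rewrite (@RintegralD _ _ _ _ D (fun x => Re c * Im (f x)) (fun x => Im c * Re (f x)))//.
  + by rewrite !RintegralZl.
  + exact: (integrableZl mD (Re c) f2).
  + exact: (integrableZl mD (Im c) f1).
Qed.

Lemma cintegralN D f : measurable D -> cintegrable D f ->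
  cintegral D (fun x => - f x) = - cintegral D f.
Proof.
move=> mD fi; rewrite -mulN1r -cintegralZ//.
by apply: eq_cintegral => x _; rewrite mulN1r.
Qed.

Lemma cintegralB D f g : measurable D -> cintegrable D f -> cintegrable D g ->
  cintegral D (fun x => f x - g x) = cintegral D f - cintegral D g.
Proof.
by move=> mD fi gi; rewrite -cintegralN// -cintegralD//; apply: cintegrableN.
Qed.

Lemma cintegral_sum D (n : nat) (F : nat -> R -> C) : measurable D ->
  (forall i, (i < n)%N -> cintegrable D (F i)) ->
  cintegral D (fun x => \sum_(i < n) F i x) = \sum_(i < n) cintegral D (F i).
Proof.
move=> mD; elim: n => [|n IH] H.
  rewrite big_ord0; under eq_cintegral do rewrite big_ord0.
  by rewrite /cintegral /= /Rintegral integral0.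
rewrite big_ord_recr /= -IH; last by move=> i ?; apply: H; rewrite ltnS ltnW.
rewrite -cintegralD//.
- by apply: eq_cintegral => x _; rewrite big_ord_recr.
- by apply: cintegrable_sum => // i ?; apply: H; rewrite ltnS ltnW.
- exact: H.
Qed.

(* The factor 2 comes from bounding the real and imaginary parts separately. *)
Lemma normc_cintegral_le D f (h : R -> R) : measurable D -> cintegrable D f ->
  mu.-integrable D (EFin \o h) -> (forall x, D x -> normc (f x) <= h x) ->
  normc (cintegral D f) <= 2 * \int[mu]_(x in D) h x.
Proof.
move=> mD [f1 f2] hi fh; apply: le_trans (normc_le_ReIm _) _.
rewrite mulr2n mulrDl !mul1r; apply: lerD => /=.
- apply: le_trans (le_normr_Rintegral mD f1) _.
  apply: le_Rintegral => //; first exact: integrable_norm.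
  by move=> x Dx; apply: le_trans (Re_le_normc _) (fh _ Dx).
- apply: le_trans (le_normr_Rintegral mD f2) _.
  apply: le_Rintegral => //; first exact: integrable_norm.
  by move=> x Dx; apply: le_trans (Im_le_normc _) (fh _ Dx).
Qed.

Lemma continuous_Re f x : {for x, continuous f} -> {for x, continuous (Re \o f)}.
Proof. by move=> /cvg_ReIm[]. Qed.

Lemma continuous_Im f x : {for x, continuous f} -> {for x, continuous (Im \o f)}.
Proof. by move=> /cvg_ReIm[]. Qed.

Lemma continuous_normc f x : {for x, continuous f} ->
  {for x, continuous (fun x => normc (f x))}.
Proof.
move=> /cvg_normc fc; apply/cvgrPdist_lt => e e0.
apply: filterS (fc e e0) => y; apply: le_lt_trans.
rewrite ler_norml lerBrDr addrC lerBlDr lerBlDr; apply/andP; split.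
- by rewrite -{1}[f y](subrK (f x)) addrC normcD.
- by rewrite normcB -{1}[f x](subrK (f y)) normcD.
Qed.

Definition continuous_between (T : topologicalType) (a b : R) (f : R -> T) :=
  forall x, a <= x <= b -> {for x, continuous f}.

Lemma continuous_between_within (T : topologicalType) (a b : R) (f : R -> T) :
  continuous_between a b f -> {within `[a, b], continuous f}.
Proof.
move=> cf; apply: continuous_in_subspaceT => x /[!inE]/=.
by rewrite in_itv /= => /cf.
Qed.

Lemma continuous_between_integrable (a b : R) (f : R -> R) :
  continuous_between a b f -> mu.-integrable `[a, b] (EFin \o f).
Proof.
move=> cf; apply: continuous_compact_integrable; first exact: segment_compact.
exact: continuous_between_within.
Qed.

Lemma continuous_between_cintegrable (a b : R) f :
  continuous_between a b f -> cintegrable `[a, b] f.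
Proof.
move=> cf; split; apply: continuous_between_integrable => x /cf.
- exact: continuous_Re.
- exact: continuous_Im.
Qed.

Lemma Rintegral_itv_cst (a b M : R) : a <= b ->
  \int[mu]_(x in `[a, b]) M = M * (b - a).
Proof.
move=> ab; rewrite (_ : (fun=> M) = cst M)// Rintegral_cst//=.
rewrite lebesgue_measure_itv /= lte_fin.
by case: ltgtP ab => //= -> _; rewrite subrr.
Qed.

Lemma normc_cintegral_bound (a b M : R) f : a <= b -> continuous_between a b f ->
  (forall x, a <= x <= b -> normc (f x) <= M) ->
  normc (cintegral `[a, b] f) <= 2 * (M * (b - a)).
Proof.
move=> ab cf fM; rewrite -Rintegral_itv_cst//.
apply: normc_cintegral_le => //.
- exact: continuous_between_cintegrable.
- by apply: (@continuous_between_integrable _ _ (cst M)) => x _; exact: cst_continuous.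
Qed.

Lemma Rintegral_split (a c b : R) (f : R -> R) : a <= c <= b ->
  mu.-integrable `[a, b] (EFin \o f) ->
  \int[mu]_(x in `[a, b]) f x =
  \int[mu]_(x in `[a, c]) f x + \int[mu]_(x in `[c, b]) f x.
Proof.
move=> /andP[ac cb] fi.
rewrite -(@Rintegral_itv_obnd_cbnd _ c); last first.
  apply: integrableS fi => // x; rewrite /= !in_itv /= => /andP[cx ->].
  by rewrite (le_trans ac (ltW cx)).
by rewrite -(@Rintegral_itvB _ f (BLeft a) (BRight b) c)// ?bnd_simp// addrC subrK.
Qed.

Lemma cintegral_split (a c b : R) f : a <= c <= b -> continuous_between a b f ->
  cintegral `[a, b] f = cintegral `[a, c] f + cintegral `[c, b] f.
Proof.
move=> acb /continuous_between_cintegrable[f1 f2].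
by apply: complex_eqP; rewrite !cReImE /=; exact: Rintegral_split.
Qed.

Lemma Rintegral_FTC2 (a b : R) (F f : R -> R) : a <= b ->
  (forall x, a <= x <= b -> is_derive x (1 : R) F (f x)) ->
  continuous_between a b f ->
  \int[mu]_(x in `[a, b]) f x = F b - F a.
Proof.
rewrite le_eqVlt => /predU1P[<- _ _|ab dF cf].
  by rewrite set_itv1 Rintegral_set1 subrr.
have Fc x : a <= x <= b -> {for x, continuous F}.
  by move=> /dF[/derivable1_diffP/differentiable_continuous].
rewrite /Rintegral (continuous_FTC2 ab (continuous_between_within cf) (F := F))//.
- split.
  + by move=> x; rewrite in_itv /= => /andP[/ltW ax /ltW xb]; case: (dF x _) => //; rewrite ax.
  + by apply: cvg_at_right_filter; apply: Fc; rewrite lexx ltW.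
  + by apply: cvg_at_left_filter; apply: Fc; rewrite lexx ltW.
- move=> x; rewrite in_itv /= => /andP[/ltW ax /ltW xb].
  by rewrite derive1E; case: (dF x _) => //; rewrite ax.
Qed.

Lemma cintegral_FTC2 (a b : R) (H h : C -> C) : a <= b ->
  (forall x, a <= x <= b -> cderiv H x%:C (h x%:C)) ->
  continuous_between a b (fun x => h x%:C) ->
  cintegral `[a, b] (fun x => h x%:C) = H b%:C - H a%:C.
Proof.
move=> ab dH ch; apply: complex_eqP; rewrite !cReImE /=.
- apply: (Rintegral_FTC2 (F := fun x => Re (H x%:C)) (f := fun x => Re (h x%:C))) => // x axb.
  + exact: (cderiv_ReIm (dH _ axb)).1.
  + exact: continuous_Re (ch x axb).
- apply: (Rintegral_FTC2 (F := fun x => Im (H x%:C)) (f := fun x => Im (h x%:C))) => // x axb.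
  + exact: (cderiv_ReIm (dH _ axb)).2.
  + exact: continuous_Im (ch x axb).
Qed.

Lemma continuous_real_complex (x : R) :
  {for x, continuous ((fun t : R => t%:C) : R -> C)}.
Proof. by apply/cvg_ReIm; split => /=; [exact: cvg_id | exact: cvg_cst]. Qed.

End Integrals.

(** * Goursat's theorem and smoothness *)

Section Goursat.
Variable R : realType.
Local Notation C := R[i].
Implicit Types (z w c : C) (f g F : C -> C) (x y l m : R).
Local Notation Re := (@complex.Re R).
Local Notation Im := (@complex.Im R).

Definition hedge f (a b y : R) : C := cintegral `[a, b] (fun t => f (t%:C + 'i * y%:C)).
Definition vedge f (a b x : R) : C := cintegral `[a, b] (fun t => 'i * f (x%:C + 'i * t%:C)).

(** Counterclockwise contour integral, with lower left corner [x + 'i * y], width [l] and height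
    [m]. The factor ['i] in [vedge] is the derivative of the parametrization of a vertical edge. *)
Definition boundary_integral f (x y l m : R) : C :=
  hedge f x (x + l) y - hedge f x (x + l) (y + m)
  + vedge f y (y + m) (x + l) - vedge f y (y + m) x.

Definition rectangle (x y l m : R) : set C :=
  [set w | x <= Re w <= x + l /\ y <= Im w <= y + m].

Lemma complexE' (a b : R) : a +i* b = a%:C + 'i * b%:C.
Proof. by rewrite [LHS]complexE. Qed.

Lemma Re_line (a b : R) : Re (a%:C + 'i * b%:C) = a.
Proof. by rewrite !cReImE /=; ring. Qed.

Lemma Im_line (a b : R) : Im (a%:C + 'i * b%:C) = b.
Proof. by rewrite !cReImE /=; ring. Qed.

Lemma continuous_hline f (y t : R) : {for t%:C + 'i * y%:C, continuous f} ->
  {for t, continuous (fun t : R => f (t%:C + 'i * y%:C))}.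
Proof.
apply: (ccont_comp (h := fun t : R => t%:C + 'i * y%:C)).
by apply: ccontD; [exact: continuous_real_complex | exact: ccont_cst].
Qed.

Lemma continuous_vline f (x t : R) : {for x%:C + 'i * t%:C, continuous f} ->
  {for t, continuous (fun t : R => 'i * f (x%:C + 'i * t%:C))}.
Proof.
move=> fc; apply: ccontM; first exact: ccont_cst.
apply: (ccont_comp (h := fun t : R => x%:C + 'i * t%:C)); last exact: fc.
apply: ccontD; first exact: ccont_cst.
by apply: ccontM; [exact: ccont_cst | exact: continuous_real_complex].
Qed.

Section Rectangle.
Variables (f : C -> C) (x y l m : R).
Hypotheses (l0 : 0 <= l) (m0 : 0 <= m).

Let cont := forall w, rectangle x y l m w -> {for w, continuous f}.

Lemma hedge_continuous t : cont -> y <= t <= y + m ->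
  continuous_between x (x + l) (fun s => f (s%:C + 'i * t%:C)).
Proof.
move=> fc yt s xs; apply: continuous_hline; apply: fc.
by split; rewrite ?Re_line ?Im_line.
Qed.

Lemma vedge_continuous s : cont -> x <= s <= x + l ->
  continuous_between y (y + m) (fun t => 'i * f (s%:C + 'i * t%:C)).
Proof.
move=> fc xs t yt; apply: continuous_vline; apply: fc.
by split; rewrite ?Re_line ?Im_line.
Qed.

Lemma lerDx : x <= x <= x + l. Proof. by rewrite lexx lerDl. Qed.
Lemma lerDy : y <= y <= y + m. Proof. by rewrite lexx lerDl. Qed.
Lemma lerDxl : x <= x + l <= x + l. Proof. by rewrite lexx lerDl l0. Qed.
Lemma lerDym : y <= y + m <= y + m. Proof. by rewrite lexx lerDl m0. Qed.

Lemma boundary_integral_primitive F : cont ->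
  (forall w, rectangle x y l m w -> cderiv F w (f w)) ->
  boundary_integral f x y l m = 0.
Proof.
move=> fc dF.
have H t : y <= t <= y + m -> hedge f x (x + l) t = F ((x + l)%:C + 'i * t%:C) - F (x%:C + 'i * t%:C).
  move=> yt; apply: (cintegral_FTC2 (H := fun w => F (w + 'i * t%:C)) (h := fun w => f (w + 'i * t%:C))).
  - by rewrite lerDl.
  - move=> s xs; rewrite -[f _]mulr1.
    apply: (cderiv_comp (g := F) (f := fun w => w + 'i * t%:C)).
    + rewrite -[1 in X in cderiv _ _ X]addr0.
      by apply: cderivD; [exact: cderiv_id | exact: cderiv_cst].
    + by apply: dF; split; rewrite ?Re_line ?Im_line.
  - exact: hedge_continuous.
have V s : x <= s <= x + l -> vedge f y (y + m) s = F (s%:C + 'i * (y + m)%:C) - F (s%:C + 'i * y%:C).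
  move=> xs; apply: (cintegral_FTC2 (H := fun w => F (s%:C + 'i * w)) (h := fun w => 'i * f (s%:C + 'i * w))).
  - by rewrite lerDl.
  - move=> t yt; rewrite mulrC.
    apply: (cderiv_comp (g := F) (f := fun w => s%:C + 'i * w)); first exact: cderiv_affine.
    by apply: dF; split; rewrite ?Re_line ?Im_line.
  - exact: vedge_continuous.
rewrite /boundary_integral !H ?V ?lerDy ?lerDx ?lerDxl ?lerDym//; ring.
Qed.

Lemma boundary_integralB g : cont ->
  (forall w, rectangle x y l m w -> {for w, continuous g}) ->
  boundary_integral (fun w => f w - g w) x y l m =
  boundary_integral f x y l m - boundary_integral g x y l m.
Proof.
move=> fc gc.
have H t : y <= t <= y + m ->
    hedge (fun w => f w - g w) x (x + l) t = hedge f x (x + l) t - hedge g x (x + l) t.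
  move=> yt; apply: cintegralB => //; apply: continuous_between_cintegrable => s xs;
    apply: continuous_hline; [apply: fc|apply: gc]; split; rewrite ?Re_line ?Im_line//.
have V s : x <= s <= x + l ->
    vedge (fun w => f w - g w) y (y + m) s = vedge f y (y + m) s - vedge g y (y + m) s.
  move=> xs; rewrite -cintegralB => //; first by apply: eq_cintegral => t _; rewrite mulrBr.
  - by apply: continuous_between_cintegrable; exact: vedge_continuous.
  - apply: continuous_between_cintegrable => t yt; apply: continuous_vline; apply: gc.
    by split; rewrite ?Re_line ?Im_line//.
rewrite /boundary_integral !H ?V ?lerDy ?lerDx ?lerDxl ?lerDym//; ring.
Qed.

(** The perimeter is [2 * (l + m)]; the other factor 2 is lost in [normc_cintegral_bound]. *)
Lemma boundary_integral_bound K : cont ->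
  (forall w, rectangle x y l m w -> normc (f w) <= K) ->
  normc (boundary_integral f x y l m) <= 4 * K * (l + m).
Proof.
move=> fc fK.
have H t : y <= t <= y + m -> normc (hedge f x (x + l) t) <= 2 * (K * l).
  move=> yt; rewrite [X in K * X](_ : l = x + l - x); last by ring.
  apply: normc_cintegral_bound; first by rewrite lerDl.
  - exact: hedge_continuous.
  - move=> s xs; apply: fK; split; rewrite ?Re_line ?Im_line//.
have V s : x <= s <= x + l -> normc (vedge f y (y + m) s) <= 2 * (K * m).
  move=> xs; rewrite [X in K * X](_ : m = y + m - y); last by ring.
  apply: normc_cintegral_bound; first by rewrite lerDl.
  - exact: vedge_continuous.
  - move=> t yt; rewrite normcM normci mul1r.
    by apply: fK; split; rewrite ?Re_line ?Im_line//.
have := H _ lerDy; have := H _ lerDym; have := V _ lerDx; have := V _ lerDxl.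
rewrite /boundary_integral.
have := normc_sub (hedge f x (x + l) y - hedge f x (x + l) (y + m)
  + vedge f y (y + m) (x + l)) (vedge f y (y + m) x).
have := normcD (hedge f x (x + l) y - hedge f x (x + l) (y + m)) (vedge f y (y + m) (x + l)).
have := normc_sub (hedge f x (x + l) y) (hedge f x (x + l) (y + m)).
lra.
Qed.

Lemma boundary_integral_split : cont ->
  boundary_integral f x y l m =
  boundary_integral f x y (l / 2) (m / 2)
  + boundary_integral f (x + l / 2) y (l / 2) (m / 2)
  + boundary_integral f x (y + m / 2) (l / 2) (m / 2)
  + boundary_integral f (x + l / 2) (y + m / 2) (l / 2) (m / 2).
Proof.
move=> fc.
have El : x + l / 2 + l / 2 = x + l by rewrite -addrA -splitr.
have Em : y + m / 2 + m / 2 = y + m by rewrite -addrA -splitr.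
have H t : y <= t <= y + m ->
    hedge f x (x + l) t = hedge f x (x + l / 2) t + hedge f (x + l / 2) (x + l) t.
  move=> yt; apply: cintegral_split; last exact: hedge_continuous.
  by move: l0; lra.
have V s : x <= s <= x + l ->
    vedge f y (y + m) s = vedge f y (y + m / 2) s + vedge f (y + m / 2) (y + m) s.
  move=> xs; apply: cintegral_split; last exact: vedge_continuous.
  by move: m0; lra.
rewrite /boundary_integral El Em (H _ lerDy) (H _ lerDym) (V _ lerDx) (V _ lerDxl).
by do 6 move: (hedge _ _ _ _) => ?; do 6 move: (vedge _ _ _ _) => ?; ring.
Qed.

End Rectangle.

Lemma nested_intervals (u d : nat -> R) :
  (forall n, 0 <= d n) -> (forall n, u n <= u n.+1) ->
  (forall n, u n.+1 + d n.+1 <= u n + d n) ->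
  exists c : R, forall n, u n <= c <= u n + d n.
Proof.
move=> d0 uS uD.
have um : {homo u : i j / (i <= j)%N >-> i <= j} by apply: homo_leq => //; exact: le_trans.
have ud i j : u i <= u j + d j.
  have [ij|/ltnW ji] := leqP i j.
    by rewrite (le_trans (um _ _ ij))// lerDl.
  rewrite (@le_trans _ _ (u i + d i)) ?lerDl//.
  elim: i ji => [|i IH]; first by rewrite leqn0 => /eqP ->.
  rewrite leq_eqVlt => /predU1P[->//|]; rewrite ltnS => /IH.
  exact: le_trans.
exists (sup (range u)) => n; apply/andP; split.
- apply: ub_le_sup; last by exists n.
  by exists (u 0%N + d 0%N) => _ [i _ <-].
- by apply: ge_sup; [exists (u 0%N), 0%N | move=> _ [i _ <-]].
Qed.

Lemma half_pow_lt (a e : R) : 0 < e -> exists n : nat, a / 2 ^+ n < e.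
Proof.
move=> e0; exists (Num.bound (a / e)).
rewrite ltr_pdivrMr ?exprn_gt0// mulrC -ltr_pdivrMr//.
have [a0|a0] := leP (a / e) 0.
  by rewrite (le_lt_trans a0)// exprn_gt0.
rewrite (lt_trans (archi_boundP (ltW a0)))//.
by rewrite -natrX ltr_nat ltn_expl.
Qed.

(** Pigeonhole principle of the bisection: one of the four quarters keeps at least a fourth of the
    integral. *)
Lemma normc_sum4_lt (s a b c d : C) : s = a + b + c + d ->
  normc a < normc s / 4 -> normc b < normc s / 4 -> normc c < normc s / 4 ->
  normc d < normc s / 4 -> False.
Proof.
move=> E.
have := normcD (a + b + c) d; have := normcD (a + b) c; have := normcD a b.
rewrite -E; lra.
Qed.

Lemma bisection_corner (a b : R) (p q : R * R) : 0 <= a -> 0 <= b ->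
  q \in [:: p; (p.1 + a / 2, p.2); (p.1, p.2 + b / 2); (p.1 + a / 2, p.2 + b / 2)] ->
  [/\ p.1 <= q.1, q.1 + a / 2 <= p.1 + a, p.2 <= q.2 & q.2 + b / 2 <= p.2 + b].
Proof. by move=> a0 b0; rewrite !inE => /or4P[] /eqP -> /=; split; lra. Qed.

(** Bisection: rectangles that keep at least a fourth of the integral at each step shrink to a point
    [c]. Near [c], [f] differs by [o(|w - c|)] from an affine function, which has a primitive. The
    integral over the [n]-th rectangle is therefore [o(4^-n)], against the lower bound
    [T / 4 ^+ n]. *)
Theorem goursat f (x y l m : R) : 0 <= l -> 0 <= m ->
  (forall w, rectangle x y l m w -> derivable f w 1) ->
  boundary_integral f x y l m = 0.
Proof.
move=> l0 m0 df; apply/eqP; apply: contraT => T0.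
pose B (p : R * R) n := boundary_integral f p.1 p.2 (l / 2 ^+ n) (m / 2 ^+ n).
pose T := normc (B (x, y) 0%N).
have {T0}T0 : 0 < T by rewrite normc_gt0 /B /= expr0 !divr1.
have fc w : rectangle x y l m w -> {for w, continuous f}.
  by move=> /df/derivable_cderiv; exact: cderiv_cont.
pose cand (p : R * R) n : seq (R * R) :=
  [:: p; (p.1 + l / 2 ^+ n.+1, p.2); (p.1, p.2 + m / 2 ^+ n.+1);
      (p.1 + l / 2 ^+ n.+1, p.2 + m / 2 ^+ n.+1)].
pose good p n q := normc (B p n) / 4 <= normc (B q n.+1).
(* The first quarter whose integral is large enough; [nextP] shows that there is one as long as the
   current rectangle lies in the original one. *)
pose next p n := nth p (cand p n) (find (good p n) (cand p n)).
pose r := fix r n := if n is n.+1 then next (r n) n else (x, y).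
have E2 (a : R) n : a / 2 ^+ n.+1 = a / 2 ^+ n / 2.
  by rewrite exprSr invfM mulrA.
have nextP p n : (x <= p.1) && (p.1 + l / 2 ^+ n <= x + l) ->
    (y <= p.2) && (p.2 + m / 2 ^+ n <= y + m) ->
    good p n (next p n) /\ next p n \in cand p n.
  move=> /andP[px1 px2] /andP[py1 py2].
  suff h : has (good p n) (cand p n).
    by split; [exact: nth_find | rewrite mem_nth// -has_find].
  apply: contraT => /hasPn H.
  have small q : q \in cand p n -> normc (B q n.+1) < normc (B p n) / 4.
    by move=> /H; rewrite /good -ltNge.
  have dl : 0 <= l / 2 ^+ n by rewrite divr_ge0// exprn_ge0.
  have dm : 0 <= m / 2 ^+ n by rewrite divr_ge0// exprn_ge0.
  have cp w : rectangle p.1 p.2 (l / 2 ^+ n) (m / 2 ^+ n) w -> {for w, continuous f}.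
    by move=> [wx wy]; apply: fc; split; lra.
  have := @boundary_integral_split f p.1 p.2 _ _ dl dm cp.
  rewrite -!E2 -/(B p n) -/(B p n.+1).
  rewrite -/(B (p.1 + l / 2 ^+ n.+1, p.2) n.+1) -/(B (p.1, p.2 + m / 2 ^+ n.+1) n.+1).
  rewrite -/(B (p.1 + l / 2 ^+ n.+1, p.2 + m / 2 ^+ n.+1) n.+1).
  by move/normc_sum4_lt; case; apply: small; rewrite !inE eqxx ?orbT.
have rP n : [/\ (x <= (r n).1) && ((r n).1 + l / 2 ^+ n <= x + l),
   (y <= (r n).2) && ((r n).2 + m / 2 ^+ n <= y + m) & T / 4 ^+ n <= normc (B (r n) n)].
  elim: n => [|n [/[dup] I1 /andP[h1 h2] /[dup] I2 /andP[h3 h4] IH]].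
    by rewrite /= !expr0 !divr1 !lexx.
  have [g c] := nextP (r n) n I1 I2.
  have dl : 0 <= l / 2 ^+ n by rewrite divr_ge0// exprn_ge0.
  have dm : 0 <= m / 2 ^+ n by rewrite divr_ge0// exprn_ge0.
  have Tg : T / 4 ^+ n.+1 <= normc (B (r n.+1) n.+1).
    apply: le_trans g; rewrite exprSr invfM mulrA ler_wpM2r// invr_ge0//.
  move: c; rewrite /cand !E2 => /(bisection_corner dl dm)[k1 k2 k3 k4].
  split; last exact: Tg.
  - by rewrite (le_trans h1 k1) (le_trans k2 h2).
  - by rewrite (le_trans h3 k3) (le_trans k4 h4).
have rS n : ((r n).1 <= (r n.+1).1 /\ (r n.+1).1 + l / 2 ^+ n.+1 <= (r n).1 + l / 2 ^+ n)
  /\ ((r n).2 <= (r n.+1).2 /\ (r n.+1).2 + m / 2 ^+ n.+1 <= (r n).2 + m / 2 ^+ n).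
  have [I1 I2 _] := rP n; have [_ ] := nextP (r n) n I1 I2.
  have dl : 0 <= l / 2 ^+ n by rewrite divr_ge0// exprn_ge0.
  have dm : 0 <= m / 2 ^+ n by rewrite divr_ge0// exprn_ge0.
  by rewrite /cand !E2 => /(bisection_corner dl dm)[].
have [cx cxP] := @nested_intervals (fun n => (r n).1) (fun n => l / 2 ^+ n)
  (fun n => divr_ge0 l0 (exprn_ge0 n (ler0n _ 2))) (fun n => (rS n).1.1) (fun n => (rS n).1.2).
have [cy cyP] := @nested_intervals (fun n => (r n).2) (fun n => m / 2 ^+ n)
  (fun n => divr_ge0 m0 (exprn_ge0 n (ler0n _ 2))) (fun n => (rS n).2.1) (fun n => (rS n).2.2).
pose c : C := cx%:C + 'i * cy%:C.
have rc : rectangle x y l m c.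
  split; rewrite ?Re_line ?Im_line.
  - by have := cxP 0%N; rewrite /= expr0 divr1.
  - by have := cyP 0%N; rewrite /= expr0 divr1.
have /derivable_cderiv dfc := df _ rc.
set f' := 'D_1 f c in dfc.
have lm0 : 0 < l + m + 1 by rewrite ltr_wpDl// addr_ge0.
(* The final comparison is [T <= 4 * e * (l + m) ^+ 2] against [T = 8 * e * (l + m + 1) ^+ 2]. The
   [+ 1] keeps the denominator nonzero when [l = m = 0]. *)
pose e := T / (8 * (l + m + 1) ^+ 2).
have e0 : 0 < e by rewrite divr_gt0// mulr_gt0// exprn_gt0.
have [d d0 dP] := dfc e e0.
have [n hn] := half_pow_lt (l + m + 1) d0.
have pn : 0 < 2 ^+ n :> R by rewrite exprn_gt0.
have [I1 I2 Tn] := rP n.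
(* The affine part of [f] at [c], then a primitive of it: subtracting [g] does not change the
   boundary integral. *)
pose g w := (f c - f' * c) + f' * w.
pose G w := (f c - f' * c) * w + f' / 2 * w ^+ 2.
have dl : 0 <= l / 2 ^+ n by rewrite divr_ge0// exprn_ge0.
have dm : 0 <= m / 2 ^+ n by rewrite divr_ge0// exprn_ge0.
have subr w : rectangle (r n).1 (r n).2 (l / 2 ^+ n) (m / 2 ^+ n) w -> rectangle x y l m w.
  by move=> [w1 w2]; split; lra.
have gc w : {for w, continuous g} by apply: cderiv_cont; exact: cderiv_affine.
have dG w : cderiv G w (g w).
  move=> e' e'0.
  exists (e' / (normc (f' / 2) + 1)) => [|h hh].
    by rewrite divr_gt0// ltr_wpDl ?normc_ge0.
  have -> : G (w + h) - G w - g w * h = f' / 2 * h * h.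
    by rewrite /G /g; field.
  rewrite normcM ler_wpM2r ?normc_ge0// normcM.
  move: hh; rewrite ltr_pdivlMr ?ltr_wpDl ?normc_ge0// => /ltW; apply: le_trans.
  by rewrite mulrC ler_wpM2l ?normc_ge0// lerDl.
have Bg : boundary_integral g (r n).1 (r n).2 (l / 2 ^+ n) (m / 2 ^+ n) = 0.
  by apply: (boundary_integral_primitive dl dm (F := G)).
have Bf : B (r n) n = boundary_integral (fun w => f w - g w) (r n).1 (r n).2 (l / 2 ^+ n) (m / 2 ^+ n).
  by rewrite (boundary_integralB dl dm (fun w h => fc w (subr w h)) (fun w _ => gc w)) Bg subr0.
have Bb : normc (B (r n) n) <= 4 * (e * ((l + m) / 2 ^+ n)) * (l / 2 ^+ n + m / 2 ^+ n).
  rewrite Bf; apply: boundary_integral_bound; [exact: dl|exact: dm|..].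
    move=> w wr; apply: ccontB; [exact: (fc w (subr w wr)) | exact: (gc w)].
  move=> w [w1 w2].
  have hw : normc (w - c) <= (l + m) / 2 ^+ n.
    apply: le_trans (normc_le_ReIm _) _.
    rewrite mulrDl; apply: lerD; rewrite !(cReD, cImD, cReN, cImN) ?Re_line ?Im_line ler_norml.
      by have := cxP n; move: w1; rewrite /=; lra.
    by have := cyP n; move: w2; rewrite /=; lra.
  have hd : normc (w - c) < d.
    apply: le_lt_trans hw (le_lt_trans _ hn).
    by rewrite ler_pM2r ?invr_gt0// lerDl.
  have := dP _ hd; rewrite (_ : c + (w - c) = w); last by ring.
  have -> : f w - f c - f' * (w - c) = f w - g w by rewrite /g; ring.
  by move/le_trans; apply; rewrite ler_wpM2l// ltW.
move: (le_trans Tn Bb); rewrite -mulrDl.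
have -> : 4 * (e * ((l + m) / 2 ^+ n)) * ((l + m) / 2 ^+ n) =
  (4 * e * (l + m) ^+ 2) / 4 ^+ n.
  have -> : 4 ^+ n = 2 ^+ n * 2 ^+ n :> R by rewrite -exprMn -natrM.
  by field; rewrite gt_eqF.
rewrite ler_pM2r ?invr_gt0 ?exprn_gt0//.
have -> : T = 8 * e * (l + m + 1) ^+ 2.
  by rewrite /e; field; rewrite gt_eqF.
have : (l + m) ^+ 2 <= (l + m + 1) ^+ 2 by rewrite ler_sqr ?nnegrE ?lerDl// ?addr_ge0// ltW.
move=> h1 h2.
have : e * (l + m) ^+ 2 <= e * (l + m + 1) ^+ 2 by rewrite ler_wpM2l// ltW.
have : 0 < e * (l + m + 1) ^+ 2 by rewrite mulr_gt0// exprn_gt0.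
lra.
Qed.

End Goursat.

(** * Uniformity on segments and integrals depending on a parameter *)

Section SegmentEstimates.
Variable R : realType.
Local Notation C := R[i].
Implicit Types (z w : C) (f F : C -> C) (a b : R).
Local Notation Re := (@complex.Re R).
Local Notation Im := (@complex.Im R).

(* Compactness of `[a, b]: a property of points and small scales that holds
   locally holds uniformly. *)
Lemma segment_uniform (a b : R) (P : R -> R -> Prop) :
  (forall t, a <= t <= b -> exists2 d : R, 0 < d & forall e s : R,
     0 < e < d -> `|s - t| < d -> P e s) ->
  exists2 d : R, 0 < d & forall e t : R, 0 < e < d -> a <= t <= b -> P e t.
Proof.
move=> H.
have /compact_near_coveringP/near_covering_withinP := @segment_compact R a b.
move=> /(_ R (0 : R)^'+ P _) [].
  move=> t /=; rewrite in_itv /= => tab; have [d d0 dP] := H t tab.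
  exists ([set s | `|s - t| < d], [set e | 0 < e < d]) => /=.
    split; first by apply/nbhs_ballP; exists d => //= s; rewrite /ball /= distrC.
    by near=> e; apply/andP; split; near: e; [exact: nbhs_right_gt | exact: nbhs_right_lt].
  by move=> [s e] /= [s1 s2] _; exact: dP.
move=> d /= d0 dP; exists d => // e t /andP[e0 ed] tab; apply: dP => //=.
- by rewrite sub0r normrN gtr0_norm.
Unshelve. all: by end_near. Qed.

(** Boundedness is phrased by a scale, [normc (g s) <= e^-1], so that the uniform scale of
    [segment_uniform] yields the bound. *)
Lemma continuous_between_bounded a b (g : R -> C) : continuous_between a b g ->
  exists2 M : R, 0 < M & forall x, a <= x <= b -> normc (g x) <= M.
Proof.
move=> gc.
have [t /gc /cvg_normc /(_ 1 ltr01) gt|d d0 dP] := @segment_uniform a b (fun e s => normc (g s) <= e^-1).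
  have M0 : 0 < normc (g t) + 1 by rewrite ltr_wpDl ?normc_ge0.
  move: gt => /nbhs_ballP[d /= d0 dP].
  exists (Num.min d (normc (g t) + 1)^-1) => [|e s]; first by rewrite lt_min d0 invr_gt0.
  rewrite !lt_min => /and3P[e0 ed eM] /andP[sd _].
  apply: (@le_trans _ _ (normc (g t) + 1)).
    rewrite -[g s](subrK (g t)) (le_trans (normcD _ _))// addrC lerD2l ltW//.
    by apply: dP; rewrite /ball /= distrC.
  by rewrite -[leLHS]invrK lef_pV2 ?posrE ?invr_gt0// ltW.
exists ((d / 2)^-1) => [|x xab]; first by rewrite invr_gt0 divr_gt0.
by apply: dP => //; rewrite divr_gt0//= ltr_pdivrMr// mulr2n mulrDr mulr1 ltrDl.
Qed.

Lemma continuous_segment f w k s : {for w + s%:C * k, continuous f} ->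
  {for s, continuous (fun s : R => f (w + s%:C * k))}.
Proof.
apply: (ccont_comp (h := fun s : R => w + s%:C * k)).
apply: ccontD; first exact: ccont_cst.
by apply: ccontM; [exact: continuous_real_complex | exact: ccont_cst].
Qed.

Lemma cintegral_segment F f w k : (forall s : R, 0 <= s <= 1 ->
    cderiv F (w + s%:C * k) (f (w + s%:C * k)) /\ {for w + s%:C * k, continuous f}) ->
  cintegral `[0, 1] (fun s => k * f (w + s%:C * k)) = F (w + k) - F w.
Proof.
move=> H.
rewrite (cintegral_FTC2 (H := fun s => F (w + s * k)) (h := fun s => k * f (w + s * k))).
- by rewrite mul1r mul0r addr0.
- exact: ler01.
- move=> s s01; rewrite mulrC.
  apply: (cderiv_comp (g := F) (f := fun s => w + s * k)); last exact: (H s s01).1.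
  have := cderiv_affine w k s%:C; congr (cderiv _ _ _).
  by apply/funext => t; rewrite mulrC.
- move=> s s01; apply: ccontM; first exact: ccont_cst.
  exact: continuous_segment (H s s01).2.
Qed.

(** The left-hand quantity is the integral of [(f (w + s * k) - f w) * k] for [s] from 0 to 1. *)
Lemma cderiv_segment_bound F f w k (e : R) : (forall s : R, 0 <= s <= 1 ->
    [/\ cderiv F (w + s%:C * k) (f (w + s%:C * k)), {for w + s%:C * k, continuous f} &
        normc (f (w + s%:C * k) - f w) <= e]) ->
  normc (F (w + k) - F w - f w * k) <= 2 * (e * normc k).
Proof.
move=> H.
rewrite -(cintegral_segment (f := f)); last by move=> s /H[].
have cf : continuous_between 0 1 (fun s : R => k * f (w + s%:C * k)).
  move=> s /H[_ fc _]; apply: ccontM; first exact: ccont_cst.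
  exact: continuous_segment fc.
have cw : continuous_between 0 1 (fun s : R => f w * k) by move=> s _; exact: ccont_cst.
have -> : f w * k = cintegral `[0, 1] (fun s : R => f w * k).
  rewrite (cintegral_FTC2 (H := fun s => 0 + (f w * k) * s) (h := fun s => f w * k)).
  - by rewrite mulr1 mulr0 addr0 subr0 add0r.
  - exact: ler01.
  - by move=> s _; exact: cderiv_affine.
  - by move=> s _; exact: ccont_cst.
rewrite -cintegralB; last 3 first.
- exact: measurable_itv.
- exact: continuous_between_cintegrable cf.
- exact: continuous_between_cintegrable cw.
rewrite -[X in _ <= 2 * X]mulr1 -[X in 2 * (_ * X)]subr0.
apply: normc_cintegral_bound; first exact: ler01.
- by move=> s s01; apply: ccontB; [exact: cf s01 | exact: cw s01].
- move=> s /H[_ _ he]; have -> : k * f (w + s%:C * k) - f w * k = (f (w + s%:C * k) - f w) * k by ring.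
  by rewrite normcM ler_wpM2r ?normc_ge0.
Qed.

Section ParamIntegral.
Variables (U : set C) (F f : C -> C) (al be ga : R -> C) (a b : R) (z0 : C).
Hypotheses (Uo : open U) (ab : a <= b).
Hypotheses (alc : continuous_between a b al) (bec : continuous_between a b be)
  (gac : continuous_between a b ga).
Hypothesis Uz0 : forall t, a <= t <= b -> U (al t + z0 * be t).

(** Points [al t + z * be t] cover both families used later: circles around [z] (with [be = 1]) and
    segments from a fixed point to [z] (with [be t = t]). Compactness makes the admissible
    perturbation of [z0] independent of [t]. *)
Lemma param_uniform (g : C -> C) (e : R) : 0 < e -> (forall w, U w -> {for w, continuous g}) ->
  exists2 d : R, 0 < d & forall t h, a <= t <= b -> normc h < d ->
    U (al t + (z0 + h) * be t) /\
    normc (g (al t + (z0 + h) * be t) - g (al t + z0 * be t)) <= e.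
Proof.
move=> e0 gc.
have [t tab|d d0 dP] := @segment_uniform a b (fun e' s => forall h, normc h < e' ->
    U (al s + (z0 + h) * be s) /\
    normc (g (al s + (z0 + h) * be s) - g (al s + z0 * be s)) <= e); last first.
  exists (d / 2) => [|t h tab hd]; first by rewrite divr_gt0.
  apply: (dP (d / 2)) => //; rewrite divr_gt0//= ltr_pdivrMr//.
  by rewrite mulr2n mulrDr mulr1 ltrDl.
set w := al t + z0 * be t.
have Uw : U w := Uz0 tab.
have /nbhs_normc[d1 d10 d1P] : nbhs w U by exact: open_nbhs_nbhs.
have [d2 d20 d2P] := (ccontP _ _).1 (gc _ Uw) (e / 2) (divr_gt0 e0 ltr02).
pose d := Num.min d1 d2.
have d0 : 0 < d by rewrite lt_min d10.
pose M := normc (be t) + 1.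
have M0 : 0 < M by rewrite ltr_wpDl ?normc_ge0.
have /cvg_normc/(_ (d / 2) (divr_gt0 d0 ltr02)) cc : {for t, continuous (fun s => al s + z0 * be s)}.
  by apply: ccontD; [exact: alc tab|apply: ccontM; [exact: ccont_cst|exact: bec tab]].
have /cvg_normc/(_ 1 ltr01) cb := bec tab.
have [d3 /= d30 d3P] := (nbhs_ballP (t : R) _).1 (filterI cc cb).
exists (Num.min d3 (d / 2 / M)) => [|e' s]; first by rewrite lt_min d30 !divr_gt0.
rewrite !lt_min => /and3P[e'0 _ e'd] /andP[sd _] h he'.
have [] := d3P s; first by rewrite /ball /= distrC.
rewrite /= => s1 s2.
have bM : normc (be s) <= M.
  by rewrite -[be s](subrK (be t)) (le_trans (normcD _ _))// addrC lerD2l ltW.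
have s3 : normc (al s + (z0 + h) * be s - w) < d.
  have -> : al s + (z0 + h) * be s - w = (al s + z0 * be s - w) + h * be s by ring.
  apply: le_lt_trans (normcD _ _) _; rewrite [d]splitr ltr_leD//.
  have := lt_trans he' e'd; rewrite ltr_pdivlMr// => /ltW; apply: le_trans.
  by rewrite normcM ler_wpM2l// normc_ge0.
have s4 : normc (al s + z0 * be s - w) < d.
  by rewrite (lt_trans s1)// ltr_pdivrMr// mulr2n mulrDr mulr1 ltrDl.
split; first by apply: d1P; rewrite (lt_le_trans s3)// ge_min lexx.
have g1 : normc (g (al s + (z0 + h) * be s) - g w) < e / 2.
  by apply: d2P; rewrite (lt_le_trans s3)// ge_min lexx orbT.
have g2 : normc (g (al s + z0 * be s) - g w) < e / 2.
  by apply: d2P; rewrite (lt_le_trans s4)// ge_min lexx orbT.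
rewrite [X in normc X](_ : _ = (g (al s + (z0 + h) * be s) - g w) - (g (al s + z0 * be s) - g w)); last by ring.
by rewrite (le_trans (normc_sub _ _))// [e]splitr lerD// ltW.
Qed.

Lemma param_integrand_cont (g : C -> C) z : (forall w, U w -> {for w, continuous g}) ->
  (forall t, a <= t <= b -> U (al t + z * be t)) ->
  continuous_between a b (fun t => g (al t + z * be t) * ga t).
Proof.
move=> gc zU t tab; apply: ccontM; last exact: gac tab.
apply: (ccont_comp (h := fun t => al t + z * be t)); last exact: gc (zU t tab).
by apply: ccontD; [exact: alc tab|apply: ccontM; [exact: ccont_cst|exact: bec tab]].
Qed.

Lemma param_integral_cont : (forall w, U w -> {for w, continuous F}) ->
  {for z0, continuous (fun z => cintegral `[a, b] (fun t => F (al t + z * be t) * ga t))}.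
Proof.
move=> Fc; apply/ccontP => e e0.
have [M M0 MP] := continuous_between_bounded gac.
pose K := 4 * M * (b - a + 1).
have ba0 : 0 < b - a + 1 by rewrite ltr_wpDl// subr_ge0.
have K0 : 0 < K by rewrite !mulr_gt0.
have [d d0 dP] := param_uniform (divr_gt0 e0 K0) Fc.
exists d => // z zd.
have zh : z = z0 + (z - z0) by ring.
have zU t : a <= t <= b -> U (al t + z * be t).
  by move=> tab; have [] := dP _ _ tab zd; rewrite -zh.
have c1 := param_integrand_cont Fc zU; have c2 := param_integrand_cont Fc Uz0.
rewrite -cintegralB; last 3 first.
- exact: measurable_itv.
- exact: continuous_between_cintegrable c1.
- exact: continuous_between_cintegrable c2.
apply: (@le_lt_trans _ _ (2 * (e / K * M * (b - a)))).
  apply: normc_cintegral_bound; first exact: ab.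
  - by move=> t tab; apply: ccontB; [exact: c1 tab|exact: c2 tab].
  - move=> t tab; rewrite -mulrBl normcM; apply: ler_pM; rewrite ?normc_ge0 ?MP//.
    by have [_] := dP _ _ tab zd; rewrite -zh.
have -> : 2 * (e / K * M * (b - a)) = e * ((b - a) / (b - a + 1) / 2).
  by rewrite /K; field; rewrite !gt_eqF.
rewrite gtr_pMr// ltr_pdivrMr// ltr_pdivrMr//; lra.
Qed.

Lemma param_integral_cderiv : (forall w, U w -> cderiv F w (f w)) ->
  (forall w, U w -> {for w, continuous f}) ->
  cderiv (fun z => cintegral `[a, b] (fun t => F (al t + z * be t) * ga t)) z0
    (cintegral `[a, b] (fun t => f (al t + z0 * be t) * (be t * ga t))).
Proof.
move=> dF fc e e0.
have Fc w : U w -> {for w, continuous F} by move=> /dF; exact: cderiv_cont.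
have [M M0 MP] := continuous_between_bounded gac.
have [N N0 NP] := continuous_between_bounded bec.
pose K := 4 * (M * N) * (b - a + 1).
have ba0 : 0 < b - a + 1 by rewrite ltr_wpDl// subr_ge0.
have K0 : 0 < K by rewrite !mulr_gt0.
have [d d0 dP] := param_uniform (divr_gt0 e0 K0) fc.
exists d => // h hd.
have zU t : a <= t <= b -> U (al t + (z0 + h) * be t) by move=> tab; have [] := dP _ _ tab hd.
have c1 := param_integrand_cont Fc zU; have c2 := param_integrand_cont Fc Uz0.
have c3 : continuous_between a b (fun t => f (al t + z0 * be t) * (be t * ga t)).
  move=> t tab; rewrite (_ : (fun _ => _) = (fun t => (f (al t + z0 * be t) * ga t) * be t)).
    by apply: ccontM; [exact: (param_integrand_cont fc Uz0 tab)|exact: bec tab].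
  by apply/funext => s; ring.
have c4 : continuous_between a b (fun t => h * (f (al t + z0 * be t) * (be t * ga t))).
  by move=> t tab; apply: ccontM; [exact: ccont_cst|exact: c3 tab].
have i1 := continuous_between_cintegrable c1.
have i2 := continuous_between_cintegrable c2.
have i3 := continuous_between_cintegrable c3.
have i4 := continuous_between_cintegrable c4.
have mI : measurable (`[a, b]%classic : set (measurableTypeR R)) by exact: measurable_itv.
rewrite -(cintegralB mI i1 i2) [_ * h]mulrC -(cintegralZ _ mI i3).
rewrite -(cintegralB mI (cintegrableB mI i1 i2) i4).
apply: (@le_trans _ _ (2 * (2 * (e / K * normc h * N) * M * (b - a)))).
  apply: normc_cintegral_bound; first exact: ab.
  - move=> t tab; apply: ccontB; last exact: c4 tab.
    by apply: ccontB; [exact: c1 tab|exact: c2 tab].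
  - move=> t tab; set w := al t + z0 * be t.
    have -> : al t + (z0 + h) * be t = w + h * be t by rewrite /w; ring.
    (* Up to the factor [ga t] this is the first-order error of [F] at [w] with increment
       [h * be t], which is small as soon as [f] varies by at most [e / K] along that increment. *)
    have -> : F (w + h * be t) * ga t - F w * ga t - h * (f w * (be t * ga t)) =
      (F (w + h * be t) - F w - f w * (h * be t)) * ga t by ring.
    rewrite normcM; apply: ler_pM; rewrite ?normc_ge0 ?MP//.
    apply: le_trans (@cderiv_segment_bound F f w (h * be t) (e / K) _) _.
      move=> s /andP[s0 s1].
      have E : w + s%:C * (h * be t) = al t + (z0 + s%:C * h) * be t by rewrite /w; ring.
      have shd : normc (s%:C * h) < d.
        rewrite normcM normc_real ger0_norm//; apply: le_lt_trans hd.
        by rewrite ler_piMl ?normc_ge0.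
      by have [Us fs] := dP _ _ tab shd; rewrite E; split => //; [exact: dF | exact: (fc _ Us)].
    apply: ler_wpM2l => //; rewrite -[X in _ <= X]mulrA.
    apply: ler_wpM2l; first by rewrite ltW// divr_gt0.
    by rewrite normcM; apply: ler_wpM2l; [exact: normc_ge0 | exact: NP].
have -> : 2 * (2 * (e / K * normc h * N) * M * (b - a)) =
    e * normc h * ((b - a) / (b - a + 1)).
  by rewrite /K; field; rewrite !gt_eqF.
rewrite ler_piMr ?mulr_ge0 ?normc_ge0 ?ltW//.
by rewrite ltr_pdivrMr// mul1r ltrDl.
Qed.

End ParamIntegral.
End SegmentEstimates.

(** * Cauchy's formula for the derivative *)

Section Smoothness.
Variable R : realType.
Local Notation C := R[i].
Implicit Types (z w : C) (f g F : C -> C) (a b : R).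
Local Notation Re := (@complex.Re R).
Local Notation Im := (@complex.Im R).

Lemma real_complexD (x y : R) : (x + y)%:C = x%:C + y%:C :> C.
Proof. exact: rmorphD. Qed.

Lemma real_complexM (x y : R) : (x * y)%:C = x%:C * y%:C :> C.
Proof. exact: rmorphM. Qed.

Lemma real_complexN (x : R) : (- x)%:C = - x%:C :> C.
Proof. exact: rmorphN. Qed.

Lemma real_complexV (x : R) : (x^-1)%:C = (x%:C)^-1 :> C.
Proof. exact: fmorphV. Qed.

Lemma real_complex_nat (n : nat) : (n%:R)%:C = n%:R :> C.
Proof. exact: rmorph_nat. Qed.

Lemma real_complex_eq0 (x : R) : (x%:C == 0 :> C) = (x == 0).
Proof. exact: fmorph_eq0. Qed.

Lemma i_neq0 : ('i : C) != 0.
Proof. by rewrite -normc_eq0 normci oner_eq0. Qed.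

Lemma ii : ('i : C) * 'i = -1.
Proof. by rewrite -expr2 sqr_i. Qed.

Lemma cexp_2pi : cexp ('i * (2 * pi)%:C : C) = 1.
Proof.
rewrite /cexp !cRI expR0 mulr_natl cos2pi sin2pi.
by apply: complex_eqP; rewrite !cRI.
Qed.

Lemma cintegral_cst a b (c : C) : a <= b ->
  cintegral `[a, b] (fun=> c) = (b - a)%:C * c.
Proof.
move=> ab; rewrite (cintegral_FTC2 (H := fun s => 0 + c * s) (h := fun s => c)) => //.
- by rewrite real_complexD real_complexN; ring.
- by move=> s _; exact: cderiv_affine.
- by move=> s _; exact: ccont_cst.
Qed.

Lemma cderiv_cexpZ (d z : C) : cderiv (fun w => cexp (d * w)) z (cexp (d * z) * d).
Proof.
have := cderiv_comp (cderivZ d (cderiv_id z)) (cderiv_cexp _).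
by move/cderiv_eq; apply; rewrite mulr1.
Qed.

Lemma cexp_line_cont (d : C) (t : R) : {for t, continuous (fun t : R => cexp (d * t%:C))}.
Proof.
have Hc := cderiv_cont (cderiv_cexpZ d t%:C).
exact: (ccont_comp (h := fun t : R => t%:C) (@continuous_real_complex _ t) Hc).
Qed.

Lemma cintegral_cexpNi :
  cintegral `[0, 2 * pi] (fun t : R => cexp (- 'i * t%:C)) = 0.
Proof.
have pi0 : 0 <= 2 * pi :> R by rewrite mulr_ge0// pi_ge0.
rewrite (cintegral_FTC2 (H := fun s => 'i * cexp (- 'i * s)) (h := fun s => cexp (- 'i * s))) => //.
- by rewrite mulr0 cexp0 mulNr cexpN cexp_2pi invr1 subrr.
- move=> s _; have := cderivZ 'i (cderiv_cexpZ (- 'i) s%:C).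
  by move/cderiv_eq; apply; rewrite mulrCA mulrN ii opprK mulr1.
- by move=> s _; exact: cexp_line_cont.
Qed.

(* Goursat's theorem for [(f (z + exp w) - f z) * exp (- w)], which has period
   [2 pi 'i], on rectangles reaching out to [Re w = - oo]. *)
Lemma cauchy_deriv f z (r : R) : 0 < r ->
  (forall w, normc (w - z) <= r -> derivable f w 1) ->
  cintegral `[0, 2 * pi] (fun t : R =>
     f (r%:C * cexp ('i * t%:C) + z * 1) * cexp (- 'i * t%:C)) =
  (2 * pi * r)%:C * derive1 f z.
Proof.
move=> r0 df; set f' := derive1 f z.
have pi0 : 0 <= 2 * pi :> R by rewrite mulr_ge0// pi_ge0.
have dfz : cderiv f z f'.
  by rewrite /f' derive1E; apply: derivable_cderiv; apply: df; rewrite subrr normc0 ltW.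
have df' w : normc (w - z) <= r -> cderiv f w ('D_1 f w) by move=> /df/derivable_cderiv.
pose g w := (f (z + cexp w) - f z) * cexp (- 1 * w).
have rpos : r \is Num.pos by [].
have dg w : Re w <= ln r -> exists l, cderiv g w l.
  move=> wr; eexists; apply: cderivM; last exact: cderiv_cexpZ.
  apply: cderivB; last exact: cderiv_cst.
  apply: (cderiv_comp (g := f) (f := fun w => z + cexp w)).
    by apply: cderivD; [exact: cderiv_cst | exact: cderiv_cexp].
  by apply: df'; rewrite addrAC subrr add0r normc_cexp -[r]lnK// ler_expR.
have gper (t y : R) : g (t%:C + 'i * (y + 2 * pi)%:C) = g (t%:C + 'i * y%:C).
  rewrite /g; have -> : t%:C + 'i * (y + 2 * pi)%:C = (t%:C + 'i * y%:C) + 'i * (2 * pi)%:C.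
    by rewrite real_complexD; ring.
  by rewrite !mulN1r !cexpN !cexpD cexp_2pi mulr1.
(* On the rectangle between the abscissas [la] and [ln r], of height [2 * pi], the horizontal edges
   cancel by periodicity, so the vertical integral does not depend on the abscissa. *)
have V la : la <= ln r -> vedge g 0 (0 + 2 * pi) (ln r) = vedge g 0 (0 + 2 * pi) la.
  move=> lar.
  have := @goursat R g la 0 (ln r - la) (2 * pi).
  rewrite subr_ge0 => /(_ lar pi0) => H.
  have : boundary_integral g la 0 (ln r - la) (2 * pi) = 0.
    apply: H => w [/andP[_ w1] _]; have [|l] := dg w; first by move: w1; lra.
    exact: cderiv_derivable.
  rewrite /boundary_integral.
  have -> : hedge g la (la + (ln r - la)) (0 + 2 * pi) = hedge g la (la + (ln r - la)) 0.
    by apply: eq_cintegral => t _; rewrite gper.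
  rewrite subrr add0r (_ : la + (ln r - la) = ln r); last by ring.
  by move/eqP; rewrite subr_eq0 => /eqP.
have gc (x : R) : x <= ln r ->
    continuous_between 0 (0 + 2 * pi) (fun t : R => 'i * g (x%:C + 'i * t%:C)).
  move=> xr t _; apply: continuous_vline.
  by have [|l] := dg (x%:C + 'i * t%:C); [rewrite Re_line | exact: cderiv_cont].
have cc : continuous_between 0 (0 + 2 * pi) (fun _ : R => 'i * f').
  by move=> t _; exact: ccont_cst.
have mI : measurable (`[0%R, 0 + 2 * pi]%classic : set (measurableTypeR R)) by exact: measurable_itv.
(* As [la] tends to minus infinity, [g] tends to [f'] uniformly on the vertical edge, by
   differentiability at [z]. Since the vertical integral is independent of [la], it equals the
   limit. *)
have Vr : vedge g 0 (0 + 2 * pi) (ln r) = cintegral `[0, 0 + 2 * pi] (fun=> 'i * f').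
  apply/eqP; rewrite -subr_eq0 -normc_eq0; apply/eqP/le_anti.
  rewrite normc_ge0 andbT; apply/ler_addgt0Pl => e e0; rewrite addr0.
  have pi1 : 0 < 2 * pi + 1 :> R by rewrite ltr_wpDl.
  have K0 : 0 < 2 * (2 * pi + 1) :> R by rewrite mulr_gt0.
  have [d d0 dP] := dfz _ (divr_gt0 e0 K0).
  pose la := Num.min (ln r) (ln (d / 2)).
  rewrite (V la) ?ge_min ?lexx//.
  have lar : la <= ln r by rewrite ge_min lexx.
  have d2 : d / 2 \is Num.pos by rewrite posrE divr_gt0.
  rewrite /vedge -(cintegralB mI (continuous_between_cintegrable (gc _ lar)) (continuous_between_cintegrable cc)).
  apply: (@le_trans _ _ (2 * (e / (2 * (2 * pi + 1)) * (0 + 2 * pi - 0)))).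
    apply: normc_cintegral_bound; first by rewrite add0r.
    - by move=> t tI; apply: ccontB; [exact: (gc _ lar t tI)|exact: (cc t tI)].
    - move=> t _; rewrite -mulrBr normcM normci mul1r.
      set w := la%:C + 'i * t%:C.
      have E : (g w - f') * cexp w = f (z + cexp w) - f z - f' * cexp w.
        by rewrite mulrBl /g mulN1r cexpN divfK// cexp_neq0.
      have cw : 0 < normc (cexp w) by rewrite normc_gt0 cexp_neq0.
      rewrite -(ler_pM2r cw) -normcM E; apply: dP.
      rewrite normc_cexp Re_line; apply: (@le_lt_trans _ _ (d / 2)).
        by rewrite -[d / 2]lnK// ler_expR ge_min lexx orbT.
      by rewrite ltr_pdivrMr// mulr2n mulrDr mulr1 ltrDl.
  have -> : 2 * (e / (2 * (2 * pi + 1)) * (0 + 2 * pi - 0)) = e * (2 * pi / (2 * pi + 1)).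
    by field; apply: lt0r_neq0; move: pi1; lra.
  by rewrite ler_piMr ?ltW// ltr_pdivrMr// mul1r ltrDl.
have rC : r%:C != 0 :> C by rewrite real_complex_eq0 gt_eqF.
have Ex (t : R) : cexp ((ln r)%:C + 'i * t%:C) = r%:C * cexp ('i * t%:C).
  by rewrite cexpD cexp_real lnK.
move: Vr; rewrite add0r /vedge cintegral_cst// subr0.
have fc : continuous_between 0 (2 * pi) (fun t : R =>
     f (r%:C * cexp ('i * t%:C) + z * 1) * cexp (- 'i * t%:C)).
  move=> t tI; apply: ccontM; last exact: cexp_line_cont.
  apply: (ccont_comp (h := fun t : R => r%:C * cexp ('i * t%:C) + z * 1)).
    apply: ccontD; last exact: ccont_cst.
    by apply: ccontM; [exact: ccont_cst | exact: cexp_line_cont].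
  apply: cderiv_cont (df' _ _).
  rewrite mulr1 addrK normcM normc_cexp normc_real !cRI expR0.
  by rewrite mulr1 ger0_norm// ltW.
have ec : continuous_between 0 (2 * pi) (fun t : R => f z * cexp (- 'i * t%:C)).
  by move=> t tI; apply: ccontM; [exact: ccont_cst|exact: cexp_line_cont].
have i1 := continuous_between_cintegrable fc.
have i2 := continuous_between_cintegrable ec.
have i3 : cintegrable `[0%R, 2 * pi] (fun t : R => cexp (- 'i * t%:C)).
  by apply: continuous_between_cintegrable => t _; exact: cexp_line_cont.
have mI' : measurable (`[0%R, 2 * pi]%classic : set (measurableTypeR R)) by exact: measurable_itv.
(* Back to the circle of radius [r]. The constant [f z] disappears because [cexp (- 'i * t%:C)] has
   integral zero over a period. *)
rewrite (@eq_cintegral _ _ _ (fun t : R => ('i / r%:C) * (f (r%:C * cexp ('i * t%:C) + z * 1) *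
   cexp (- 'i * t%:C) - f z * cexp (- 'i * t%:C)))); last first.
  move=> t _; rewrite /g mulN1r cexpN Ex [z + _]addrC mulr1 mulNr cexpN.
  by field; rewrite rC cexp_neq0.
rewrite (cintegralZ _ mI' (cintegrableB mI' i1 i2)) (cintegralB mI' i1 i2).
rewrite (cintegralZ _ mI' i3) cintegral_cexpNi mulr0 subr0 => H.
have ir : 'i / r%:C != 0 :> C by rewrite mulf_neq0 ?i_neq0 ?invr_neq0.
apply: (mulfI ir); rewrite H !real_complexM; field; exact: rC.
Qed.

(* By [cauchy_deriv] the derivative is locally a parametric integral of [f]:
   it is continuous, which in turn makes it differentiable. *)
Theorem derivable_derive1 (U : set C) f : open U ->
  (forall w, U w -> derivable f w 1) -> forall w, U w -> derivable (derive1 f) w 1.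
Proof.
move=> Uo df.
have loc z : U z -> exists2 r : R, 0 < r &
    forall w, normc (w - z) < r -> (forall v, normc (v - w) <= r -> U v).
  move=> Uz; have /nbhs_normc[d d0 dP] : nbhs z U by exact: open_nbhs_nbhs.
  exists (d / 2) => [|w wz v vw]; first by rewrite divr_gt0.
  apply: dP; rewrite -[v](subrK w) -addrA [d]splitr.
  by apply: le_lt_trans (normcD _ _) _; rewrite ler_ltD.
pose al (r : R) (t : R) := r%:C * cexp ('i * t%:C).
have pi0 : 0 <= 2 * pi :> R by rewrite mulr_ge0// pi_ge0.
have alc r : continuous_between 0 (2 * pi) (al r).
  by move=> t _; apply: ccontM; [exact: ccont_cst|exact: cexp_line_cont].
have bec : continuous_between 0 (2 * pi) (fun _ : R => 1 : C).
  by move=> t _; exact: ccont_cst.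
have gac : continuous_between 0 (2 * pi) (fun t : R => cexp (- 'i * t%:C)).
  by move=> t _; exact: cexp_line_cont.
have form z r : 0 < r -> (forall w, normc (w - z) < r -> (forall v, normc (v - w) <= r -> U v)) ->
    forall w, normc (w - z) < r ->
    (fun w => (2 * pi * r)^-1%:C * cintegral `[0, 2 * pi] (fun t : R => f (al r t + w * 1) * cexp (- 'i * t%:C))) w = derive1 f w.
  move=> r0 rU w wz /=; rewrite cauchy_deriv// => [|v vw]; last by apply: df; apply: (rU w).
  have p0 : 0 < 2 * pi * r by rewrite mulr_gt0 ?mulr_gt0 ?pi_gt0.
  by rewrite mulrA -real_complexM mulVf ?mul1r // gt_eqF.
have circU (z : C) (r : R) : 0 < r -> (forall w, normc (w - z) < r -> (forall v, normc (v - w) <= r -> U v)) ->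
    forall t, 0 <= t <= 2 * pi -> U (al r t + z * 1).
  move=> r0 rU t _; apply: (rU z); first by rewrite subrr normc0.
  rewrite mulr1 addrK normcM normc_cexp normc_real !cRI expR0.
  by rewrite mulr1 ger0_norm// ltW.
have fc w : U w -> {for w, continuous f} by move=> /df/derivable_cderiv; exact: cderiv_cont.
have f'c w : U w -> {for w, continuous (derive1 f)}.
  move=> Uw; have [r r0 rU] := loc _ Uw.
  have H1 := param_integral_cont Uo pi0 (alc r) bec gac (circU _ _ r0 rU) fc.
  have H := (ccontP _ _).1 (ccontM (@ccont_cst R C ((2 * pi * r)^-1%:C) w) H1).
  apply/ccontP => e /H[d d0 dP]; exists (Num.min d r) => [|v]; first by rewrite lt_min d0.
  rewrite lt_min => /andP[/dP + vr].
  by rewrite (form w r r0 rU v vr) (form w r r0 rU w)// subrr normc0.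
have df' w : U w -> cderiv f w (derive1 f w).
  by rewrite derive1E => /df/derivable_cderiv.
move=> w Uw; have [r r0 rU] := loc _ Uw.
have H := cderivZ ((2 * pi * r)^-1%:C) (param_integral_cderiv Uo pi0 (alc r) bec gac (circU _ _ r0 rU) df' f'c).
apply: cderiv_derivable; apply: cderiv_near H.
by exists r => //; exact: form.
Qed.

End Smoothness.

(** * Primitives and division by [w - c] on star-shaped domains *)

Section StarDomains.
Variable R : realType.
Local Notation C := R[i].
Implicit Types (z w c : C) (f g F : C -> C) (U : set C).
Local Notation Re := (@complex.Re R).
Local Notation Im := (@complex.Im R).

Definition star_shaped U c := forall w (s : R), U w -> 0 <= s <= 1 -> U (c + s%:C * (w - c)).

Lemma analytic_cderiv U f w : analytic_on U f -> U w -> cderiv f w (derive1 f w).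
Proof. by move=> df /df/derivable_cderiv; rewrite derive1E. Qed.

Lemma analytic_cont U f w : analytic_on U f -> U w -> {for w, continuous f}.
Proof. by move=> df /(analytic_cderiv df)/cderiv_cont. Qed.

Lemma analytic_derive1 U f : open U -> analytic_on U f -> analytic_on U (derive1 f).
Proof. exact: derivable_derive1. Qed.

Lemma analytic_derive1n U f n : open U -> analytic_on U f -> analytic_on U (derive1n n f).
Proof.
move=> Uo df; elim: n => [|n IH]; first by [].
rewrite /derive1n iterS; exact: analytic_derive1.
Qed.

Lemma derive1n_cderiv U f n w : open U -> analytic_on U f -> U w ->
  cderiv (derive1n n f) w (derive1n n.+1 f w).
Proof. by move=> Uo df Uw; exact: (analytic_cderiv (analytic_derive1n (n := n) Uo df) Uw). Qed.

Section Primitive.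
Variables (U : set C) (f : C -> C) (c : C).
Hypotheses (Uo : open U) (df : analytic_on U f) (Us : star_shaped U c) (Uc : U c).

Let al (s : R) : C := c * (1 - s%:C).
Let be (s : R) : C := s%:C.

Let alc : continuous_between 0 1 al.
Proof.
move=> s _; apply: ccontM; first exact: ccont_cst.
by apply: ccontB; [exact: ccont_cst|exact: continuous_real_complex].
Qed.

Let bec : continuous_between 0 1 be.
Proof. by move=> s _; exact: continuous_real_complex. Qed.

Let onec : continuous_between 0 1 (fun _ : R => 1 : C).
Proof. by move=> s _; exact: ccont_cst. Qed.

Let segE w s : c + s%:C * (w - c) = al s + w * be s.
Proof. by rewrite /al /be; ring. Qed.

Let Useg w : U w -> forall s : R, 0 <= s <= 1 -> U (al s + w * be s).
Proof. by move=> Uw s s01; rewrite -segE; exact: Us. Qed.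

Let fcd w : U w -> cderiv f w (derive1 f w).
Proof. exact: analytic_cderiv. Qed.

Let f'c w : U w -> {for w, continuous (derive1 f)}.
Proof. exact: (analytic_cont (analytic_derive1 Uo df)). Qed.

Let fc w : U w -> {for w, continuous f}.
Proof. exact: analytic_cont. Qed.

(** Differentiation under the integral gives the integral over [s] of [f + s * (w - c) * f'], taken
    at [c + s * (w - c)]. This integrand is the derivative in [s] of [s * f (c + s * (w - c))].
    Continuity of [f'] is needed, hence [derivable_derive1]. *)
Lemma segment_integral_cderiv w : U w -> cderiv (segment_integral f c) w (f w).
Proof.
move=> Uw.
have D := param_integral_cderiv Uo (@ler01 R) alc bec onec (Useg Uw) fcd f'c.
have P := cderivM (cderivB (cderiv_id w) (cderiv_cst c w)) D.
have E z : (z - c) * cintegral `[0, 1] (fun t : R => f (al t + z * be t) * 1) = segment_integral f c z.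
  rewrite /segment_integral; congr (_ * _); apply: eq_cintegral => s _.
  by rewrite segE mulr1.
apply: (cderiv_eq (cderiv_ext E P)); rewrite subr0 mul1r.
have mI : measurable (`[0%R, 1%R]%classic : set (measurableTypeR R)) by exact: measurable_itv.
have c1 : continuous_between 0 1 (fun t : R => f (al t + w * be t) * 1).
  exact: (param_integrand_cont alc bec onec fc (Useg Uw)).
have c2 : continuous_between 0 1 (fun t : R => derive1 f (al t + w * be t) * (be t * 1)).
  have bec1 : continuous_between 0 1 (fun t : R => be t * 1).
    by move=> s s01; apply: ccontM; [exact: bec s01 | exact: ccont_cst].
  exact: (param_integrand_cont alc bec bec1 f'c (Useg Uw)).
have c3 : continuous_between 0 1 (fun t : R => (w - c) * (derive1 f (al t + w * be t) * (be t * 1))).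
  by move=> s s01; apply: ccontM; [exact: ccont_cst|exact: c2 s01].
have i1 := continuous_between_cintegrable c1.
have i2 := continuous_between_cintegrable c2.
have i3 := continuous_between_cintegrable c3.
rewrite -(cintegralZ _ mI i2) -(cintegralD mI i1 i3).
rewrite (cintegral_FTC2 (H := fun s => s * f (c * (1 - s) + w * s))
  (h := fun s => f (c * (1 - s) + w * s) * 1 + (w - c) * (derive1 f (c * (1 - s) + w * s) * (s * 1)))).
- by rewrite !mul0r mul1r subrr mulr0 mulr1 add0r subr0.
- exact: ler01.
- move=> s s01.
  have L : cderiv (fun s => c * (1 - s) + w * s) s%:C (w - c).
    apply: (cderiv_ext _ (cderiv_affine c (w - c) s%:C)) => v; ring.
  apply: (cderiv_eq (cderivM (cderiv_id s%:C) (cderiv_comp L (fcd (Useg Uw s01))))).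
  rewrite /al /be; ring.
- by move=> s s01; apply: ccontD; [exact: c1 s01|exact: c3 s01].
Qed.

(** Take for [g w] the mean of [f'] over the segment from [c] to [w]; it is analytic because [f'']
    is continuous. This is the substitute for the theorem on removable singularities. *)
Lemma analytic_factor : exists g, [/\ analytic_on U g, g c = derive1 f c &
  forall w, U w -> f w = f c + (w - c) * g w].
Proof.
exists (fun w => cintegral `[0, 1] (fun t : R => derive1 f (al t + w * be t) * 1)).
have dd w : U w -> cderiv (derive1 f) w (derive1 (derive1 f) w).
  exact: (analytic_cderiv (analytic_derive1 Uo df)).
have ddc w : U w -> {for w, continuous (derive1 (derive1 f))}.
  exact: (analytic_cont (analytic_derive1 Uo (analytic_derive1 Uo df))).
split.
- move=> w Uw; apply: cderiv_derivable.
  exact: (param_integral_cderiv Uo (@ler01 R) alc bec onec (Useg Uw) dd ddc).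
- rewrite (eq_cintegral (g := fun=> derive1 f c)); last first.
    by move=> s _; rewrite -segE subrr mulr0 addr0 mulr1.
  by rewrite cintegral_cst ?ler01// subr0 mul1r.
- move=> w Uw.
  have E := @cintegral_segment R f (derive1 f) c (w - c).
  rewrite (_ : c + (w - c) = w) in E; last by ring.
  rewrite -[LHS](subrK (f c)) -E; last first.
    move=> s s01; have Us' : U (c + s%:C * (w - c)) by exact: Us.
    by split; [exact: fcd | exact: (f'c Us')].
  rewrite addrC; congr (_ + _).
  rewrite -cintegralZ; last 2 first.
  + exact: measurable_itv.
  + apply: continuous_between_cintegrable.
    exact: (param_integrand_cont alc bec onec f'c (Useg Uw)).
  by apply: eq_cintegral => s _; rewrite -segE mulr1.
Qed.

End Primitive.

Lemma openT_star c : star_shaped setT c. Proof. by []. Qed.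

Lemma open_halfplane : open (@right_half_plane R).
Proof.
rewrite openE => z /= z0; apply/nbhs_normc; exists (Re z) => // w wz.
rewrite /right_half_plane /=.
have := Re_le_normc (w - z); rewrite !cRI ler_norml => /andP[h _].
move: wz h; set x := normc _; lra.
Qed.

Lemma star_halfplane c : 0 < Re c -> star_shaped (@right_half_plane R) c.
Proof.
move=> c0 w s; rewrite /right_half_plane /= => w0 /andP[s0 s1]; rewrite !cRI.
have -> : Re c + s * (Re w - Re c) = (1 - s) * Re c + s * Re w by ring.
have [->|sn] := eqVneq s 1; first by rewrite subrr mul0r add0r mul1r.
have sl : 0 < 1 - s by rewrite subr_gt0 lt_neqAle sn.
by rewrite ltr_pwDl ?mulr_gt0// mulr_ge0// ltW.
Qed.

End StarDomains.

(** * Integrals along horizontal lines *)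

Section LineIntegrals.
Variable R : realType.
Local Notation C := R[i].
Local Notation mu := (@lebesgue_measure R).
Implicit Types (z w c : C) (f g F : C -> C).
Local Notation Re := (@complex.Re R).
Local Notation Im := (@complex.Im R).

Lemma Rintegral_dominated_cvg (D : set (measurableTypeR R)) (f_ : nat -> R -> R) (f g : R -> R) :
  measurable D -> (forall n, mu.-integrable D (EFin \o f_ n)) ->
  mu.-integrable D (EFin \o f) -> mu.-integrable D (EFin \o g) ->
  (forall x, D x -> f_ n x @[n --> \oo] --> f x) ->
  (forall n x, D x -> `|f_ n x| <= g x) ->
  \int[mu]_(x in D) f_ n x @[n --> \oo] --> \int[mu]_(x in D) f x.
Proof.
move=> mD fi fi' gi fc fg.
have [_ _ H] : [/\ mu.-integrable D (EFin \o f),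
  [sequence (\int[mu]_(x in D) `|(f_ n x)%:E - (f x)%:E|)%E]_n @ \oo --> 0%E &
  [sequence (\int[mu]_(x in D) (f_ n x)%:E)%E]_n @ \oo --> (\int[mu]_(x in D) (f x)%:E)%E].
  apply: (@dominated_convergence _ _ _ mu D mD _ _ (EFin \o g)).
  - by move=> n; exact: measurable_int (fi n).
  - exact: measurable_int fi'.
  - apply: aeW => x Dx; apply/fine_cvgP; split; first exact: nearW.
    exact: fc.
  - exact: gi.
  - by apply: aeW => x n Dx; rewrite /= lee_fin; exact: fg.
have fin : (\int[mu]_(x in D) (f x)%:E)%E \is a fin_num by exact: integrable_fin_num.
move: H; rewrite -(fineK fin) => /fine_cvgP[_ H].
exact: H.
Qed.

Lemma cintegral_dominated_cvg (D : set (measurableTypeR R)) (f_ : nat -> R -> C) (f : R -> C) (g : R -> R) :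
  measurable D -> (forall n, cintegrable D (f_ n)) ->
  cintegrable D f -> mu.-integrable D (EFin \o g) ->
  (forall x, D x -> f_ n x @[n --> \oo] --> f x) ->
  (forall n x, D x -> normc (f_ n x) <= g x) ->
  cintegral D (f_ n) @[n --> \oo] --> cintegral D f.
Proof.
move=> mD fi [f1 f2] gi fc fg; apply/cvg_ReIm; split.
- apply: (@Rintegral_dominated_cvg D (fun n x => Re (f_ n x)) (fun x => Re (f x)) g) => //.
  + by move=> n; case: (fi n).
  + by move=> x /fc /cvg_ReIm[].
  + by move=> n x /(fg n x); apply: le_trans; exact: Re_le_normc.
- apply: (@Rintegral_dominated_cvg D (fun n x => Im (f_ n x)) (fun x => Im (f x)) g) => //.
  + by move=> n; case: (fi n).
  + by move=> x /fc /cvg_ReIm[].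
  + by move=> n x /(fg n x); apply: le_trans; exact: Im_le_normc.
Qed.

Lemma continuous_measurable (g : R -> R) : (forall x, {for x, continuous g}) ->
  measurable_fun (setT : set (measurableTypeR R)) g.
Proof.
move=> gc; apply: measurable_realfun.continuous_measurable_fun => x; exact: gc.
Qed.

Lemma cintegrable_le (D : set (measurableTypeR R)) (f : R -> C) (h : R -> R) : measurable D ->
  (forall x, {for x, continuous f}) -> mu.-integrable D (EFin \o h) ->
  (forall x, D x -> normc (f x) <= h x) -> cintegrable D f.
Proof.
move=> mD fc hi fh; split; apply: (le_integrable mD _ _ hi).
- apply/measurable_EFinP; apply: measurable_funTS; apply: continuous_measurable => x.
  exact: continuous_Re.
- by move=> x /fh fx /=; rewrite lee_fin (le_trans (Re_le_normc _))// (le_trans fx)// ler_norm.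
- apply/measurable_EFinP; apply: measurable_funTS; apply: continuous_measurable => x.
  exact: continuous_Im.
- by move=> x /fh fx /=; rewrite lee_fin (le_trans (Im_le_normc _))// (le_trans fx)// ler_norm.
Qed.

Lemma integrable_normc (D : set (measurableTypeR R)) (f : R -> C) : measurable D ->
  (forall x, {for x, continuous f}) -> cintegrable D f ->
  mu.-integrable D (EFin \o (fun x => normc (f x))).
Proof.
move=> mD fc [f1 f2].
have i1 := integrableD mD (integrable_abse f1) (integrable_abse f2).
apply: (le_integrable mD _ _ i1).
- apply/measurable_EFinP; apply: measurable_funTS; apply: continuous_measurable => x.
  exact: continuous_normc.
- move=> x _ /=; rewrite lee_fin ger0_norm ?normc_ge0// ger0_norm ?addr_ge0//.
  exact: normc_le_ReIm.
Qed.

Lemma cintegral_lim (f : R -> C) : (forall x, {for x, continuous f}) -> cintegrable setT f ->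
  cintegral `[- (n%:R), n%:R] f @[n --> \oo] --> cintegral setT f.
Proof.
move=> fc fi.
have lim (h : R -> R) : mu.-integrable setT (EFin \o h) ->
    \int[mu]_(x in `[- (n%:R), n%:R]) h x @[n --> \oo] --> \int[mu]_(x in setT) h x.
  move=> hi; under eq_cvg do rewrite Rintegral_mkcond.
  apply: (@Rintegral_dominated_cvg setT (fun n : nat => h \_ `[- (n%:R), n%:R]) h (fun x => `|h x|)) => //.
  - move=> n; rewrite -restrict_EFin.
    have mI : measurable (`[- (n%:R), n%:R]%classic : set (measurableTypeR R)) by exact: measurable_itv.
    apply: ((integrable_mkcond _ mI).1 _).
    exact: (integrableS measurableT mI (@subsetT _ _) hi).
  - exact: integrable_abse hi.
  - move=> x _; apply: (@cvg_near_cst _ _ _ _ _ _) => //.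
    exists (Num.bound `|x|) => // n /= xn.
    rewrite /patch mem_set//= in_itv /=; rewrite -ler_norml.
    by rewrite (le_trans (ltW (archi_boundP _)))// ler_nat.
  - by move=> n x _; rewrite /patch; case: ifP => //; rewrite normr0.
case: fi => f1 f2; apply/cvg_ReIm; split; exact: lim.
Qed.

End LineIntegrals.

(** * Moving a horizontal contour *)

Section ContourShift.
Variable R : realType.
Local Notation C := R[i].
Local Notation mu := (@lebesgue_measure R).
Implicit Types (z w c : C) (f g H : C -> C) (a b u v : R).
Local Notation Re := (@complex.Re R).
Local Notation Im := (@complex.Im R).

Lemma ccvg_unique (u : nat -> C) (l l' : C) : u @ \oo --> l -> u @ \oo --> l' -> l = l'.
Proof. exact: (@cvg_unique _ (@norm_hausdorff _ C) (u @ \oo)). Qed.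

Lemma ccvgB (u v : nat -> C) (l l' : C) : u @ \oo --> l -> v @ \oo --> l' ->
  (u n - v n) @[n --> \oo] --> (l - l' : C).
Proof. by move=> ul vl; apply: cvgB; [exact: ul|exact: vl]. Qed.

(** Only the difference of the truncated integrals is said to converge. It is also applied to a
    function that decays merely like [1 / w], which is not absolutely integrable on the two
    lines. *)
Lemma shift_truncated H a b : a <= b ->
  (forall u v, a <= v <= b -> derivable H (u%:C + 'i * v%:C) 1) ->
  (forall e : R, 0 < e -> exists N : nat, forall n : nat, (N <= n)%N -> forall v, a <= v <= b ->
     normc (H ((n%:R)%:C + 'i * v%:C)) <= e /\ normc (H ((- n%:R)%:C + 'i * v%:C)) <= e) ->
  (cintegral `[- (n%:R), n%:R] (fun u => H (u%:C + 'i * a%:C))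
   - cintegral `[- (n%:R), n%:R] (fun u => H (u%:C + 'i * b%:C))) @[n --> \oo] --> (0 : C).
Proof.
move=> ab dH sides; apply/cvg_normc => e e0.
have ba0 : 0 < b - a + 1 by rewrite ltr_wpDl// subr_ge0.
have K0 : 0 < 4 * (b - a + 1) by rewrite mulr_gt0.
have [N NP] := sides _ (divr_gt0 e0 K0).
exists N => // n /= Nn; rewrite subr0.
have n0 : 0 <= n%:R + n%:R :> R by rewrite addr_ge0.
have ba : 0 <= b - a by rewrite subr_ge0.
have /(@goursat R H (- n%:R) a _ _ n0 ba) : forall w,
    rectangle (- n%:R) a (n%:R + n%:R) (b - a) w -> derivable H w 1.
  move=> w [_]; rewrite (_ : a + (b - a) = b); last by ring.
  by move=> wab; rewrite [w]complexE; exact: dH.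
rewrite /boundary_integral /hedge /vedge.
rewrite (_ : - n%:R + (n%:R + n%:R) = n%:R :> R); last by ring.
rewrite (_ : a + (b - a) = b); last by ring.
move/eqP; rewrite -addrA addr_eq0 => /eqP ->.
have Vn (x : R) : (forall v, a <= v <= b -> normc (H (x%:C + 'i * v%:C)) <= e / (4 * (b - a + 1))) ->
   normc (cintegral `[a, b] (fun t => 'i * H (x%:C + 'i * t%:C))) <= 2 * (e / (4 * (b - a + 1)) * (b - a)).
  move=> He; apply: normc_cintegral_bound; first exact: ab.
    move=> v vab; apply: continuous_vline.
    exact: (cderiv_cont (derivable_cderiv (dH x v vab))).
  by move=> v /He; rewrite normcM normci mul1r.
have V1 := Vn n%:R (fun v vab => (NP n Nn v vab).1).
have V2 := Vn (- n%:R) (fun v vab => (NP n Nn v vab).2).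
rewrite normcN (le_lt_trans (normc_sub _ _))// (le_lt_trans (lerD V1 V2))//.
have -> : 2 * (e / (4 * (b - a + 1)) * (b - a)) + 2 * (e / (4 * (b - a + 1)) * (b - a)) =
  e * ((b - a) / (b - a + 1)) by field; apply: lt0r_neq0.
by rewrite gtr_pMr// ltr_pdivrMr// mul1r ltrDl.
Qed.

Definition gaussian (ep : R) w : C := cexp (- ep%:C * w ^+ 2).

Lemma cderiv_gaussian ep w :
  cderiv (gaussian ep) w (cexp (- ep%:C * w ^+ 2) * (- ep%:C * (2 * w))).
Proof. exact: (cderiv_comp (cderivZ _ (cderiv_sqr w)) (cderiv_cexp _)). Qed.

Lemma normc_gaussian ep u v :
  normc (gaussian ep (u%:C + 'i * v%:C)) = expR (ep * v ^+ 2 - ep * u ^+ 2).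
Proof.
rewrite normc_cexp expr2; congr expR; rewrite !cRI; ring.
Qed.

Lemma gaussian_cvg (w : C) : gaussian (n.+1%:R^-1) w @[n --> \oo] --> (1 : C).
Proof.
apply/cvg_normc => e e0.
have [d d0 dP] := (ccontP _ _).1 (cderiv_cont (cderiv_cexp (0 : C))) e e0.
exists (Num.bound (normc (w ^+ 2) / d)) => // n /= hn.
have := dP (- (n.+1%:R^-1)%:C * w ^+ 2); rewrite cexp0; apply.
rewrite subr0 normcM normcN normc_real ger0_norm ?invr_ge0//.
rewrite mulrC ltr_pdivrMr ?ltr0n// mulrC -ltr_pdivrMr//.
have := archi_boundP (divr_ge0 (normc_ge0 (w ^+ 2)) (ltW d0)).
by move/lt_le_trans; apply; rewrite ler_nat (leq_trans hn).
Qed.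

(** As soon as [n >= |s + 1| / ep] the exponent is at most [- n], and [(1 + n) * exp (- n) <= 1]
    then gives a decay like [|K| / n], which is explicit enough to choose [N]. *)
Lemma expR_quadratic_cvg (s ep K : R) : 0 < ep -> forall e : R, 0 < e ->
  exists N : nat, forall n : nat, (N <= n)%N -> K * expR (s * n%:R - ep * n%:R ^+ 2) <= e.
Proof.
move=> ep0 e e0; exists (Num.bound (`|s + 1| / ep)%R + Num.bound (`|K| / e)%R)%N => n Nn.
have h1 : `|s + 1| / ep <= n%:R.
  apply: le_trans (ltW (archi_boundP (divr_ge0 (normr_ge0 (s + 1)) (ltW ep0)))) _.
  by rewrite ler_nat (leq_trans _ Nn)// leq_addr.
have h2 : `|K| / e <= n%:R.
  apply: le_trans (ltW (archi_boundP (divr_ge0 (normr_ge0 K) (ltW e0)))) _.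
  by rewrite ler_nat (leq_trans _ Nn)// leq_addl.
have h3 : s * n%:R - ep * n%:R ^+ 2 <= - n%:R.
  move: h1; rewrite ler_pdivrMr// => h1.
  have s1 : s + 1 <= n%:R * ep by rewrite (le_trans (ler_norm _)).
  have := ler_wpM2r (ler0n R n) s1; rewrite expr2; lra.
have h4 : expR (s * n%:R - ep * n%:R ^+ 2) <= expR (- n%:R) by rewrite ler_expR.
have h5 : (1 + n%:R) * expR (- n%:R) <= 1 :> R.
  by rewrite expRN ler_pdivrMr ?expR_gt0// mul1r expR_ge1Dx.
have K1 : K * expR (s * n%:R - ep * n%:R ^+ 2) <= `|K| * expR (- n%:R).
  rewrite (le_trans (ler_wpM2r (expR_ge0 _) (ler_norm K)))// ler_wpM2l//.
apply: (le_trans K1).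
move: h2; rewrite ler_pdivrMr// => h2.
have := ler_wpM2r (expR_ge0 (- n%:R)) h2.
have := expR_ge0 (- n%:R : R); have := ltW e0; move: h5.
move: (expR (- n%:R)) => X h5 e0' X0 h6.
have : e * (n%:R * X) <= e * 1.
  by apply: ler_wpM2l => //; apply: le_trans h5; rewrite mulrDl mul1r lerDr.
lra.
Qed.

(* Damping by [exp (- ep * w^2)] makes the vertical sides vanish; then [ep -> 0]. *)
Lemma contour_shift H a b (K s : R) : a <= b ->
  (forall u v, a <= v <= b -> derivable H (u%:C + 'i * v%:C) 1) ->
  (forall u v, 1 <= `|u| -> a <= v <= b -> normc (H (u%:C + 'i * v%:C)) <= K * expR (s * `|u|)) ->
  cintegrable setT (fun u => H (u%:C + 'i * a%:C)) ->
  cintegrable setT (fun u => H (u%:C + 'i * b%:C)) ->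
  cintegral setT (fun u => H (u%:C + 'i * a%:C)) = cintegral setT (fun u => H (u%:C + 'i * b%:C)).
Proof.
move=> ab dH Hb ia ib.
have mT : measurable (setT : set (measurableTypeR R)) by exact: measurableT.
have aab : a <= a <= b by rewrite lexx.
have bab : a <= b <= b by rewrite lexx andbT.
pose Hn n w := H w * gaussian (n.+1%:R^-1) w.
have dHn n u v : a <= v <= b -> derivable (Hn n) (u%:C + 'i * v%:C) 1.
  move=> vab; apply: cderiv_derivable.
  exact: (cderivM (derivable_cderiv (dH u v vab)) (cderiv_gaussian _ _)).
have Hc v : a <= v <= b -> forall u, {for u, continuous (fun u => H (u%:C + 'i * v%:C))}.
  move=> vab u; apply: continuous_hline.
  exact: (cderiv_cont (derivable_cderiv (dH u v vab))).
have Hnc n v : a <= v <= b -> forall u, {for u, continuous (fun u => Hn n (u%:C + 'i * v%:C))}.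
  move=> vab u; apply: continuous_hline.
  exact: (cderiv_cont (derivable_cderiv (dHn n u v vab))).
(* On a fixed line the Gaussian is at most [expR (v ^+ 2)], uniformly in [n]: this is the dominating
   function for the limit of vanishing damping. *)
have Hnb n u v : normc (Hn n (u%:C + 'i * v%:C)) <=
    expR (v ^+ 2) * normc (H (u%:C + 'i * v%:C)).
  rewrite normcM mulrC ler_wpM2r ?normc_ge0// normc_gaussian ler_expR.
  rewrite (@le_trans _ _ (n.+1%:R^-1 * v ^+ 2))//.
    by rewrite gerBl mulr_ge0 ?invr_ge0 ?sqr_ge0.
  by rewrite ler_piMl ?sqr_ge0// invf_le1 ?ltr0n// ler1n.
have hint v : a <= v <= b -> cintegrable setT (fun u => H (u%:C + 'i * v%:C)) ->
    mu.-integrable setT (EFin \o (fun u => expR (v ^+ 2) * normc (H (u%:C + 'i * v%:C)))).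
  move=> vab iv; have := integrableZl mT (expR (v ^+ 2)) (integrable_normc mT (Hc v vab) iv).
  by apply: (eq_integrable mT) => x _; rewrite /= EFinM.
have Hni n v : a <= v <= b -> cintegrable setT (fun u => H (u%:C + 'i * v%:C)) ->
    cintegrable setT (fun u => Hn n (u%:C + 'i * v%:C)).
  move=> vab iv; apply: (cintegrable_le mT (Hnc n v vab) (hint v vab iv)) => x _.
  exact: Hnb.
have Hncvg v : a <= v <= b -> cintegrable setT (fun u => H (u%:C + 'i * v%:C)) ->
    cintegral setT (fun u => Hn n (u%:C + 'i * v%:C)) @[n --> \oo] --> cintegral setT (fun u => H (u%:C + 'i * v%:C)).
  move=> vab iv; apply: (cintegral_dominated_cvg mT (fun n => Hni n v vab iv) iv (hint v vab iv)).
  - move=> u _; rewrite -[X in _ --> X]mulr1; apply: cvgM; first exact: cvg_cst.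
    exact: gaussian_cvg.
  - by move=> n u _; exact: Hnb.
have E n : cintegral setT (fun u => Hn n (u%:C + 'i * a%:C)) = cintegral setT (fun u => Hn n (u%:C + 'i * b%:C)).
  have la := cintegral_lim (Hnc n a aab) (Hni n a aab ia).
  have lb := cintegral_lim (Hnc n b bab) (Hni n b bab ib).
  have l0 : (cintegral `[- (m%:R), m%:R] (fun u => Hn n (u%:C + 'i * a%:C))
   - cintegral `[- (m%:R), m%:R] (fun u => Hn n (u%:C + 'i * b%:C))) @[m --> \oo] --> (0 : C).
    apply: (shift_truncated ab (dHn n)) => e e0.
    have ep0 : 0 < n.+1%:R^-1 :> R by rewrite invr_gt0.
    (* [V] dominates [v ^+ 2] on the strip whatever the signs of [a] and [b]. *)
    pose V := a ^+ 2 + b ^+ 2.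
    have [N NP] := expR_quadratic_cvg s (`|K| * expR V) ep0 e0.
    have key (m : nat) (u v : R) : (maxn N 1 <= m)%N -> a <= v <= b -> `|u| = m%:R ->
        normc (Hn n (u%:C + 'i * v%:C)) <= e.
      rewrite geq_max => /andP[Nm m1] vab um; apply: le_trans (NP m Nm).
      rewrite normcM normc_gaussian expRD [expR (s * _ - _)]expRD.
      have -> : u ^+ 2 = m%:R ^+ 2 by rewrite -um -normrX ger0_norm ?sqr_ge0.
      rewrite -!mulrA [expR V * _]mulrCA !mulrA ler_wpM2r ?expR_ge0//.
      apply: ler_pM; rewrite ?normc_ge0 ?expR_ge0//.
        apply: le_trans (Hb u v _ vab) _; first by rewrite um ler1n.
        by rewrite um ler_wpM2r ?expR_ge0// ler_norm.
      rewrite ler_expR; have v2 : v ^+ 2 <= V.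
        rewrite /V; move/andP: vab => [h1 h2]; have [v0|v0] := leP 0 v.
          by rewrite (@le_trans _ _ (b ^+ 2)) ?lerDr ?sqr_ge0// ler_sqr ?nnegrE// (le_trans v0).
        rewrite (@le_trans _ _ (a ^+ 2)) ?lerDl ?sqr_ge0//.
        by rewrite -(sqrrN v) -(sqrrN a) ler_sqr ?nnegrE ?lerN2 ?oppr_ge0//; move: h1 v0; lra.
      rewrite (@le_trans _ _ (v ^+ 2))//.
      by rewrite -mulrA -expr2 ler_piMl ?sqr_ge0// invf_le1 ?ltr0n// ler1n.
    exists (maxn N 1) => m Nm v vab; split; apply: (key m) => //.
    - by rewrite normr_nat.
    - by rewrite normrN normr_nat.
  have l1 := ccvgB la lb.
  apply/eqP; rewrite -subr_eq0; apply/eqP.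
  exact: (ccvg_unique l1 l0).
have la := Hncvg a aab ia; have lb := Hncvg b bab ib.
move: la; under eq_cvg do rewrite E; move=> la.
exact: (ccvg_unique la lb).
Qed.

End ContourShift.

(** * Integrability criteria on the real line *)

Section Integrability.
Variable R : realType.
Local Notation C := R[i].
Local Notation mu := (@lebesgue_measure R).
Local Notation Re := (@complex.Re R).
Local Notation Im := (@complex.Im R).

Lemma eq_Rintegral_segment (a b : R) (f g : R -> R) : (forall x, a <= x <= b -> f x = g x) ->
  \int[mu]_(x in `[a, b]) f x = \int[mu]_(x in `[a, b]) g x.
Proof.
by move=> fg; apply: eq_Rintegral => x; rewrite inE /= in_itv /= => /fg.
Qed.

(** Monotone convergence along [[- n, n]]. It reduces questions on the whole line to compact
    segments, where integrals are computed from primitives. *)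
Lemma integrable_of_segments (g : R -> R) (B : R) : (forall x, {for x, continuous g}) ->
  (forall x, 0 <= g x) -> (forall n : nat, \int[mu]_(x in `[- (n%:R), n%:R]) g x <= B) ->
  mu.-integrable setT (EFin \o g) /\ \int[mu]_(x in setT) g x <= B.
Proof.
move=> gc g0 gB.
have mT : measurable (setT : set (measurableTypeR R)) by exact: measurableT.
have mI (n : nat) : measurable (`[- (n%:R), n%:R]%classic : set (measurableTypeR R)).
  exact: measurable_itv.
have mg : measurable_fun (setT : set (measurableTypeR R)) (EFin \o g).
  by apply/measurable_EFinP; exact: continuous_measurable.
pose gn (n : nat) := (EFin \o g) \_ `[- (n%:R), n%:R].
have gnE n : (\int[mu]_(x in setT) gn n x = (\int[mu]_(x in `[- (n%:R), n%:R]) g x)%:E)%E.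
  rewrite -integral_mkcond /Rintegral fineK//; apply: integrable_fin_num => //.
  by apply: continuous_between_integrable => x _; exact: gc.
have lim x : gn ^~ x @ \oo --> (g x)%:E.
  apply: cvg_near_cst => //; exists (Num.bound `|x|) => // n /= xn.
  rewrite /gn /patch mem_set//= in_itv /= -ler_norml.
  by rewrite (le_trans (ltW (archi_boundP _)))// ler_nat.
have mgn n : measurable_fun (setT : set (measurableTypeR R)) (gn n).
  apply: ((measurable_restrict (EFin \o g) (mI n) mT).1 _).
  exact: (measurable_funS mT (@subsetT _ _) mg).
have gn0 n x : setT x -> (0 <= gn n x)%E.
  by move=> _; rewrite /gn /patch; case: ifP => //= _; rewrite lee_fin.
have gnd x : setT x -> nondecreasing_seq (gn ^~ x).
  move=> _ m n mn; rewrite /gn /patch; case: ifPn => [|_]; last first.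
    by case: ifP => //= _; rewrite lee_fin.
  rewrite inE /= in_itv /= => /andP[h1 h2]; rewrite mem_set//= in_itv /=.
  have mn' : m%:R <= n%:R :> R by rewrite ler_nat.
  by apply/andP; split; lra.
have H := @cvg_monotone_convergence _ _ _ mu setT mT gn mgn gn0 gnd.
rewrite (_ : (fun x => limn (gn ^~ x)) = EFin \o g) in H; last first.
  by apply/funext => x; apply/cvg_lim => //; exact: lim.
have leB : (\int[mu]_(x in setT) (g x)%:E <= B%:E)%E.
  rewrite -(cvg_lim _ H)//; apply: lime_le; first by apply/cvg_ex; eexists; exact: H.
  by apply: nearW => n; rewrite gnE lee_fin.
have gi : mu.-integrable setT (EFin \o g).
  apply/integrableP; split => //.
  under eq_integral do rewrite /= ger0_norm//.
  by rewrite (le_lt_trans leB)// ltry.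
split => //; rewrite -lee_fin /Rintegral fineK//.
exact: integrable_fin_num.
Qed.

Lemma is_derive_expRZ (c x : R) : is_derive x (1 : R) (fun y => expR (c * y)) (c * expR (c * x)).
Proof.
have A : is_derive x (1 : R) (fun y => c * y) c.
  apply/is_derive_realP => e e0; exists 1 => // h _.
  have -> : c * (x + h) - c * x - c * h = 0 by ring.
  by rewrite normr0 mulr_ge0// ltW.
have H := is_derive1_comp (is_derive_expR (c * x)) A.
by apply: (is_derive_eq (f := fun y => expR (c * y))); rewrite mulrC.
Qed.

Lemma continuous_expRZ (c x : R) : {for x, continuous (fun y => expR (c * y))}.
Proof.
by case: (is_derive_expRZ c x) => /derivable1_diffP/differentiable_continuous.
Qed.

Lemma Rintegral_expRZ (a b c : R) : a <= b -> c != 0 ->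
  \int[mu]_(x in `[a, b]) expR (c * x) = c^-1 * expR (c * b) - c^-1 * expR (c * a).
Proof.
move=> ab c0.
apply: (Rintegral_FTC2 (F := fun x => c^-1 * expR (c * x)) (f := fun x => expR (c * x))) => //.
- move=> x _; apply/is_derive_realP => e e0.
  have ce : 0 < e * `|c| by rewrite mulr_gt0 ?normr_gt0.
  have [d d0 dP] := (is_derive_realP _ _ _).1 (is_derive_expRZ c x) _ ce.
  exists d => // h /dP hP.
  have -> : c^-1 * expR (c * (x + h)) - c^-1 * expR (c * x) - expR (c * x) * h =
    c^-1 * (expR (c * (x + h)) - expR (c * x) - c * expR (c * x) * h) by field.
  rewrite normrM normfV mulrC ler_pdivrMr ?normr_gt0// (le_trans hP)//.
  by rewrite mulrAC.
- by move=> x _; exact: continuous_expRZ.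
Qed.

Lemma continuous_expRN_abs (d x : R) : {for x, continuous (fun x => expR (- (d * `|x|)))}.
Proof.
apply: (@continuous_comp _ _ _ (fun x => - (d * `|x|)) expR); last exact: continuous_expR.
apply: cvgN; apply: cvgM; first exact: cvg_cst.
exact: norm_continuous.
Qed.

Lemma integrable_expRN_abs (d : R) : 0 < d ->
  mu.-integrable setT (EFin \o (fun x => expR (- (d * `|x|)))).
Proof.
move=> d0.
suff gB (n : nat) : \int[mu]_(x in `[- (n%:R), n%:R]) expR (- (d * `|x|)) <= d^-1 + d^-1.
  by case: (integrable_of_segments (@continuous_expRN_abs d) (fun x => expR_ge0 _) gB).
have n0 : 0 <= n%:R :> R by [].
rewrite (@Rintegral_split _ _ 0); last 2 first.
- by rewrite n0 andbT oppr_le0.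
- by apply: continuous_between_integrable => x _; exact: continuous_expRN_abs.
apply: lerD.
- rewrite (@eq_Rintegral_segment _ _ _ (fun x => expR (d * x))); last first.
    move=> x /andP[_ x0].
    by rewrite ler0_norm// mulrN opprK.
  rewrite Rintegral_expRZ ?oppr_le0// ?gt_eqF// mulr0 expR0 mulr1.
  by rewrite gerBl mulr_ge0 ?invr_ge0 ?expR_ge0// ltW.
- rewrite (@eq_Rintegral_segment _ _ _ (fun x => expR (- d * x))); last first.
    move=> x /andP[x0 _].
    by rewrite ger0_norm// mulNr.
  rewrite Rintegral_expRZ// ?oppr_eq0 ?gt_eqF// mulr0 expR0 mulr1 invrN opprK.
  by rewrite addrC mulNr gerBl mulr_ge0 ?invr_ge0 ?expR_ge0// ltW.
Qed.

Lemma cintegrable_exp_decay (f : R -> C) (K d : R) : (forall x, {for x, continuous f}) ->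
  0 < d -> (forall u, 1 <= `|u| -> normc (f u) <= K * expR (- (d * `|u|))) ->
  cintegrable setT f.
Proof.
move=> fc d0 fK.
have [M M0 MP] := @continuous_between_bounded R (-1) 1 f (fun x _ => fc x).
have mT : measurable (setT : set (measurableTypeR R)) by exact: measurableT.
pose K' := Num.max K (M * expR d).
have hi : mu.-integrable setT (EFin \o (fun u => K' * expR (- (d * `|u|)))).
  have := integrableZl mT K' (integrable_expRN_abs d0).
  by apply: (eq_integrable mT) => x _; rewrite /= EFinM.
apply: (cintegrable_le mT fc hi) => u _.
have [u1|u1] := leP 1 `|u|.
  by rewrite (le_trans (fK u u1))// ler_wpM2r ?expR_ge0// le_max lexx.
apply: (@le_trans _ _ (M * expR d * expR (- (d * `|u|)))).
  rewrite -mulrA -expRD -[leLHS]mulr1; apply: ler_pM => //.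
  - exact: normc_ge0.
  - by apply: MP; rewrite -ler_norml ltW.
  - by rewrite -expR0 ler_expR subr_ge0 ler_piMr// ltW.
by rewrite ler_wpM2r ?expR_ge0// le_max lexx orbT.
Qed.

End Integrability.

(** * The Bernoulli transform *)

Section BernoulliTransform.
Variable R : realType.
Local Notation C := R[i].
Local Notation mu := (@lebesgue_measure R).
Implicit Types (w z : C).
Local Notation Re := (@complex.Re R).
Local Notation Im := (@complex.Im R).

Lemma pi_neq0 : (pi : R) != 0.
Proof. by rewrite gt_eqF ?pi_gt0. Qed.

(** The modulus forces [Re w = 0], and the half-angle formula gives [sin (Im w / 2) = 0] with
    [|Im w / 2| < pi]. *)
Lemma cexp_eq1 w : `|Im w| < 2 * pi -> cexp w = 1 -> w = 0.
Proof.
move=> wpi w1.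
have Rw : Re w = 0.
  by apply: (@expR_inj R); rewrite expR0 -normc_cexp w1 normc1.
have cw : cos (Im w) = 1.
  move: w1 => /(congr1 Re); rewrite /cexp !cRI Rw expR0 /=.
  by rewrite !cRI.
have sw : sin (Im w / 2) = 0.
  have : cos (Im w / 2 *+ 2) = 1 by rewrite -mulr_natr divfK.
  rewrite cos_mulr2n => h; apply/eqP; rewrite -sqrf_eq0 sin2cos2; apply/eqP.
  by move: h; lra.
suff Iw : Im w = 0 by apply: complex_eqP.
apply/eqP; case: ltgtP => // h.
- have := @sin_gt0_pi R (- (Im w / 2)); rewrite sinN sw oppr0 ltxx; apply.
  by move: wpi h; rewrite ltr_norml; lra.
- have := @sin_gt0_pi R (Im w / 2); rewrite sw ltxx; apply.
  by move: wpi h; rewrite ltr_norml; lra.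
Qed.

Lemma cexp_factor : exists E : C -> C, [/\ forall w, exists l, cderiv E w l,
  E 0 = 1 & forall w, cexp w = 1 + w * E w].
Proof.
have an : analytic_on setT (@cexp R).
  by move=> w _; exact: cderiv_derivable (cderiv_cexp w).
have [g [ga g0 gE]] := analytic_factor (@openT C) an (@openT_star R 0).
exists g; split.
- by move=> w; exists ('D_1 g w); apply: derivable_cderiv; exact: ga.
- by rewrite g0 (cderiv_derive1 (cderiv_cexp 0)) cexp0.
- by move=> w; rewrite (gE w I) cexp0 subr0.
Qed.

(** With [E] the entire extension of [(cexp w - 1) / w], the Bernoulli function is [cexp w / E w],
    and [E] has no zero in the strip by [cexp_eq1]. *)
Lemma cderiv_bernoulli w : `|Im w| < 2 * pi -> exists l, cderiv (@bernoulli_fun R) w l.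
Proof.
have [E [dE E0 EE]] := cexp_factor; have [l dl] := dE w => wpi.
have Ew : E w != 0.
  have [->|w0] := eqVneq w 0; first by rewrite E0 oner_eq0.
  apply/eqP => Ew; move: (EE w); rewrite Ew mulr0 addr0 => /(cexp_eq1 wpi) w00.
  by rewrite w00 eqxx in w0.
eexists; apply: cderiv_ext (cderivM (cderiv_cexp w) (cderivV Ew dl)) => z.
rewrite /bernoulli_fun; case: eqVneq => [->|z0]; first by rewrite E0 cexp0 invr1 mulr1.
rewrite (_ : cexp z - 1 = z * E z); last by rewrite EE; ring.
by rewrite -mulf_div divff// mul1r.
Qed.

Lemma arctan_derivative (a b k p u : R) : p != 0 ->
  2 * a - 2 * b - 2 * p / (u ^+ 2 + p ^+ 2) * k = 2 * (a - b - (1 + (u / p) ^+ 2)^-1 / p * k).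
Proof.
move=> p0; have p2 : u ^+ 2 + p ^+ 2 != 0.
  by rewrite paddr_eq0 ?sqr_ge0// negb_and [_ ^+ 2 == 0 :> R in X in _ || X]sqrf_eq0 p0 orbT.
have -> : 1 + (u / p) ^+ 2 = (u ^+ 2 + p ^+ 2) / p ^+ 2 by field.
by field; rewrite p0 p2.
Qed.

Section Strip.
Variables (sg : C).
Hypothesis sg01 : 0 < Re sg < 1.

(** For [sg = 'i * w'] this is the integrand of the Fourier transform at [w'], and [0 < Re sg < 1]
    means [-1 < Im w' < 0]. The number [q] below is what the exponential is multiplied by under a
    translation by [2 pi 'i]. *)
Let M w := bernoulli_fun w * cexp (- sg * w).
Let q := cexp (- sg * ('i * (2 * pi)%:C)).

Let cderivMM w : `|Im w| < 2 * pi -> exists l, cderiv M w l.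
Proof.
by move=> /cderiv_bernoulli[l dl]; eexists; exact: (cderivM dl (cderiv_cexpZ _ _)).
Qed.

(** The Bernoulli function grows like [x] on the right and like [x * exp x] on the left. After
    multiplication by [exp (- sg * x)] a decay of rate [d = min (Re sg) (1 - Re sg)] is left at both
    ends; half of it pays for the factor [normc x]. *)
Let M_bound : exists K d : R, [/\ 0 < d, 0 <= K & forall u v : R, 1 <= `|u| -> `|v| <= pi ->
  normc (M (u%:C + 'i * v%:C)) <= K * expR (- (d * `|u|))].
Proof.
case/andP: sg01 => s0 s1.
pose d := Num.min (Re sg) (1 - Re sg).
have d0 : 0 < d by rewrite lt_min s0 subr_gt0.
pose T := expR (`|Im sg| * pi).
exists (2 * (2 / d + pi) * T), (d / 2); split.
- by rewrite divr_gt0.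
- by rewrite !mulr_ge0 ?expR_ge0// addr_ge0 ?divr_ge0 ?pi_ge0// ltW.
move=> u v u1 vpi; set x := u%:C + 'i * v%:C.
have nx : normc (cexp x) = expR u by rewrite normc_cexp Re_line.
have x0 : x != 0.
  apply/eqP => /(congr1 Re); rewrite Re_line /= => u0.
  by move: u1; rewrite u0 normr0 ler10.
have T0 : 0 < T by exact: expR_gt0.
have b1 : normc (bernoulli_fun x) <= 2 * normc x * Num.min 1 (expR u).
  rewrite /bernoulli_fun (negbTE x0) normcM normcV normcM nx.
  have n0 := normc_ge0 x.
  have [u0|u0] := leP 0 u.
  - move: u1; rewrite ger0_norm// => u1.
    have e2 : 2 <= expR u by rewrite (le_trans _ (expR_ge1Dx u))//; lra.
    have h : expR u / 2 <= normc (cexp x - 1).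
      have := normc_sub (cexp x - 1) (- 1); rewrite opprK subrK normcN normc1 nx; lra.
    have hp : 0 < normc (cexp x - 1) by rewrite (lt_le_trans _ h)// divr_gt0// expR_gt0.
    rewrite ler_pdivrMr// min_l; last by move: e2; lra.
    rewrite mulr1 -mulrA mulrCA ler_wpM2l//; move: h; lra.
  - move: u1; rewrite ltr0_norm// => u1.
    have e2 : expR u <= 2^-1.
      rewrite -[u]opprK expRN lef_pV2 ?posrE ?expR_gt0//.
      by rewrite (le_trans _ (expR_ge1Dx _))//; lra.
    have h : 1 / 2 <= normc (cexp x - 1).
      have := normc_sub (cexp x) (cexp x - 1).
      rewrite (_ : cexp x - (cexp x - 1) = 1); last by ring.
      by rewrite normc1 nx; move: e2; lra.
    have hp : 0 < normc (cexp x - 1) by rewrite (lt_le_trans _ h)// divr_gt0.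
    rewrite ler_pdivrMr// min_r; last by move: e2; lra.
    have ex : 0 <= normc x * expR u by rewrite mulr_ge0 ?expR_ge0.
    have := ler_wpM2l ex h; lra.
have b2 : normc (cexp (- sg * x)) <= T * expR (- (Re sg * u)).
  rewrite normc_cexp -expRD ler_expR !cRI.
  have : Im sg * v <= `|Im sg| * pi.
    by rewrite (le_trans (ler_norm _))// normrM ler_wpM2l.
  lra.
have b3 : Num.min 1 (expR u) * expR (- (Re sg * u)) <= expR (- (d * `|u|)).
  have dle1 : d <= Re sg by rewrite ge_min lexx.
  have dle2 : d <= 1 - Re sg by rewrite ge_min lexx orbT.
  have [u0|u0] := leP 0 u.
  - apply: (@le_trans _ _ (1 * expR (- (Re sg * u)))).
      by rewrite ler_wpM2r ?expR_ge0// ge_min lexx.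
    by rewrite mul1r ler_expR lerN2 ger0_norm// ler_wpM2r.
  - apply: (@le_trans _ _ (expR u * expR (- (Re sg * u)))).
      by rewrite ler_wpM2r ?expR_ge0// ge_min lexx orbT.
    rewrite -expRD ler_expR ltr0_norm//.
    have := ler_wpM2r (_ : 0 <= - u) dle2; rewrite oppr_ge0 (ltW u0) => /(_ isT); lra.
have b4 : normc x <= `|u| + pi.
  rewrite (le_trans (normcD _ _))// normcM normci mul1r !normc_real lerD2l//.
have b5 : (`|u| + pi) * expR (- (d * `|u|)) <= (2 / d + pi) * expR (- (d / 2 * `|u|)).
  have -> : - (d * `|u|) = - (d / 2 * `|u|) + - (d / 2 * `|u|) by field.
  rewrite expRD mulrA ler_wpM2r ?expR_ge0// mulrDl lerD//.
    rewrite expRN ler_pdivrMr ?expR_gt0//.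
    have := expR_ge1Dx (d / 2 * `|u|); have := normr_ge0 u => un h.
    have E : `|u| = 2 / d * (d / 2 * `|u|) by field; rewrite gt_eqF.
    rewrite [leLHS]E; apply: ler_wpM2l; first by rewrite divr_ge0// ltW.
    by move: h; lra.
  rewrite ler_piMr ?pi_ge0// -expR0 ler_expR oppr_le0.
  by apply: mulr_ge0 => //; rewrite divr_ge0// ltW.
have n0 := normc_ge0 x.
have m0 : 0 <= Num.min 1 (expR u) by rewrite le_min ler01 expR_ge0.
rewrite normcM.
apply: (@le_trans _ _ ((2 * normc x * Num.min 1 (expR u)) * (T * expR (- (Re sg * u))))).
  by apply: ler_pM; rewrite ?normc_ge0.
have -> : (2 * normc x * Num.min 1 (expR u)) * (T * expR (- (Re sg * u))) =
  2 * T * (normc x * (Num.min 1 (expR u) * expR (- (Re sg * u)))) by ring.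
have -> : 2 * (2 / d + pi) * T * expR (- (d / 2 * `|u|)) =
  2 * T * ((2 / d + pi) * expR (- (d / 2 * `|u|))) by ring.
apply: ler_wpM2l; first by rewrite mulr_ge0// ltW.
apply: le_trans b5; apply: ler_pM => //.
Qed.

Let strip2 (u v : R) : `|v| <= pi -> `|Im (u%:C + 'i * v%:C)| < 2 * pi.
Proof. by rewrite Im_line => /le_lt_trans; apply; rewrite ltr_pMl ?pi_gt0// ltr1n. Qed.

Let cderivM_line (u v : R) : `|v| <= pi -> exists l, cderiv M (u%:C + 'i * v%:C) l.
Proof. by move=> vpi; apply: cderivMM; exact: strip2. Qed.

Let M_line_cont (v : R) : `|v| <= pi -> forall u : R, {for u, continuous (fun u : R => M (u%:C + 'i * v%:C))}.
Proof.
move=> vpi u; apply: continuous_hline.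
by have [l] := cderivM_line u vpi; exact: cderiv_cont.
Qed.

Let M_line_int (v : R) : `|v| <= pi -> cintegrable setT (fun u : R => M (u%:C + 'i * v%:C)).
Proof.
move=> vpi; have [K [d [d0 K0 Mb]]] := M_bound.
apply: (cintegrable_exp_decay (M_line_cont vpi) d0 (K := K)) => u u1.
exact: Mb.
Qed.

Let M_shift (v v' : R) : - pi <= v -> v <= v' -> v' <= pi ->
  cintegral setT (fun u : R => M (u%:C + 'i * v%:C)) =
  cintegral setT (fun u : R => M (u%:C + 'i * v'%:C)).
Proof.
move=> h1 h2 h3; have [K [d [d0 K0 Mb]]] := M_bound.
have vin (x : R) : v <= x <= v' -> `|x| <= pi by rewrite ler_norml => ?; lra.
apply: (contour_shift (K := K) (s := 0) h2).
- move=> u x /vin xpi; have [l] := cderivM_line u xpi; exact: cderiv_derivable.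
- move=> u x u1 /vin xpi; rewrite (le_trans (Mb u x u1 xpi))// ler_wpM2l// ler_expR mul0r.
  by rewrite oppr_le0 mulr_ge0// ltW.
- by apply: M_line_int; apply: vin; rewrite lexx.
- by apply: M_line_int; apply: vin; rewrite lexx andbT.
Qed.

Let nv : `|- pi| <= pi :> R. Proof. by rewrite normrN ger0_norm ?pi_ge0. Qed.
Let pv : `|pi| <= pi :> R. Proof. by rewrite ger0_norm ?pi_ge0. Qed.

Let xm (u : R) : C := u%:C + 'i * (- pi)%:C.
Let xp (u : R) : C := u%:C + 'i * pi%:C.
(** Since [cexp] has period [2 pi 'i], the values of [M] on the two boundary lines are [xm * km] and
    [q * xp * km] with the same [km]: only the linear factor and [q] distinguish them. *)
Let km (u : R) : C := M (xm u) / xm u.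

Let line_neq0 (u v : R) : v != 0 -> u%:C + 'i * v%:C != 0 :> C.
Proof. by move=> v0; apply/eqP => /(congr1 Im); rewrite Im_line => /= v00; rewrite v00 eqxx in v0. Qed.

Let xm0 u : xm u != 0. Proof. by rewrite line_neq0// oppr_eq0 pi_neq0. Qed.
Let xp0 u : xp u != 0. Proof. by rewrite line_neq0// pi_neq0. Qed.

Let xpE u : xp u = xm u + 'i * (2 * pi)%:C.
Proof. by rewrite /xp /xm real_complexN real_complexM real_complex_nat; ring. Qed.

Let Mxm u : M (xm u) = xm u * km u.
Proof. by rewrite /km mulrC divfK. Qed.

Let Mxp u : M (xp u) = q * (xp u * km u).
Proof.
rewrite /km /M /bernoulli_fun (negbTE (xm0 u)) (negbTE (xp0 u)).
have -> : cexp (xp u) = cexp (xm u) by rewrite xpE cexpD cexp_2pi mulr1.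
have -> : cexp (- sg * xp u) = cexp (- sg * xm u) * q by rewrite xpE mulrDr cexpD.
rewrite -[xp u * _ / _]mulrA -[xm u * _ / _]mulrA.
move: (cexp (xm u) / (cexp (xm u) - 1)) => X.
by field; exact: xm0.
Qed.

Let km_cont u : {for u, continuous km}.
Proof.
have [l dl] := cderivM_line u nv.
have H := cderiv_cont (cderivM dl (cderiv_inv (xm0 u))).
exact: (@continuous_hline R (fun w => M w * w^-1) (- pi) u H).
Qed.

Let km_int : cintegrable setT km.
Proof.
have [K [d [d0 K0 Mb]]] := M_bound.
apply: (cintegrable_exp_decay km_cont d0 (K := K)) => u u1.
rewrite normcM normcV ler_pdivrMr ?normc_gt0//.
apply: (le_trans (Mb u (- pi) u1 nv)).
rewrite ler_peMr ?mulr_ge0 ?expR_ge0//.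
apply: (le_trans u1); apply: le_trans (Re_le_normc _).
by rewrite Re_line.
Qed.

Let mT : measurable (setT : set (measurableTypeR R)).
Proof. exact: measurableT. Qed.

(* [(M w - 1) / w] is holomorphic in the strip, so its integrals along
   [Im w = - pi] and [Im w = pi] agree; the [1 / w] parts leave an arctangent. *)
Lemma one_minus_q_integral_km : (1 - q) * cintegral setT km = 'i * (2 * pi)%:C.
Proof.
have [K [d [d0 K0 Mb]]] := M_bound.
pose U := [set w : C | `|Im w| < 2 * pi].
have Uo : open U.
  rewrite openE => z zU; apply/nbhs_normc; exists (2 * pi - `|Im z|); first by rewrite subr_gt0.
  move=> w wz; have := Im_le_normc (w - z).
  have := ler_normD (Im (w - z)) (Im z); rewrite -cImD subrK /U /= => h1 h2.
  by apply: le_lt_trans h1 _; rewrite -ltrBrDr (le_lt_trans h2).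
have Us : star_shaped U 0.
  move=> w s wU /andP[s0 s1]; rewrite /U /= add0r subr0 !cRI normrM ger0_norm//.
  by apply: le_lt_trans wU; rewrite ler_piMl.
have Ma : analytic_on U M.
  by move=> w /cderivMM[l]; exact: cderiv_derivable.
have [h [ha _ hE]] := analytic_factor Uo Ma Us.
have M0 : M 0 = 1 by rewrite /M /bernoulli_fun eqxx mulr0 cexp0 mulr1.
have lineU (u v : R) : `|v| <= pi -> U (u%:C + 'i * v%:C) by move=> vpi; exact: strip2.
have hM (u v : R) : `|v| <= pi -> u%:C + 'i * v%:C != 0 ->
    h (u%:C + 'i * v%:C) = (M (u%:C + 'i * v%:C) - 1) / (u%:C + 'i * v%:C).
  move=> vpi x0; rewrite (hE _ (lineU u v vpi)) M0 subr0 addrAC subrr add0r.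
  by rewrite mulrAC divff// mul1r.
have vin (x : R) : - pi <= x <= pi -> `|x| <= pi by rewrite ler_norml.
have npi : - pi <= pi :> R by have := pi_ge0 R; lra.
have hd (u v : R) : - pi <= v <= pi -> derivable h (u%:C + 'i * v%:C) 1.
  by move=> /vin vpi; apply: ha; exact: lineU.
have L := shift_truncated npi hd.
have {}L : (cintegral `[- (n%:R), n%:R] (fun u : R => h (u%:C + 'i * (- pi)%:C))
   - cintegral `[- (n%:R), n%:R] (fun u : R => h (u%:C + 'i * pi%:C))) @[n --> \oo] --> (0 : C).
  apply: L => e e0.
  (* On the vertical sides [M] is bounded by [K] and the modulus of the variable is at least [n],
     whence the bound [(K + 1) / n] for [(M w - 1) / w]. *)
  exists (Num.bound ((K + 1) / e)).+1 => n nN v /vin vpi.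
  have n1 : 1 <= n%:R :> R by rewrite ler1n (leq_trans _ nN).
  have n0 : 0 < n%:R :> R by rewrite (lt_le_trans _ n1).
  have ne : K + 1 <= e * n%:R.
    rewrite mulrC -ler_pdivrMr//; apply: le_trans (ltW (archi_boundP _)) _.
      by rewrite divr_ge0// ?addr_ge0// ltW.
    by rewrite ler_nat (leq_trans _ nN).
  have key (u : R) : `|u| = n%:R -> normc (h (u%:C + 'i * v%:C)) <= e.
    move=> un; have nx : n%:R <= normc (u%:C + 'i * v%:C).
      by have := Re_le_normc (u%:C + 'i * v%:C); rewrite Re_line un.
    have x0 : u%:C + 'i * v%:C != 0 by rewrite -normc_gt0 (lt_le_trans _ nx).
    rewrite (hM _ _ vpi x0) normcM normcV ler_pdivrMr ?normc_gt0//.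
    apply: (@le_trans _ _ (e * n%:R)); last by rewrite ler_wpM2l// ltW.
    apply: le_trans ne; rewrite (le_trans (normc_sub _ _))// normc1 lerD2r.
    apply: le_trans (Mb u v _ vpi) _; first by rewrite un.
    rewrite ler_piMr// -expR0 ler_expR oppr_le0 mulr_ge0// ltW//.
  by split; apply: key; rewrite ?normrN normr_nat.
pose G (u : R) := 2 * pi / (u ^+ 2 + pi ^+ 2).
have p2 (u : R) : 0 < u ^+ 2 + pi ^+ 2 :> R by rewrite ltr_wpDl ?sqr_ge0// exprn_gt0// pi_gt0.
(* The terms [1 / xm - 1 / xp] combine to [(xp - xm) / (xm * xp)], whose numerator is [2 pi 'i] and
   whose denominator is the real number [u ^+ 2 + pi ^+ 2]. *)
have hdiff (u : R) : h (xm u) - h (xp u) = (1 - q) * km u - 'i * (G u)%:C.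
  rewrite /xm hM ?xm0// -/(xm u) /xp hM ?xp0// -/(xp u) Mxm Mxp.
  have -> : (G u)%:C = (2 * pi)%:C / (xm u * xp u).
    rewrite /G real_complexM real_complexV; congr (_ / _).
    rewrite /xm /xp; apply: complex_eqP; rewrite !cRI; ring.
  have -> : 'i * ((2 * pi)%:C / (xm u * xp u)) = (xp u - xm u) / (xm u * xp u).
    rewrite (_ : xp u - xm u = 'i * (2 * pi)%:C); last by rewrite xpE; ring.
    by rewrite mulrA.
  by field; rewrite xm0 xp0.
have hxmc (u : R) : {for u, continuous (fun u : R => h (xm u))}.
  by apply: continuous_hline; apply: (analytic_cont ha); exact: lineU.
have hxpc (u : R) : {for u, continuous (fun u : R => h (xp u))}.
  by apply: continuous_hline; apply: (analytic_cont ha); exact: lineU.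
pose At (u : R) := 2 * atan (u / pi).
have dAt (u : R) : is_derive u (1 : R) At (G u).
  have A1 : is_derive u (1 : R) (fun y => y / pi) pi^-1.
    apply/is_derive_realP => e e0; exists 1 => // k _.
    have -> : (u + k) / pi - u / pi - pi^-1 * k = 0 by ring.
    by rewrite normr0 mulr_ge0// ltW.
  have A2 := @is_derive1_comp R (@atan R) (fun y => y / pi) u _ _ (is_derive1_atan (u / pi)) A1.
  apply/is_derive_realP => e e0.
  have [dd dd0 ddP] := (is_derive_realP _ _ _).1 A2 _ (divr_gt0 e0 ltr02).
  exists dd => // k /ddP /= kP.
  have -> : At (u + k) - At u - G u * k =
     2 * (atan ((u + k) / pi) - atan (u / pi) - (1 + (u / pi) ^+ 2)^-1 / pi * k).
    exact: (@arctan_derivative _ _ _ pi _ pi_neq0).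
  by rewrite normrM ger0_norm// -ler_pdivlMl// mulrA [2^-1 * e]mulrC.
have Gc (u : R) : {for u, continuous G}.
  apply: cvgM; first exact: cvg_cst.
  apply: cvgV; first by rewrite gt_eqF.
  apply: cvgD; last exact: cvg_cst.
  by apply: exprn_continuous.
have GI (n : nat) : \int[mu]_(x in `[- (n%:R), n%:R]) G x = 4 * atan (n%:R / pi).
  rewrite (Rintegral_FTC2 (F := At)) //.
  - by rewrite /At mulNr atanN; ring.
  - by rewrite (le_trans _ (ler0n R n))// oppr_le0.
(* This limit is the total mass of [G], and produces the right-hand side ['i * (2 * pi)]. *)
have atlim : 4 * atan (n%:R / pi) @[n --> \oo] --> (2 * pi : R).
  rewrite (_ : 2 * pi = 4 * (pi / 2)); last by field.
  apply: cvgM; first exact: cvg_cst.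
  apply: cvg_comp (@cvgy_atan R).
  apply/cvgryPge => A; exists (Num.bound (A * pi)) => // n /= nA.
  rewrite ler_pdivlMr ?pi_gt0//; have [A0|A0] := leP (A * pi) 0.
    by rewrite (le_trans A0).
  by rewrite (le_trans (ltW (archi_boundP (ltW A0))))// ler_nat.
have L2 : (1 - q) * cintegral `[- (n%:R), n%:R] km @[n --> \oo] --> (1 - q) * cintegral setT km.
  by apply: cvgM; [exact: cvg_cst | exact: cintegral_lim].
have L3 : 'i * (4 * atan (n%:R / pi))%:C @[n --> \oo] --> ('i * (2 * pi)%:C : C).
  apply: cvgM; first exact: cvg_cst.
  by apply/cvg_ReIm; split; [exact: atlim | exact: cvg_cst].
have L4 := ccvgB L2 L3.
have E : forall n : nat, (cintegral `[- (n%:R), n%:R] (fun u : R => h (u%:C + 'i * (- pi)%:C))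
   - cintegral `[- (n%:R), n%:R] (fun u : R => h (u%:C + 'i * pi%:C))) =
   (1 - q) * cintegral `[- (n%:R), n%:R] km - 'i * (4 * atan (n%:R / pi))%:C.
  move=> n.
  have mI : measurable (`[- (n%:R), n%:R]%classic : set (measurableTypeR R)) by exact: measurable_itv.
  have i1 : cintegrable `[- (n%:R), n%:R] (fun u : R => h (xm u)).
    by apply: continuous_between_cintegrable => x _; exact: hxmc.
  have i2 : cintegrable `[- (n%:R), n%:R] (fun u : R => h (xp u)).
    by apply: continuous_between_cintegrable => x _; exact: hxpc.
  have i3 : cintegrable `[- (n%:R), n%:R] km.
    by apply: continuous_between_cintegrable => x _; exact: km_cont.
  have gc : continuous_between (- n%:R) n%:R (fun u : R => (G u)%:C).
    by move=> x _; apply/cvg_ReIm; split; [exact: Gc | exact: cvg_cst].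
  have i4 := continuous_between_cintegrable gc.
  rewrite -(cintegralB mI i1 i2) -(cintegralZ _ mI i3) -GI.
  have -> : (\int[mu]_(x in `[- (n%:R), n%:R]) G x)%:C = cintegral `[- (n%:R), n%:R] (fun u : R => (G u)%:C).
    apply: complex_eqP => //=; rewrite /Rintegral integral0_eq//.
  rewrite -(cintegralZ _ mI i4) -(cintegralB mI (cintegrableZ _ mI i3) (cintegrableZ _ mI i4)).
  by apply: eq_cintegral => u _; rewrite hdiff.
move: L; under eq_cvg do rewrite E; move=> L.
by have /eqP := ccvg_unique L4 L; rewrite subr_eq0 => /eqP.
Qed.

(** Both boundary lines have the integral [I0]. In [q * M (xm u) - M (xp u)] the linear factors
    cancel up to [xm u - xp u = - 2 pi 'i], which leaves [- 2 pi 'i * q * km u]. A second factor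
    [1 - q] brings in [one_minus_q_integral_km]; this is where the double pole of the kernel comes
    from. *)
Theorem bernoulli_transform :
  cintegral setT (fun x : R => bernoulli_fun x%:C * cexp (- sg * x%:C)) * (1 - q) ^+ 2 =
  - (2 * pi)%:C ^+ 2 * q.
Proof.
set I0 := cintegral _ _.
have E0 : I0 = cintegral setT (fun u : R => M (u%:C + 'i * 0%:C)).
  by apply: eq_cintegral => u _; rewrite mulr0 addr0.
have piN : - pi <= 0 :> R by rewrite oppr_le0 pi_ge0.
have Em : I0 = cintegral setT (fun u : R => M (xm u)).
  exact: (etrans E0 (esym (M_shift (lexx _) piN (pi_ge0 R)))).
have Ep : I0 = cintegral setT (fun u : R => M (xp u)).
  exact: (etrans E0 (M_shift piN (pi_ge0 R) (lexx _))).
have i1 := M_line_int nv; have i2 := M_line_int pv.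
have qi : cintegrable setT (fun u : R => q * M (xm u)) by exact: cintegrableZ.
have : q * I0 - I0 = - ('i * (2 * pi)%:C * q * cintegral setT km).
  rewrite {1}Em Ep -(cintegralZ _ mT i1) -(cintegralB mT qi i2) -(cintegralZ _ mT km_int).
  rewrite -(cintegralN mT (cintegrableZ _ mT km_int)).
  apply: eq_cintegral => u _; rewrite -/(xm u) -/(xp u) Mxm Mxp xpE; ring.
have := one_minus_q_integral_km; set A := cintegral setT km => HA HI.
have -> : I0 * (1 - q) ^+ 2 = (- (q * I0 - I0)) * (1 - q) by ring.
rewrite HI opprK.
have -> : 'i * (2 * pi)%:C * q * A * (1 - q) = 'i * (2 * pi)%:C * q * ((1 - q) * A) by ring.
rewrite HA.
have -> : 'i * (2 * pi)%:C * q * ('i * (2 * pi)%:C) = ('i * 'i) * (2 * pi)%:C ^+ 2 * q by ring.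
by rewrite ii mulN1r.
Qed.

End Strip.
End BernoulliTransform.

(** * Primitives in weighted spaces *)

Section WeightedPrimitive.
Variable R : realType.
Local Notation C := R[i].
Local Notation mu := (@lebesgue_measure R).
Local Notation Re := (@complex.Re R).
Local Notation Im := (@complex.Im R).

Lemma is_derive_real_near (f g : R -> R) (x l d : R) : 0 < d ->
  (forall y, `|y - x| < d -> f y = g y) -> is_derive x (1 : R) f l -> is_derive x (1 : R) g l.
Proof.
move=> d0 fg /is_derive_realP df; apply/is_derive_realP => e /df[d' d'0 dP].
exists (Num.min d d') => [|h]; first by rewrite lt_min d0.
rewrite lt_min => /andP[hd /dP].
have -> : f (x + h) = g (x + h) by apply: fg; rewrite (addrC x) addrK.
by have -> : f x = g x by apply: fg; rewrite subrr normr0.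
Qed.

Lemma continuous_primitive (g : R -> R) : (forall x : R, {for x, continuous g}) ->
  exists P : R -> R, forall x, is_derive x (1 : R) P (g x).
Proof.
move=> gc.
have gi (a b : R) : mu.-integrable `[a, b] (EFin \o g).
  by apply: continuous_between_integrable => x _; exact: gc.
(* A segment with reversed bounds is empty, so the difference is the signed integral from 0 to
   [x]. *)
exists (fun x => \int[mu]_(t in `[0, x]) g t - \int[mu]_(t in `[x, 0]) g t) => x.
pose N := `|x| + 1.
have N0 : 0 < N by rewrite ltr_wpDl.
have xN : - N < x by rewrite /N; have := ler_norm (- x); rewrite normrN; lra.
have xN' : x < x + 1 by rewrite ltrDl.
have gi1 : mu.-integrable `[- N, x + 1] (EFin \o g) by exact: gi.
have [d1 d2] := continuous_FTC1 xN' gi1 xN (gc x).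
have D : is_derive x (1 : R) (fun y => \int[mu]_(t in `[- N, y]) g t) (g x).
  by rewrite -d2 derive1E; exact: derivableP.
pose c := \int[mu]_(t in `[- N, 0]) g t.
apply: (@is_derive_real_near (fun y => \int[mu]_(t in `[- N, y]) g t - c) _ _ _ 1 ltr01).
- move=> y yx.
  have yN : - N <= y.
    have := ler_norm (- x); have := ler_norm (x - y); rewrite distrC normrN /N; lra.
  have [y0|y0] := leP 0 y.
  + rewrite (@Rintegral_split _ (- N) 0 y) ?oppr_le0 ?(ltW N0) ?y0//.
    rewrite /c addrAC subrr add0r.
    have [->|yn] := eqVneq y 0; first by rewrite set_itv1 Rintegral_set1 subrr.
    rewrite (@set_itv_ge _ _ (BLeft y) (BRight 0)) ?Rintegral_set0 ?subr0//.
    by rewrite bnd_simp -ltNge lt_neqAle eq_sym yn.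
  + rewrite /c (@Rintegral_split _ (- N) y 0) ?yN ?(ltW y0)//.
    rewrite (@set_itv_ge _ _ (BLeft 0) (BRight y)); last by rewrite bnd_simp -ltNge.
    rewrite Rintegral_set0; ring.
- apply/is_derive_realP => e e0; have [d d0 dP] := (is_derive_realP _ _ _).1 D e e0.
  by exists d => // h /dP; rewrite opprB addrA subrK.
Qed.

Lemma is_derive_real_cont (P : R -> R) (x l : R) : is_derive x (1 : R) P l -> {for x, continuous P}.
Proof. by move=> [/derivable1_diffP/differentiable_continuous]. Qed.

Lemma is_derive_realM (f g : R -> R) (x a b : R) : is_derive x (1 : R) f a ->
  is_derive x (1 : R) g b -> is_derive x (1 : R) (fun y => f y * g y) (a * g x + f x * b).
Proof.
move=> df dg; have H := is_deriveM df dg.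
apply: (is_derive_eq (f := fun y => f y * g y)).
by rewrite /GRing.scale/= addrC (mulrC a).
Qed.

(** By parts, the right side minus the left side is the boundary term
    [c^-1 * (P n - P 0) * expR (- c * n)], which is nonnegative because [P] increases. *)
Lemma weighted_primitive_half (P g : R -> R) (c n : R) : 0 < c -> 0 <= n ->
  (forall x : R, {for x, continuous g}) -> (forall x, 0 <= g x) ->
  (forall x, is_derive x (1 : R) P (g x)) ->
  \int[mu]_(x in `[0, n]) ((P x - P 0) * expR (- c * x)) <=
  c^-1 * \int[mu]_(x in `[0, n]) (g x * expR (- c * x)).
Proof.
move=> c0 n0 gc g0 dP.
have ec x : {for x, continuous (fun x : R => expR (- c * x))} := @continuous_expRZ R (- c) x.
have Pc x : {for x, continuous P} := is_derive_real_cont (dP x).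
have c1 x : {for x, continuous (fun x => (P x - P 0) * expR (- c * x))}.
  by apply: cvgM; [apply: cvgB; [exact: Pc|exact: cvg_cst]|exact: ec].
have c2 x : {for x, continuous (fun x => g x * expR (- c * x))}.
  by apply: cvgM; [exact: gc|exact: ec].
have mI : measurable (`[0%R, n]%classic : set (measurableTypeR R)) by exact: measurable_itv.
have i1 : mu.-integrable `[0, n] (EFin \o (fun x => (P x - P 0) * expR (- c * x))).
  by apply: continuous_between_integrable => x _; exact: c1.
have i2 : mu.-integrable `[0, n] (EFin \o (fun x => g x * expR (- c * x))).
  by apply: continuous_between_integrable => x _; exact: c2.
have i3 : mu.-integrable `[0, n] (EFin \o (fun x => c^-1 * (g x * expR (- c * x)))).
  by have := integrableZl mI c^-1 i2; apply: (eq_integrable mI) => x _; rewrite /= EFinM.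
rewrite -(RintegralZl _ mI i2) -subr_ge0 -(RintegralB mI i3 i1).
have D1 x : 0 <= x <= n -> is_derive x (1 : R) (fun x => c^-1 * ((P x - P 0) * expR (- c * x)))
    (c^-1 * (g x * expR (- c * x)) - (P x - P 0) * expR (- c * x)).
  move=> _.
  have A : is_derive x (1 : R) (fun x => P x - P 0) (g x).
    apply/is_derive_realP => e e0; have [d d0 dd] := (is_derive_realP _ _ _).1 (dP x) e e0.
    by exists d => // h /dd; rewrite opprB addrA subrK.
  have B := is_derive_realM A (is_derive_expRZ (- c) x).
  apply/is_derive_realP => e e0.
  have [d d0 dd] := (is_derive_realP _ _ _).1 B _ (mulr_gt0 e0 c0).
  exists d => // h /dd hP.
  set X := (X in `|X|); have -> : X = c^-1 * ((P (x + h) - P 0) * expR (- c * (x + h)) -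
    (P x - P 0) * expR (- c * x) -
    (g x * expR (- c * x) + (P x - P 0) * (- c * expR (- c * x))) * h).
    by rewrite /X; field; rewrite gt_eqF.
  rewrite normrM ger0_norm ?invr_ge0 ?(ltW c0)// ler_pdivrMl//.
  by apply: (le_trans hP); rewrite [c * _]mulrA (mulrC c).
have D2 : continuous_between 0 n (fun x => c^-1 * (g x * expR (- c * x)) - (P x - P 0) * expR (- c * x)).
  move=> x _; apply: cvgB; last exact: c1.
  by apply: cvgM; [exact: cvg_cst|exact: c2].
rewrite (Rintegral_FTC2 n0 D1 D2) subrr mul0r mulr0 subr0.
have -> : P n - P 0 = \int[mu]_(x in `[0, n]) g x.
  by rewrite (Rintegral_FTC2 n0 (fun x _ => dP x))// => x _; exact: gc.
rewrite mulr_ge0 ?invr_ge0 ?(ltW c0)// mulr_ge0 ?expR_ge0//.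
exact: Rintegral_ge0.
Qed.

Lemma Rintegral_reflect (g : R -> R) (n : R) : 0 <= n -> (forall x : R, {for x, continuous g}) ->
  \int[mu]_(x in `[- n, 0]) g x = \int[mu]_(x in `[0, n]) g (- x).
Proof.
move=> n0 gc; have [P dP] := continuous_primitive gc.
have gNc x : {for x, continuous (fun x : R => g (- x))}.
  by apply: (@continuous_comp _ _ _ (fun x : R => - x) g); [exact: opp_continuous|exact: gc].
have dPN x : is_derive x (1 : R) (fun x => - P (- x)) (g (- x)).
  apply/is_derive_realP => e e0; have [d d0 dd] := (is_derive_realP _ _ _).1 (dP (- x)) e e0.
  exists d => // h hd; have := dd (- h); rewrite normrN => /(_ hd).
  by rewrite opprD -[X in _ -> X <= _]normrN; congr (`|_| <= _); ring.
have nn : - n <= 0 by rewrite oppr_le0.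
rewrite (Rintegral_FTC2 nn (fun x _ => dP x) (fun x _ => gc x)).
rewrite (Rintegral_FTC2 n0 (fun x _ => dPN x) (fun x _ => gNc x)).
by rewrite oppr0; ring.
Qed.

(* Integration by parts on both half-lines: the boundary terms have the right sign. *)
Lemma weighted_primitive_real (P g G : R -> R) (c : R) : 0 < c ->
  (forall x : R, {for x, continuous g}) -> (forall x, 0 <= g x) ->
  (forall x, is_derive x (1 : R) P (g x)) ->
  (forall x : R, {for x, continuous G}) -> (forall x, 0 <= G x <= `|P x - P 0|) ->
  mu.-integrable setT (EFin \o (fun x => g x * expR (- (c * `|x|)))) ->
  mu.-integrable setT (EFin \o (fun x => G x * expR (- (c * `|x|)))) /\
  \int[mu]_(x in setT) (G x * expR (- (c * `|x|))) <=
  c^-1 * \int[mu]_(x in setT) (g x * expR (- (c * `|x|))).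
Proof.
move=> c0 gc g0 dP Gc GP gi.
have ec x : {for x, continuous (fun x : R => expR (- (c * `|x|)))} := @continuous_expRN_abs R c x.
have ec' x : {for x, continuous (fun x : R => expR (- c * x))} := @continuous_expRZ R (- c) x.
have Pc x : {for x, continuous P} := is_derive_real_cont (dP x).
have gNc x : {for x, continuous (fun x : R => g (- x))}.
  by apply: (@continuous_comp _ _ _ (fun x : R => - x) g); [exact: opp_continuous|exact: gc].
have PNc x : {for x, continuous (fun x : R => - P (- x))}.
  by apply: cvgN; apply: (@continuous_comp _ _ _ (fun x : R => - x) P); [exact: opp_continuous|exact: Pc].
have dPN x : is_derive x (1 : R) (fun x => - P (- x)) (g (- x)).
  apply/is_derive_realP => e e0; have [d d0 dd] := (is_derive_realP _ _ _).1 (dP (- x)) e e0.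
  exists d => // h hd; have := dd (- h); rewrite normrN => /(_ hd).
  by rewrite opprD -[X in _ -> X <= _]normrN; congr (`|_| <= _); ring.
have Gec x : {for x, continuous (fun x : R => G x * expR (- (c * `|x|)))}.
  by apply: cvgM; [exact: Gc|exact: ec].
have gec x : {for x, continuous (fun x : R => g x * expR (- (c * `|x|)))}.
  by apply: cvgM; [exact: gc|exact: ec].
have GeNc x : {for x, continuous (fun x : R => G (- x) * expR (- (c * `|- x|)))}.
  by apply: (@continuous_comp _ _ _ (fun x : R => - x) (fun x : R => G x * expR (- (c * `|x|))));
    [exact: opp_continuous|exact: Gec].
have mono (a b : R) (u v : R -> R) : continuous_between a b u -> continuous_between a b v ->
    (forall x, a <= x <= b -> u x <= v x) ->
    \int[mu]_(x in `[a, b]) u x <= \int[mu]_(x in `[a, b]) v x.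
  move=> uc vc uv; apply: le_Rintegral.
  - exact: measurable_itv.
  - exact: continuous_between_integrable.
  - exact: continuous_between_integrable.
  - by move=> x; rewrite /= in_itv /= => /uv.
have Pmono x : 0 <= x -> P 0 <= P x.
  move=> x0; rewrite -subr_ge0 -(Rintegral_FTC2 x0 (fun y _ => dP y)).
    by apply: Rintegral_ge0.
  by move=> y _; exact: gc.
have PNmono x : 0 <= x -> P (- x) <= P 0.
  move=> x0; rewrite -subr_ge0 -lerN2 oppr0 opprB.
  have := Rintegral_FTC2 x0 (fun y _ => dPN y) (fun y _ => gNc y).
  rewrite oppr0 opprK => E; rewrite -oppr_ge0 opprB addrC -E.
  by apply: Rintegral_ge0.
apply: integrable_of_segments => //.
- by move=> x; have /andP[G0 _] := GP x; rewrite mulr_ge0 ?expR_ge0.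
move=> n; have n0 : 0 <= n%:R :> R by [].
have nseg : - n%:R <= (0 : R) <= n%:R by rewrite n0 oppr_le0 n0.
rewrite (Rintegral_split nseg); last by apply: continuous_between_integrable => x _; exact: Gec.
apply: (@le_trans _ _ (c^-1 * \int[mu]_(x in `[- n%:R, n%:R]) (g x * expR (- (c * `|x|))))); last first.
  rewrite ler_wpM2l ?invr_ge0 ?(ltW c0)//.
  rewrite (Rintegral_mkcond mu `[- n%:R, n%:R]); apply: le_Rintegral => //.
  - rewrite -restrict_EFin.
    have mI : measurable (`[- (n%:R), n%:R]%classic : set (measurableTypeR R)) by exact: measurable_itv.
    apply: ((integrable_mkcond _ mI).1 _).
    exact: (integrableS measurableT mI (@subsetT _ _) gi).
  - by move=> x _; rewrite /patch; case: ifP => // _; rewrite mulr_ge0 ?expR_ge0.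
rewrite (Rintegral_split nseg); last by apply: continuous_between_integrable => x _; exact: gec.
rewrite mulrDr; apply: lerD.
- rewrite (Rintegral_reflect n0 Gec) (Rintegral_reflect n0 gec).
  have H := weighted_primitive_half c0 n0 gNc (fun x => g0 (- x)) dPN.
  apply: (@le_trans _ _ (\int[mu]_(x in `[0, n%:R]) ((- P (- x) - - P (- 0)) * expR (- c * x)))).
    apply: mono.
    + by move=> x _; exact: GeNc.
    + by move=> x _; apply: cvgM; [apply: cvgB; [exact: PNc|exact: cvg_cst]|exact: ec'].
    + move=> x /andP[x0 _]; rewrite normrN (ger0_norm x0) mulNr ler_wpM2r ?expR_ge0//.
      have /andP[_ h] := GP (- x); apply: (le_trans h).
      by rewrite distrC ger0_norm ?subr_ge0 ?PNmono// oppr0 opprK addrC.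
  apply: (le_trans H); rewrite ler_wpM2l ?invr_ge0 ?(ltW c0)//.
  rewrite (@eq_Rintegral_segment _ _ _ _ (fun x => g (- x) * expR (- (c * `|- x|))))// => x /andP[x0 _].
  by rewrite normrN (ger0_norm x0) mulNr.
- have H := weighted_primitive_half c0 n0 gc g0 dP.
  apply: (@le_trans _ _ (\int[mu]_(x in `[0, n%:R]) ((P x - P 0) * expR (- c * x)))).
    apply: mono.
    + by move=> x _; exact: Gec.
    + by move=> x _; apply: cvgM; [apply: cvgB; [exact: Pc|exact: cvg_cst]|exact: ec'].
    + move=> x /andP[x0 _]; rewrite (ger0_norm x0) mulNr ler_wpM2r ?expR_ge0//.
      have /andP[_ h] := GP x; rewrite (le_trans h)// ger0_norm// subr_ge0.
      exact: Pmono.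
  apply: (le_trans H); rewrite ler_wpM2l ?invr_ge0 ?(ltW c0)//.
  rewrite le_eqVlt; apply/orP; left; apply/eqP; apply: eq_Rintegral_segment => x /andP[x0 _].
  by rewrite (ger0_norm x0) mulNr.
Qed.

Lemma weighted_primitive (phi psi : C -> C) (c : R) : 0 < c ->
  (forall x : R, cderiv phi x%:C (psi x%:C)) ->
  (forall x : R, {for x, continuous (fun x : R => psi x%:C)}) -> phi 0 = 0 ->
  mu.-integrable setT (EFin \o (fun x => normc (psi x%:C) * expR (- (c * `|x|)))) ->
  mu.-integrable setT (EFin \o (fun x => normc (phi x%:C) * expR (- (c * `|x|)))) /\
  \int[mu]_(x in setT) (normc (phi x%:C) * expR (- (c * `|x|))) <=
  2 * c^-1 * \int[mu]_(x in setT) (normc (psi x%:C) * expR (- (c * `|x|))).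
Proof.
move=> c0 dphi psic phi0 ipsi.
have mT : measurable (setT : set (measurableTypeR R)) by exact: measurableT.
(* The factor 2 is the one of [normc_cintegral_le]: with it the real primitive [P] of [g] dominates
   the increments of [phi]. *)
pose g (x : R) := 2 * normc (psi x%:C).
have nc x : {for x, continuous (fun x : R => normc (psi x%:C))}.
  exact: (continuous_normc (psic x)).
have gc x : {for x, continuous g} by apply: cvgM; [exact: cvg_cst|exact: nc].
have g0 x : 0 <= g x by rewrite mulr_ge0 ?normc_ge0.
have [P dP] := continuous_primitive gc.
have phic x : {for x, continuous (fun x : R => phi x%:C)}.
  exact: (ccont_comp (h := fun t : R => t%:C) (@continuous_real_complex _ x) (cderiv_cont (dphi x))).
have gi : mu.-integrable setT (EFin \o (fun x => g x * expR (- (c * `|x|)))).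
  have := integrableZl mT 2 ipsi; apply: (eq_integrable mT) => x _.
  by rewrite /= /g -mulrA EFinM.
have seg (a b : R) : a <= b -> normc (phi b%:C - phi a%:C) <= P b - P a.
  move=> ab; rewrite -(cintegral_FTC2 ab (fun x _ => dphi x) (fun x _ => psic x)).
  rewrite -(Rintegral_FTC2 ab (fun x _ => dP x) (fun x _ => gc x)).
  have mI : measurable (`[a, b]%classic : set (measurableTypeR R)) by exact: measurable_itv.
  have i1 := continuous_between_cintegrable (fun x (_ : a <= x <= b) => psic x).
  have i2 := continuous_between_integrable (fun x (_ : a <= x <= b) => nc x).
  rewrite /g (RintegralZl _ mI i2).
  by apply: (normc_cintegral_le mI i1 i2) => x _.
have GP x : 0 <= normc (phi x%:C) <= `|P x - P 0|.
  rewrite normc_ge0 /=; have [x0|x0] := leP 0 x.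
    by have := seg _ _ x0; rewrite phi0 subr0 => h; rewrite (le_trans h)// ler_norm.
  have := seg _ _ (ltW x0); rewrite phi0 sub0r normcN => h.
  by rewrite (le_trans h)// distrC ler_norm.
have [h1 h2] := weighted_primitive_real c0 gc g0 dP (fun x => continuous_normc (phic x)) GP gi.
split; first exact: h1.
apply: (le_trans h2); rewrite [2 * c^-1]mulrC -mulrA ler_wpM2l ?invr_ge0 ?(ltW c0)//.
rewrite -(RintegralZl _ mT ipsi) le_eqVlt; apply/orP; left; apply/eqP.
by apply: eq_Rintegral => x _; rewrite /g mulrA.
Qed.

End WeightedPrimitive.

(** * The kernel of the Bernoulli umbra *)

Section Kernel.
Variable R : realType.
Local Notation C := R[i].
Local Notation mu := (@lebesgue_measure R).
Implicit Types (w z : C) (u v t : R).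
Local Notation Re := (@complex.Re R).
Local Notation Im := (@complex.Im R).

Definition qexp w : C := cexp ((2 * pi)%:C * w).

(** This is [- pi / (2 * sinh (pi * w) ^+ 2)]. On the line [Im w = - 1/2] it becomes the probability
    density [pi / (2 * cosh (pi * u) ^+ 2)]. *)
Definition kap w : C := - (2 * pi)%:C * qexp w / (1 - qexp w) ^+ 2.

Let pi2 : 0 < 2 * pi :> R. Proof. by rewrite mulr_gt0// pi_gt0. Qed.

Lemma normc_qexp w : normc (qexp w) = expR (2 * pi * Re w).
Proof. by rewrite normc_cexp !cRI. Qed.

Lemma qexp_periodic w : qexp (w - 'i) = qexp w.
Proof.
rewrite /qexp mulrBr cexpD [_%:C * 'i]mulrC cexpN cexp_2pi invr1 mulr1//.
Qed.

Lemma kap_periodic w : kap (w - 'i) = kap w.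
Proof. by rewrite /kap qexp_periodic. Qed.

Lemma qexp_eq1 w : `|Im w| < 1 -> qexp w = 1 -> w = 0.
Proof.
move=> w1 /cexp_eq1 H; have : (2 * pi)%:C * w = 0.
  by apply: H; rewrite !cRI normrM (ger0_norm (ltW pi2)) gtr_pMr.
by move/eqP; rewrite mulf_eq0 real_complex_eq0 (gt_eqF pi2) /= => /eqP.
Qed.

Lemma qexp_neq1 w : `|Im w| < 1 -> w != 0 -> 1 - qexp w != 0.
Proof.
move=> w1 w0; rewrite subr_eq0 eq_sym; apply/eqP => /(qexp_eq1 w1) w00.
by rewrite w00 eqxx in w0.
Qed.

Lemma qexp_line_neq1 u v : -1 < v < 0 -> 1 - qexp (u%:C + 'i * v%:C) != 0.
Proof.
move=> /andP[v1 v0]; apply: qexp_neq1.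
  by rewrite Im_line ltr_norml v1 (lt_trans v0).
by apply/eqP => /(congr1 Im); rewrite Im_line /= => v00; rewrite v00 ltxx in v0.
Qed.

Lemma cderiv_qexp w : cderiv qexp w (qexp w * (2 * pi)%:C).
Proof. exact: cderiv_cexpZ. Qed.

Lemma cderiv_kap w : 1 - qexp w != 0 -> exists l, cderiv kap w l.
Proof.
move=> q1; eexists; apply: cderivM; first exact: (cderivZ _ (cderiv_qexp w)).
apply: (cderivV (f := fun w => (1 - qexp w) ^+ 2)); first by rewrite expf_neq0.
exact: (cderiv_sqr_comp (cderivB (cderiv_cst 1 w) (cderiv_qexp w))).
Qed.

Lemma expR_2pi_ge u : 0 <= u -> 1 + u <= expR (2 * pi * u).
Proof.
move=> u0; rewrite (le_trans (expR_ge1Dx u))// ler_expR ler_peMl//.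
have := pi_ge2 R; lra.
Qed.

(** For [|Re w| >= 1] the modulus of [qexp w] is at least 2 or at most [1 / 2], according to the
    sign of [Re w]. *)
Lemma one_sub_qexp_ge w : 1 <= `|Re w| ->
  Num.max 1 (normc (qexp w)) <= 2 * normc (1 - qexp w).
Proof.
move=> w1; have [u0|u0] := leP 0 (Re w).
- move: w1; rewrite ger0_norm// => u1.
  have h1 := expR_2pi_ge u0; have h2 := normc_sub (1 - qexp w) 1.
  move: h2; rewrite addrAC subrr add0r normcN normc1 normc_qexp => h2.
  by rewrite ge_max; apply/andP; split; move: h1 h2 u1; lra.
- move: w1; rewrite ltr0_norm// => u1.
  have u0' : 0 <= - Re w by rewrite oppr_ge0 ltW.
  have h1 := expR_2pi_ge u0'.
  have h2 := normcD (1 - qexp w) (qexp w); rewrite subrK normc1 normc_qexp in h2.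
  have h3 : expR (2 * pi * Re w) <= 1 / 2.
    rewrite -[Re w]opprK mulrN expRN mul1r lef_pV2 ?posrE ?expR_gt0//.
    by apply: le_trans h1; move: u1; lra.
  by rewrite normc_qexp ge_max; apply/andP; split; move: h2 h3; lra.
Qed.

(** By [one_sub_qexp_ge] the squared denominator is comparable with [max 1 (normc (qexp w)) ^+ 2],
    and the quotient is then of size [exp (- 2 pi |Re w|)] on either side. The bound is uniform in
    [Im w], as required for contours that sweep a strip. *)
Lemma kap_far w : 1 <= `|Re w| -> normc (kap w) <= 8 * pi * expR (- (2 * pi * `|Re w|)).
Proof.
move=> w1; have := one_sub_qexp_ge w1.
rewrite ge_max => /andP[h1 h2].
have n0 : 0 < normc (1 - qexp w) by move: h1; lra.
have p0 := @pi_gt0 R.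
rewrite /kap normcM normcV normcX normcM normcN normc_real ger0_norm ?(ltW pi2)//.
rewrite ler_pdivrMr ?exprn_gt0//.
set r := normc (qexp w) in h2 *; set N := normc (1 - qexp w) in h1 h2 n0 *.
set Y := expR (- (2 * pi * `|Re w|)).
have Y0 : 0 <= Y := expR_ge0 _.
suff H : r <= 4 * Y * N ^+ 2.
  have -> : 8 * pi * Y * N ^+ 2 = 2 * pi * (4 * Y * N ^+ 2) by ring.
  by rewrite ler_wpM2l// ltW.
have r0 : 0 <= r := normc_ge0 _.
have [u0|u0] := leP 0 (Re w).
- have rY : r * Y = 1.
    by rewrite /r /Y normc_qexp ger0_norm// -expRD subrr expR0.
  have -> : r = r ^+ 2 * Y by rewrite expr2 -mulrA rY mulr1.
  have -> : 4 * Y * N ^+ 2 = (2 * N) ^+ 2 * Y by ring.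
  by rewrite ler_wpM2r// ler_sqr ?nnegrE// mulr_ge0// ltW.
- have -> : r = Y by rewrite /r /Y normc_qexp ltr0_norm// mulrN opprK.
  have -> : 4 * Y * N ^+ 2 = (2 * N) ^+ 2 * Y by ring.
  by rewrite ler_peMl// exprn_ege1.
Qed.

Lemma kap_line_cont v : -1 < v < 0 -> forall u : R, {for u, continuous (fun u : R => kap (u%:C + 'i * v%:C))}.
Proof.
move=> v01 u; apply: continuous_hline.
by have [l] := cderiv_kap (qexp_line_neq1 u v01); exact: cderiv_cont.
Qed.

Lemma kap_line_bound v : -1 < v < 0 -> exists2 K : R, 0 < K &
  forall u, normc (kap (u%:C + 'i * v%:C)) <= K * expR (- (2 * pi * `|u|)).
Proof.
move=> v01.
have [M M0 MP] := @continuous_between_bounded R (-1) 1 _ (fun x _ => @kap_line_cont v v01 x).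
have p0 := @pi_gt0 R.
exists (Num.max (8 * pi) (M * expR (2 * pi))) => [|u].
  by rewrite lt_max mulr_gt0.
have [u1|u1] := leP 1 `|u|.
  apply: le_trans (kap_far _) _; first by rewrite Re_line.
  by rewrite Re_line ler_wpM2r ?expR_ge0// le_max lexx.
apply: (@le_trans _ _ (M * expR (2 * pi) * expR (- (2 * pi * `|u|)))).
  rewrite -mulrA -expRD -[leLHS]mulr1; apply: ler_pM => //.
  - exact: normc_ge0.
  - by apply: MP; rewrite -ler_norml ltW.
  - by rewrite -[X in X <= _]expR0 ler_expR subr_ge0 ler_piMr ?(ltW u1)// ltW.
by rewrite ler_wpM2r ?expR_ge0// le_max lexx orbT.
Qed.

Lemma kap_line_integrable v : -1 < v < 0 -> cintegrable setT (fun u : R => kap (u%:C + 'i * v%:C)).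
Proof.
move=> v01; have [K K0 KP] := kap_line_bound v01.
by apply: (cintegrable_exp_decay (kap_line_cont v01) pi2 (K := K)).
Qed.

(** The function [- 1 / (1 - qexp w)] is a primitive of the kernel; it tends to 0 at the right end
    of the line and to [-1] at the left end. *)
Lemma kap_integral v : -1 < v < 0 -> cintegral setT (fun u : R => kap (u%:C + 'i * v%:C)) = 1.
Proof.
move=> v01.
have L := cintegral_lim (kap_line_cont v01) (kap_line_integrable v01).
pose A w := - (1 - qexp w)^-1.
have dA u : cderiv A (u%:C + 'i * v%:C) (kap (u%:C + 'i * v%:C)).
  set w := _ + _; have q1 : 1 - qexp w != 0 := qexp_line_neq1 u v01.
  have H := cderivN (cderivV (f := fun w => 1 - qexp w) q1 (cderivB (cderiv_cst 1 w) (cderiv_qexp w))).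
  apply: (cderiv_eq H); rewrite /kap.
  by move: (qexp w) q1 ((2 * pi)%:C) => Q q1 P; field.
have dline u : cderiv (fun z => A (z + 'i * v%:C)) u%:C (kap (u%:C + 'i * v%:C)).
  have := cderiv_comp (cderivD (cderiv_id u%:C) (cderiv_cst ('i * v%:C) u%:C)) (dA u).
  by move/cderiv_eq; apply; rewrite addr0 mulr1.
have E (n : nat) : cintegral `[- (n%:R), n%:R] (fun u : R => kap (u%:C + 'i * v%:C)) =
   A ((n%:R)%:C + 'i * v%:C) - A ((- n%:R)%:C + 'i * v%:C).
  apply: (cintegral_FTC2 (H := fun z => A (z + 'i * v%:C)) (h := fun z => kap (z + 'i * v%:C))).
  - by rewrite (le_trans _ (ler0n R n))// oppr_le0.
  - by move=> u _; exact: dline.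
  - by move=> u _; exact: kap_line_cont.
have small (n : nat) : (0 < n)%N -> expR (- (2 * pi * n%:R)) <= n%:R^-1 :> R.
  move=> n0; rewrite expRN lef_pV2 ?posrE ?expR_gt0 ?ltr0n//.
  by have := expR_2pi_ge (ler0n R n); lra.
have key (n : nat) : (0 < n)%N -> normc (A ((n%:R)%:C + 'i * v%:C)) <= 2 * n%:R^-1 /\
    normc (A ((- n%:R)%:C + 'i * v%:C) + 1) <= 2 * n%:R^-1.
  move=> n0; have n1 : 1 <= n%:R :> R by rewrite ler1n.
  split.
  - set w := (n%:R)%:C + 'i * v%:C; have q1 : 1 - qexp w != 0 by exact: qexp_line_neq1.
    have w1 : 1 <= `|Re w| by rewrite Re_line normr_nat.
    have := one_sub_qexp_ge w1; rewrite ge_max normc_qexp Re_line => /andP[_ h].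
    rewrite /A normcN normcV; apply: le_trans (ler_wpM2l _ (small n n0)) => //.
    rewrite expRN ler_pdivlMr ?expR_gt0// mulrC ler_pdivrMr ?normc_gt0//.
  - set w := (- n%:R)%:C + 'i * v%:C; have q1 : 1 - qexp w != 0 by exact: qexp_line_neq1.
    have w1 : 1 <= `|Re w| by rewrite Re_line normrN normr_nat.
    have := one_sub_qexp_ge w1; rewrite ge_max => /andP[h _].
    have -> : A w + 1 = - (qexp w / (1 - qexp w)).
      by rewrite /A; move: (qexp w) q1 => Q q1; field.
    rewrite normcN normcM normcV; apply: le_trans (ler_wpM2l _ (small n n0)) => //.
    rewrite normc_qexp Re_line mulrN ler_pdivrMr ?normc_gt0// [leRHS]mulrAC.
    by rewrite ler_peMl ?expR_ge0.
have L2 : cintegral `[- (n%:R), n%:R] (fun u : R => kap (u%:C + 'i * v%:C)) @[n --> \oo] --> (1 : C).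
  apply/cvg_normc => e e0.
  exists (Num.bound (4 / e)).+1 => // n /= nN; rewrite E.
  have n0 : (0 < n)%N by rewrite (leq_trans _ nN).
  have nr : 0 < n%:R :> R by rewrite ltr0n.
  have [k1 k2] := key n n0.
  have ne : 4 * n%:R^-1 < e.
    rewrite ltr_pdivrMr// mulrC -ltr_pdivrMr//.
    apply: lt_le_trans (archi_boundP _) _; first by rewrite divr_ge0// ltW.
    by rewrite ler_nat ltnW.
  have -> : A ((n%:R)%:C + 'i * v%:C) - A ((- n%:R)%:C + 'i * v%:C) - 1 =
    A ((n%:R)%:C + 'i * v%:C) - (A ((- n%:R)%:C + 'i * v%:C) + 1) by ring.
  apply: le_lt_trans (normc_sub _ _) _; move: k1 k2 ne; lra.
exact: (ccvg_unique L L2).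
Qed.

(** [bernoulli_transform] at [sg = 'i * w]: the real part of [sg] is [t], and the multiplier [q] is
    [qexp w]. One factor [sqrt (2 * pi)] survives from [(2 * pi) / sqrt (2 * pi)]. *)
Lemma bernoulli_hatE u t : 0 < t < 1 ->
  bernoulli_hat (u -i* t) = (Num.sqrt (2 * pi))%:C * kap (u%:C + 'i * (- t)%:C).
Proof.
move=> t01; rewrite complexE'; set w := u%:C + 'i * (- t)%:C.
have sg01 : 0 < Re ('i * w) < 1 by rewrite /w !cRI.
have nt : -1 < - t < 0 by rewrite ltrN2 oppr_lt0 andbC.
have q1 : 1 - qexp w != 0 := qexp_line_neq1 u nt.
have := bernoulli_transform sg01.
have -> : cexp (- ('i * w) * ('i * (2 * pi)%:C)) = qexp w.
  rewrite /qexp; congr cexp.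
  have -> : - ('i * w) * ('i * (2 * pi)%:C) = - ('i * 'i) * ((2 * pi)%:C * w) by ring.
  by rewrite ii opprK mul1r.
rewrite /bernoulli_hat => H.
rewrite (@eq_cintegral _ _ _ (fun x : R => bernoulli_fun x%:C * cexp (- ('i * w) * x%:C))); last first.
  by move=> x _; rewrite mulNr.
set I0 := cintegral _ _ in H *.
have s0 : Num.sqrt (2 * pi) != 0 :> R by rewrite gt_eqF// sqrtr_gt0.
have s2 : (Num.sqrt (2 * pi))%:C * (Num.sqrt (2 * pi))%:C = (2 * pi)%:C :> C.
  by rewrite -real_complexM -expr2 sqr_sqrtr// ltW.
have -> : I0 = - (2 * pi)%:C ^+ 2 * qexp w / (1 - qexp w) ^+ 2.
  by rewrite -H mulfK// expf_neq0.
rewrite /kap real_complexV -s2.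
have s0C : (Num.sqrt (2 * pi))%:C != 0 :> C by rewrite real_complex_eq0.
by move: ((Num.sqrt (2 * pi))%:C) (qexp w) s0C q1 => S Q S0 q1; field; rewrite q1 S0.
Qed.

End Kernel.

(** * Integrals against the kernel along a horizontal line *)

Section LineTransform.
Variable R : realType.
Local Notation C := R[i].
Local Notation mu := (@lebesgue_measure R).
Implicit Types (w z y : C) (u v t : R).
Local Notation Re := (@complex.Re R).
Local Notation Im := (@complex.Im R).

(** The growth condition with compactness already exploited: one constant for each closed strip, and
    one exponent [s] for all of them. *)
Definition strip_bounded (f : C -> C) : Prop := exists s : R, forall a b : R, 0 < a ->
  exists2 M : R, 0 <= M & forall w, a <= Re w <= b -> normc (f w) <= M * expR (s * `|Im w|).

Definition line_integrable (f : C -> C) : Prop := forall z, 0 < Re z ->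
  mu.-integrable setT (EFin \o (fun u => normc (f (z + 'i * u%:C)) * expR (- (2 * pi * `|u|)))).

Definition line_transform (F : C -> C) y v : C :=
  cintegral setT (fun u : R => kap (u%:C + 'i * v%:C) * F ('i * (u%:C + 'i * v%:C) + y)).

Section Transform.
Variables (F f : C -> C).
Hypothesis dF : forall w, 0 < Re w -> cderiv F w (f w).
Hypothesis Fs : strip_bounded F.
Hypothesis Fl : line_integrable F.

Let mT : measurable (setT : set (measurableTypeR R)).
Proof. exact: measurableT. Qed.

(** The horizontal line [Im w = v] becomes the vertical line of abscissa [Re y - v] in the argument
    of [F]; the hypotheses on vertical lines are applied there. *)
Lemma rotated_line u v y : 'i * (u%:C + 'i * v%:C) + y = (y - v%:C) + 'i * u%:C.
Proof.
have -> : 'i * (u%:C + 'i * v%:C) + y = 'i * u%:C + ('i * 'i) * v%:C + y by ring.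
rewrite ii; ring.
Qed.

Lemma Re_rotated w y : Re ('i * w + y) = Re y - Im w.
Proof. rewrite !cRI; ring. Qed.

Lemma Im_rotated w y : Im ('i * w + y) = Re w + Im y.
Proof. rewrite !cRI; ring. Qed.

Lemma cderiv_rotated y w : cderiv (fun z => 'i * z + y) w 'i.
Proof.
by apply: (cderiv_ext _ (cderiv_affine y 'i w)) => z; rewrite addrC.
Qed.

Lemma cderiv_F_rotated y w : Im w < Re y ->
  cderiv (fun z => F ('i * z + y)) w (f ('i * w + y) * 'i).
Proof.
move=> wy; apply: (cderiv_comp (g := F) (cderiv_rotated y w)).
by apply: dF; rewrite Re_rotated subr_gt0.
Qed.

Lemma F_line_cont y v : v < Re y ->
  forall u : R, {for u, continuous (fun u : R => F ('i * (u%:C + 'i * v%:C) + y))}.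
Proof.
move=> vy u; apply: (@continuous_hline R (fun w => F ('i * w + y)) v u).
by apply: cderiv_cont (cderiv_F_rotated _); rewrite Im_line.
Qed.

Lemma transform_integrable (g : R -> C) v : -1 < v < 0 ->
  (forall u : R, {for u, continuous g}) ->
  mu.-integrable setT (EFin \o (fun u => normc (g u) * expR (- (2 * pi * `|u|)))) ->
  cintegrable setT (fun u : R => kap (u%:C + 'i * v%:C) * g u).
Proof.
move=> v01 gc gi; have [K K0 KP] := kap_line_bound v01.
have hi : mu.-integrable setT (EFin \o (fun u => K * (normc (g u) * expR (- (2 * pi * `|u|))))).
  by have := integrableZl mT K gi; apply: (eq_integrable mT) => x _; rewrite /= EFinM.
apply: (cintegrable_le mT _ hi) => [u|u _].
  by apply: ccontM; [exact: kap_line_cont | exact: gc].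
by rewrite normcM mulrCA mulrC ler_wpM2l ?normc_ge0// mulrC; exact: KP.
Qed.

Lemma transform_bound v : -1 < v < 0 -> exists2 K : R, 0 <= K & forall g : R -> C,
  (forall u : R, {for u, continuous g}) ->
  mu.-integrable setT (EFin \o (fun u => normc (g u) * expR (- (2 * pi * `|u|)))) ->
  normc (cintegral setT (fun u : R => kap (u%:C + 'i * v%:C) * g u)) <=
  K * \int[mu]_(u in setT) (normc (g u) * expR (- (2 * pi * `|u|))).
Proof.
move=> v01; have [K K0 KP] := kap_line_bound v01.
exists (2 * K) => [|h hc hi]; first by rewrite mulr_ge0// ltW.
have hi' : mu.-integrable setT (EFin \o (fun u => K * (normc (h u) * expR (- (2 * pi * `|u|))))).
  by have := integrableZl mT K hi; apply: (eq_integrable mT) => x _; rewrite /= EFinM.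
rewrite -mulrA -(RintegralZl _ mT hi).
apply: (normc_cintegral_le mT (transform_integrable v01 hc hi) hi') => u _.
by rewrite normcM mulrCA mulrC ler_wpM2l ?normc_ge0// mulrC; exact: KP.
Qed.

Lemma F_line_integrable y v : v < Re y ->
  mu.-integrable setT (EFin \o (fun u : R => normc (F ('i * (u%:C + 'i * v%:C) + y)) * expR (- (2 * pi * `|u|)))).
Proof.
move=> vy; have T0 : 0 < Re (y - v%:C) by rewrite !cRI subr_gt0.
have := Fl T0; apply: (eq_integrable mT) => u _ /=.
by rewrite rotated_line.
Qed.

Lemma line_transform_integrable y v : -1 < v < 0 -> v < Re y ->
  cintegrable setT (fun u : R => kap (u%:C + 'i * v%:C) * F ('i * (u%:C + 'i * v%:C) + y)).
Proof.
move=> v01 vy; apply: (transform_integrable v01 (F_line_cont vy)).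
exact: F_line_integrable.
Qed.

Lemma F_strip_bound y (a b : R) : b < Re y -> exists s M : R, [/\ 0 <= M, 1 <= s &
  forall u v : R, a <= v <= b -> normc (F ('i * (u%:C + 'i * v%:C) + y)) <= M * expR (s * `|u|)].
Proof.
move=> by0; have [s Hs] := Fs.
have yb : 0 < Re y - b by rewrite subr_gt0.
have [M M0 MP] := Hs _ (Re y - a) yb.
(* With [1 <= s'] the exponential also dominates terms that are linear in [|u|]. *)
pose s' := Num.max 1 s.
exists s', (M * expR (s' * `|Im y|)); split.
- by rewrite mulr_ge0 ?expR_ge0.
- by rewrite le_max lexx.
move=> u v /andP[v1 v2]; apply: le_trans (MP _ _) _.
  by rewrite Re_rotated Im_line; apply/andP; split; lra.
rewrite -mulrA ler_wpM2l// -expRD ler_expR Im_rotated Re_line.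
have ss : s <= s' by rewrite le_max lexx orbT.
have s0 : 0 <= s' by rewrite le_max ler01.
apply: (@le_trans _ _ (s' * `|u + Im y|)); first by rewrite ler_wpM2r.
by rewrite -mulrDr ler_wpM2l// addrC ler_normD.
Qed.

(** The poles of [kap] at [0] and [- 'i] lie outside the strip between the lines. Any exponential
    growth of [F] is tolerated by [contour_shift], which asks for integrability on the two extreme
    lines only. *)
Lemma line_transform_indep y v v' : -1 < v -> v <= v' -> v' < 0 -> v' < Re y ->
  line_transform F y v = line_transform F y v'.
Proof.
move=> h1 h2 h3 h4.
have [s [M [M0 s1 MP]]] := @F_strip_bound y v v' h4.
have vin x : v <= x <= v' -> -1 < x < 0 by move=> ?; apply/andP; split; lra.
apply: (contour_shift (H := fun w => kap w * F ('i * w + y)) (K := 8 * pi * M) (s := s) h2).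
- move=> u x xv; have [l dl] := cderiv_kap (qexp_line_neq1 u (vin x xv)).
  apply: cderiv_derivable; apply: (cderivM dl (cderiv_F_rotated (y := y) _)).
  by rewrite Im_line; move/andP: xv => [_ xv]; apply: le_lt_trans h4.
- move=> u x u1 xv; rewrite normcM -mulrA; apply: ler_pM; rewrite ?normc_ge0//; last exact: MP.
  apply: le_trans (kap_far _) _; rewrite Re_line//.
  rewrite ler_piMr ?mulr_ge0 ?pi_ge0// -[X in _ <= X]expR0 ler_expR oppr_le0.
  by rewrite !mulr_ge0// pi_ge0.
- by apply: line_transform_integrable; [apply: vin; rewrite lexx | apply: le_lt_trans h4].
- by apply: line_transform_integrable; [apply: vin; rewrite lexx andbT | exact: h4].
Qed.

End Transform.
End LineTransform.

(** * The weighted class and the difference equation *)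

Section Weighted.
Variable R : realType.
Local Notation C := R[i].
Local Notation mu := (@lebesgue_measure R).
Implicit Types (w z y : C) (u v t : R).
Local Notation Re := (@complex.Re R).
Local Notation Im := (@complex.Im R).

Definition weighted (g : R -> C) : Prop :=
  (forall u : R, {for u, continuous g}) /\
  mu.-integrable setT (EFin \o (fun u => normc (g u) * expR (- (2 * pi * `|u|)))).

Let mT : measurable (setT : set (measurableTypeR R)).
Proof. exact: measurableT. Qed.

Let pi2 : 0 < 2 * pi :> R. Proof. by rewrite mulr_gt0// pi_gt0. Qed.

Lemma weighted_continuous (g : R -> C) u : {for u, continuous g} ->
  {for u, continuous (fun u : R => normc (g u) * expR (- (2 * pi * `|u|)))}.
Proof.
move=> gc; apply: cvgM; first exact: (continuous_normc gc).
exact: (@continuous_expRN_abs R (2 * pi) u).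
Qed.

Lemma weighted_le (g : R -> C) (h : R -> R) : (forall u : R, {for u, continuous g}) ->
  mu.-integrable setT (EFin \o h) ->
  (forall u, normc (g u) * expR (- (2 * pi * `|u|)) <= h u) -> weighted g.
Proof.
move=> gc hi gh; split; first exact: gc.
apply: (le_integrable mT _ _ hi).
- apply/measurable_EFinP; apply: continuous_measurable => u; exact: weighted_continuous.
- move=> u _ /=; rewrite lee_fin ger0_norm ?mulr_ge0 ?normc_ge0 ?expR_ge0//.
  by rewrite (le_trans (gh u))// ler_norm.
Qed.

Lemma weightedD (g h : R -> C) : weighted g -> weighted h -> weighted (fun u => g u + h u).
Proof.
move=> [gc gi] [hc hi].
apply: (weighted_le _ (integrableD mT gi hi)) => [u|u].
  by apply: ccontD; [exact: gc|exact: hc].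
by rewrite /= -mulrDl ler_wpM2r ?expR_ge0// normcD.
Qed.

Lemma weightedZ (a : C) (g : R -> C) : weighted g -> weighted (fun u => a * g u).
Proof.
move=> [gc gi].
apply: (weighted_le (h := fun u => normc a * (normc (g u) * expR (- (2 * pi * `|u|))))) => [u||u].
- by apply: ccontM; [exact: ccont_cst|exact: gc].
- have := integrableZl mT (normc a) gi; apply: (eq_integrable mT) => u _.
  by rewrite /= EFinM.
- by rewrite normcM mulrA.
Qed.

Lemma weighted_ext (g h : R -> C) : (forall u, g u = h u) -> weighted g -> weighted h.
Proof. by move=> /funext ->. Qed.

Lemma weightedB (g h : R -> C) : weighted g -> weighted h -> weighted (fun u => g u - h u).
Proof.
move=> gw /(weightedZ (-1)) hw; apply: (weighted_ext _ (weightedD gw hw)) => u.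
by rewrite mulN1r.
Qed.

Lemma weighted1 : weighted (fun=> 1).
Proof.
apply: (weighted_le _ (integrable_expRN_abs pi2)) => [u|u]; first exact: ccont_cst.
by rewrite normc1 mul1r.
Qed.

Lemma weighted_cst (a : C) : weighted (fun=> a).
Proof. by apply: (weighted_ext _ (weightedZ a weighted1)) => u; rewrite mulr1. Qed.

Lemma weighted_primitive_spec (phi psi : C -> C) :
  (forall x : R, cderiv phi x%:C (psi x%:C)) -> phi 0 = 0 -> weighted (fun x : R => psi x%:C) ->
  weighted (fun x : R => phi x%:C) /\
  \int[mu]_(x in setT) (normc (phi x%:C) * expR (- (2 * pi * `|x|))) <=
  2 * (2 * pi)^-1 * \int[mu]_(x in setT) (normc (psi x%:C) * expR (- (2 * pi * `|x|))).
Proof.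
move=> dphi phi0 [pc pi]; have [h1 h2] := weighted_primitive pi2 dphi pc phi0 pi.
split; [split; last exact: h1|exact: h2].
move=> u; exact: (ccont_comp (h := fun t : R => t%:C) (@continuous_real_complex _ u) (cderiv_cont (dphi u))).
Qed.

(** Induction by the Hardy inequality, as [z ^+ j.+1] is the primitive of [j.+1 * z ^+ j] vanishing
    at 0. *)
Lemma weighted_pow (j : nat) : weighted (fun u => u%:C ^+ j).
Proof.
elim: j => [|j IH].
  by apply: (weighted_ext _ weighted1) => u; rewrite expr0.
have [] // := @weighted_primitive_spec (fun z => z ^+ j.+1) (fun z => j.+1%:R * z ^+ j).
- move=> x; have := cderivX j (cderiv_id x%:C).
  by move/cderiv_eq; apply; rewrite mulr1.
- by rewrite expr0n.
- exact: weightedZ.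
Qed.

Lemma weighted_sum (n : nat) (g : nat -> R -> C) : (forall i, weighted (g i)) ->
  weighted (fun u => \sum_(i < n) g i u).
Proof.
move=> gw; elim: n => [|n IH].
  by apply: (weighted_ext _ (weighted_cst 0)) => u; rewrite big_ord0.
by apply: (weighted_ext _ (weightedD IH (gw n))) => u; rewrite big_ord_recr.
Qed.

Section Shift.
Variables (F f : C -> C).
Hypothesis dF : forall w, 0 < Re w -> cderiv F w (f w).
Hypothesis Fs : strip_bounded F.
Hypothesis Fl : line_integrable F.

(** Two applications of [analytic_factor]: a double pole needs the Taylor remainder of order two. *)
Lemma double_factor c : 0 < Re c -> exists g : C -> C, (forall w, 0 < Re w -> exists l, cderiv g w l) /\
  forall w, 0 < Re w -> F w = F c + f c * (w - c) + (w - c) ^+ 2 * g w.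
Proof.
move=> c0; pose U := @right_half_plane R.
have Uo := @open_halfplane R; have Us := star_halfplane c0.
have Fa : analytic_on U F by move=> w /dF/cderiv_derivable.
have [g [ga gc gE]] := analytic_factor Uo Fa Us.
have [h [ha _ hE]] := analytic_factor Uo ga Us.
exists h; split => [w w0|w w0].
  by exists ('D_1 h w); apply: derivable_cderiv; exact: ha.
rewrite (gE w w0) (hE w w0) gc (cderiv_derive1 (dF c0)); ring.
Qed.

Lemma weighted_F_line y v : v < Re y ->
  weighted (fun u : R => F ('i * (u%:C + 'i * v%:C) + y)).
Proof. by move=> vy; split; [exact: (F_line_cont dF vy) | exact: F_line_integrable]. Qed.

Lemma weighted_affine (a b : C) v : weighted (fun u : R => a + b * ('i * (u%:C + 'i * v%:C) - 1)).
Proof.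
have H := weightedD (weighted_cst (a - b - b * v%:C)) (weightedZ (b * 'i) (weighted_pow 1)).
apply: (weighted_ext _ H) => u; rewrite expr1.
have -> : 'i * (u%:C + 'i * v%:C) = 'i * u%:C + ('i * 'i) * v%:C by ring.
rewrite ii; ring.
Qed.

Lemma cderiv_2pi_shift w : cderiv (fun z => (2 * pi)%:C * (z + 'i)) w (2 * pi)%:C.
Proof.
have := cderivZ (2 * pi)%:C (cderivD (cderiv_id w) (cderiv_cst 'i w)).
by move/cderiv_eq; apply; rewrite addr0 mulr1.
Qed.

Lemma kap_periodicD u v : kap (u%:C + 'i * (v - 1)%:C) = kap (u%:C + 'i * v%:C) :> C.
Proof.
rewrite -[RHS]kap_periodic; congr kap; rewrite real_complexD real_complexN; ring.
Qed.

Lemma rotated_shift u v : 'i * (u%:C + 'i * (v - 1)%:C) = 'i * (u%:C + 'i * v%:C) + 1 :> C.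
Proof.
have -> : 'i * (u%:C + 'i * (v - 1)%:C) = 'i * u%:C + ('i * 'i) * (v - 1)%:C by ring.
have -> : 'i * (u%:C + 'i * v%:C) = 'i * u%:C + ('i * 'i) * v%:C by ring.
rewrite ii real_complexD real_complexN; ring.
Qed.

Lemma kap_mul_integrable (g : R -> C) v : -1 < v < 0 -> weighted g ->
  cintegrable setT (fun u : R => kap (u%:C + 'i * v%:C) * g u).
Proof. by move=> v01 [gc gi]; exact: transform_integrable. Qed.

(* The double pole of kap at -'i is removed by subtracting the first Taylor polynomial of F. *)
Lemma line_transform_shift y v : -1 < Re y -> -1 < v < 0 -> v < Re y ->
  line_transform F (y + 1) v = line_transform F y v + f (y + 1).
Proof.
move=> y1 v01 vy; set c := y + 1.
have c0 : 0 < Re c by rewrite /c !cRI; lra.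
have [g2 [dg2 gE]] := double_factor c0.
(* The Taylor polynomial of [F] at [c = y + 1], in the variable ['i * w + y]: indeed ['i * w + y - c
   = 'i * w - 1 = 'i * (w + 'i)] vanishes at the pole. *)
pose Lw w := F c + f c * ('i * w - 1).
pose X w := (2 * pi)%:C * (w + 'i).
(* A form of [kap w * (F ('i * w + y) - Lw w)] that also makes sense at [w = - 'i]. The square of
   the Bernoulli function at [X w = 2 pi (w + 'i)] absorbs [(w + 'i) ^+ 2 / (1 - qexp w) ^+ 2], and
   [bernoulli_fun] is differentiable for [|Im (X w)| < 2 pi], which covers the whole strip. *)
pose H w := g2 ('i * w + y) * (bernoulli_fun (X w)) ^+ 2 / ((2 * pi)%:C * qexp w).
case/andP: (v01) => v1 v0.
have v1v : v - 1 <= v by lra.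
have pC : (2 * pi)%:C != 0 :> C by rewrite real_complex_eq0 gt_eqF.
have q0 w : qexp w != 0 by exact: cexp_neq0.
have HE w : v - 1 <= Im w <= v -> w + 'i != 0 ->
    H w = kap w * (F ('i * w + y) - Lw w).
  move=> /andP[w1 w2] wi.
  have z0 : 0 < Re ('i * w + y) by rewrite Re_rotated; lra.
  rewrite (gE _ z0) /Lw.
  have zc : 'i * w + y - c = 'i * w - 1 by rewrite /c; ring.
  rewrite zc.
  have -> : F c + f c * ('i * w - 1) + ('i * w - 1) ^+ 2 * g2 ('i * w + y) - (F c + f c * ('i * w - 1)) =
    ('i * w - 1) ^+ 2 * g2 ('i * w + y) by ring.
  have -> : ('i * w - 1) ^+ 2 = - (w + 'i) ^+ 2.
    have -> : 'i * w - 1 = 'i * (w + 'i) by rewrite mulrDr ii.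
    by rewrite exprMn expr2 ii mulN1r.
  have X0 : X w != 0 by rewrite mulf_neq0.
  have qX : cexp (X w) = qexp w.
    by rewrite /X -/(qexp (w + 'i)) -qexp_periodic addrK.
  rewrite /H /bernoulli_fun (negbTE X0) qX /kap /X.
  have wI : `|Im (w + 'i)| < 1 by rewrite !cRI ltr_norml; apply/andP; split; lra.
  have q1 : 1 - qexp w != 0.
    rewrite -(addrK 'i w) qexp_periodic; exact: (qexp_neq1 wI wi).
  have q1' : qexp w - 1 != 0 by rewrite -opprB oppr_eq0.
  move: (qexp w) (q0 w) q1 q1' ((2 * pi)%:C) pC (g2 _) => Q Q0 Q1 Q1' P P0 G.
  by field; rewrite P0 Q0 Q1 Q1'.
have dH u x : v - 1 <= x <= v -> derivable H (u%:C + 'i * x%:C) 1.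
  move=> /andP[x1 x2]; set w := u%:C + 'i * x%:C.
  have z0 : 0 < Re ('i * w + y) by rewrite Re_rotated Im_line; lra.
  have [l dl] := dg2 _ z0.
  have XI : `|Im (X w)| < 2 * pi.
    rewrite /X cImM Re_real Im_real mul0r addr0 normrM ger0_norm ?(ltW pi2)//.
    rewrite gtr_pMr// cImD Im_line Im_i ltr_norml; apply/andP; split; lra.
  have [m dm] := cderiv_bernoulli XI.
  have d1 := cderiv_comp (g := g2) (cderiv_rotated y w) dl.
  have d2 := cderiv_sqr_comp (cderiv_comp (g := @bernoulli_fun R) (cderiv_2pi_shift w) dm).
  have d3 := cderivV (f := fun w => (2 * pi)%:C * qexp w) (mulf_neq0 pC (q0 w))
    (cderivZ (2 * pi)%:C (cderiv_qexp w)).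
  exact: (cderiv_derivable (cderivM (cderivM d1 d2) d3)).
have lineE (x : R) : x != -1 -> v - 1 <= x <= v -> forall u : R,
    H (u%:C + 'i * x%:C) = kap (u%:C + 'i * x%:C) * F ('i * (u%:C + 'i * x%:C) + y) -
      kap (u%:C + 'i * x%:C) * Lw (u%:C + 'i * x%:C).
  move=> xn xv u; rewrite -mulrBr; apply: HE; rewrite ?Im_line//.
  apply/eqP => /(congr1 Im); rewrite cImD Im_line Im_i /= => /eqP.
  by rewrite addr_eq0 (negbTE xn).
have iF : cintegrable setT (fun u : R => kap (u%:C + 'i * v%:C) * F ('i * (u%:C + 'i * v%:C) + y)).
  by apply: (kap_mul_integrable v01); exact: weighted_F_line.
have vc : v < Re c by rewrite /c !cRI; lra.
have iFc : cintegrable setT (fun u : R => kap (u%:C + 'i * v%:C) * F ('i * (u%:C + 'i * v%:C) + c)).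
  by apply: (kap_mul_integrable v01); exact: weighted_F_line.
have iL : cintegrable setT (fun u : R => kap (u%:C + 'i * v%:C) * Lw (u%:C + 'i * v%:C)).
  by apply: (kap_mul_integrable v01); exact: weighted_affine.
have ik := kap_line_integrable v01.
have ifk : cintegrable setT (fun u : R => f c * kap (u%:C + 'i * v%:C)) by exact: cintegrableZ.
have vv : v - 1 <= v <= v by rewrite v1v lexx.
have vv' : v - 1 <= v - 1 <= v by rewrite v1v lexx.
have vn : v != -1 by rewrite gt_eqF.
have vn' : v - 1 != -1 by rewrite lt_eqF//; lra.
have Hb u : H (u%:C + 'i * v%:C) = kap (u%:C + 'i * v%:C) * F ('i * (u%:C + 'i * v%:C) + y) -
      kap (u%:C + 'i * v%:C) * Lw (u%:C + 'i * v%:C) := lineE v vn vv u.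
(* One period below, [kap] is unchanged, the argument of [F] grows by 1 and [Lw] grows by [f c].
   This [f c], integrated against a kernel of mass 1, is the term [f (y + 1)] of the conclusion. *)
have Ha u : H (u%:C + 'i * (v - 1)%:C) = kap (u%:C + 'i * v%:C) * F ('i * (u%:C + 'i * v%:C) + c) -
      (kap (u%:C + 'i * v%:C) * Lw (u%:C + 'i * v%:C) + f c * kap (u%:C + 'i * v%:C)).
  rewrite (lineE _ vn' vv' u) kap_periodicD /Lw rotated_shift.
  have -> : 'i * (u%:C + 'i * v%:C) + 1 + y = 'i * (u%:C + 'i * v%:C) + c by rewrite /c; ring.
  ring.
have iLf := cintegrableD mT iL ifk.
have iHa : cintegrable setT (fun u : R => H (u%:C + 'i * (v - 1)%:C)).
  by apply: (eq_cintegrable mT _ (cintegrableB mT iFc iLf)) => u _; rewrite Ha.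
have iHb : cintegrable setT (fun u : R => H (u%:C + 'i * v%:C)).
  by apply: (eq_cintegrable mT _ (cintegrableB mT iF iL)) => u _; rewrite Hb.
have [s [M [M0 s1 MP]]] := @F_strip_bound R F Fs y (v - 1) v vy.
(* [8 * pi] bounds the kernel for [|u| >= 1], [M] bounds [F], and the other terms bound [Lw]: on the
   strip [|x| <= 2], hence [normc ('i * w - 1) <= |u| + 3 <= 3 * expR (s * |u|)]. *)
pose K := 8 * pi * (M + normc (F c) + 3 * normc (f c)).
have E : cintegral setT (fun u : R => H (u%:C + 'i * (v - 1)%:C)) = cintegral setT (fun u : R => H (u%:C + 'i * v%:C)).
  apply: (contour_shift (K := K) (s := s) v1v) => // u x u1 xv.
  have wi : u%:C + 'i * x%:C + 'i != 0.
    apply/eqP => /(congr1 Re); rewrite cReD Re_line Re_i addr0 /= => u0.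
    by move: u1; rewrite u0 normr0 ler10.
  rewrite HE ?Im_line// normcM /K -mulrA; apply: ler_pM; rewrite ?normc_ge0//.
    apply: le_trans (kap_far _) _; rewrite Re_line//.
    rewrite ler_piMr ?mulr_ge0 ?pi_ge0// -[X in _ <= X]expR0 ler_expR oppr_le0.
    by rewrite !mulr_ge0// pi_ge0.
  apply: le_trans (normc_sub _ _) _; rewrite !mulrDl -addrA; apply: lerD; first exact: MP.
  have us : `|u| <= s * `|u| by rewrite ler_peMl.
  have e1 : 1 <= expR (s * `|u|).
    by rewrite -[X in X <= _]expR0 ler_expR (le_trans _ us).
  have e2 : `|u| <= expR (s * `|u|).
    by apply: (le_trans us); rewrite (le_trans _ (expR_ge1Dx _))// lerDr.
  rewrite /Lw; apply: le_trans (normcD _ _) _; apply: lerD.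
    by rewrite ler_peMr// normc_ge0.
  have e3 : normc ('i * (u%:C + 'i * x%:C) - 1) <= 3 * expR (s * `|u|).
    apply: le_trans (normc_sub _ _) _; rewrite normcM normci mul1r normc1.
    have := normc_le_ReIm (u%:C + 'i * x%:C); rewrite Re_line Im_line.
    have xb : `|x| <= 2 by rewrite ler_norml; apply/andP; split; move/andP: xv => [? ?]; lra.
    have := expR_ge1Dx (s * `|u|); lra.
  rewrite normcM; apply: le_trans (ler_wpM2l (normc_ge0 (f c)) e3) _.
  rewrite le_eqVlt; apply/orP; left; apply/eqP; ring.
have t1 : cintegral setT (fun u : R => H (u%:C + 'i * (v - 1)%:C)) =
    line_transform F c v - (cintegral setT (fun u : R => kap (u%:C + 'i * v%:C) * Lw (u%:C + 'i * v%:C)) + f c).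
  rewrite (eq_cintegral (fun u _ => Ha u)) (cintegralB mT iFc iLf) (cintegralD mT iL ifk).
  by rewrite (cintegralZ _ mT ik) (kap_integral v01) mulr1.
have t2 : cintegral setT (fun u : R => H (u%:C + 'i * v%:C)) =
    line_transform F y v - cintegral setT (fun u : R => kap (u%:C + 'i * v%:C) * Lw (u%:C + 'i * v%:C)).
  by rewrite (eq_cintegral (fun u _ => Hb u)) (cintegralB mT iF iL).
move: E; rewrite t1 t2; set Y := cintegral _ _ => E.
have alg (a1 a2 a3 a4 : C) : a1 - (a2 + a3) = a4 - a2 -> a1 = a4 + a3.
  by move/(canRL (subrK _)) ->; ring.
exact: (alg _ _ _ _ E).
Qed.

End Shift.
End Weighted.

(** * Consequences of the Taylor remainder hypotheses *)

Section TClass.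
Variable R : realType.
Local Notation C := R[i].
Local Notation mu := (@lebesgue_measure R).
Implicit Types (w z y : C) (u v t : R) (f F : C -> C).
Local Notation Re := (@complex.Re R).
Local Notation Im := (@complex.Im R).

Let mT : measurable (setT : set (measurableTypeR R)).
Proof. exact: measurableT. Qed.

Lemma exponentially_bounded_strip f : exponentially_bounded f -> strip_bounded f.
Proof.
move=> [s [B [B0 Bloc Bf]]]; exists s => a b a0.
have [t /andP[ta tb]|d d0 dP] := @segment_uniform R a b (fun e t => `|B t| <= e^-1).
  have t0 : 0 < t by rewrite (lt_le_trans a0).
  have /pinfty_ex_gt0[M M0 MP] := Bloc t t0.
  have [d /= d0 dP] := (nbhs_ballP (t : R) _).1 MP.
  exists (Num.min (Num.min d t) M^-1) => [|e x]; first by rewrite !lt_min d0 t0 invr_gt0.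
  rewrite !lt_min => /and3P[e0 _ eM] /andP[/andP[xd xt] _].
  apply: (@le_trans _ _ M).
    apply: dP; first by rewrite /ball /= distrC.
    by move: xt; rewrite /= ltr_norml; lra.
  by rewrite -[leLHS]invrK lef_pV2 ?posrE ?invr_gt0// ltW.
exists ((d / 2)^-1) => [|w wab]; first by rewrite invr_ge0 divr_ge0// ltW.
have w0 : 0 < Re w by move/andP: wab => [h _]; rewrite (lt_le_trans a0).
apply: le_trans (Bf w w0) _; rewrite ler_wpM2r ?expR_ge0//.
apply: le_trans (ler_norm _) _; apply: dP => //.
by rewrite divr_gt0//= ltr_pdivrMr// mulr2n mulrDr mulr1 ltrDl.
Qed.

(** The bound at abscissa [x] is the supremum of [normc (f w) * expR (- (s * |Im w|))] over the
    vertical line; it is locally bounded because the strip constants serve all abscissas of an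
    interval at once. *)
Lemma strip_exponentially_bounded f : strip_bounded f -> exponentially_bounded f.
Proof.
move=> [s Hs].
pose E (x : R) := [set r : R | exists2 w, Re w = x & r = normc (f w) * expR (- (s * `|Im w|))].
have EM (a b : R) : 0 < a -> exists2 M : R, 0 <= M & forall x, a <= x <= b -> ubound (E x) M.
  move=> a0; have [M M0 MP] := Hs a b a0; exists M => // x xab r [w wx ->].
  by rewrite expRN ler_pdivrMr ?expR_gt0//; apply: MP; rewrite wx.
have En x : E x !=set0.
  by exists (normc (f x%:C) * expR (- (s * `|Im x%:C|))), x%:C.
have Ele x w : 0 < x -> Re w = x -> normc (f w) * expR (- (s * `|Im w|)) <= sup (E x).
  move=> x0 wx; apply: ub_le_sup; last by exists w.
  have [M M0 MP] := EM x x x0; exists M; apply: MP; rewrite lexx//.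
have E0 x : 0 < x -> 0 <= sup (E x).
  by move=> x0; apply: le_trans (Ele x x%:C x0 _); rewrite ?mulr_ge0 ?normc_ge0 ?expR_ge0.
exists s, (fun x => sup (E x)); split.
- by move=> x /E0.
- move=> x /= x0; have [M M0 MP] := EM (x / 2) (2 * x) (divr_gt0 x0 ltr02).
  exists M; split; first exact: num_real.
  move=> M' MM'; apply/(nbhs_ballP (x : R)); exists (x / 2) => /=; first by rewrite divr_gt0.
  move=> y; rewrite /ball /= => yx y0; apply: le_trans (ltW MM').
  rewrite ger0_norm ?E0//; apply: ge_sup => //; apply: MP.
  by move: yx; rewrite ltr_norml; lra.
- move=> z z0; rewrite -ler_pdivrMr ?expR_gt0// -expRN.
  exact: Ele.
Qed.

Lemma strip_bounded_primitive f : analytic_on (@right_half_plane R) f ->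
  strip_bounded f -> strip_bounded (segment_integral f 1).
Proof.
move=> fa [s Hs]; exists (Num.max s 0 + 1) => a b a0.
have a'0 : 0 < Num.min a 1 by rewrite lt_min a0 ltr01.
have [M M0 MP] := Hs _ (Num.max b 1) a'0.
exists (2 * M * (`|b| + 2)) => [|w /andP[wa wb]]; first by rewrite !mulr_ge0// addr_ge0.
set s' := Num.max s 0.
have s'0 : 0 <= s' by rewrite le_max lexx orbT.
have w0 : 0 < Re w by rewrite (lt_le_trans a0).
have seg t : 0 <= t <= 1 -> Num.min a 1 <= Re (1 + t%:C * (w - 1)) <= Num.max b 1 /\
    `|Im (1 + t%:C * (w - 1))| <= `|Im w|.
  move=> /andP[t0 t1]; rewrite !cRI; split.
    have -> : 1 + t * (Re w - 1) = (1 - t) + t * Re w by ring.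
    have m1 : Num.min a 1 <= 1 by rewrite ge_min lexx orbT.
    have m2 : Num.min a 1 <= Re w by rewrite ge_min wa.
    have m3 : 1 <= Num.max b 1 by rewrite le_max lexx orbT.
    have m4 : Re w <= Num.max b 1 by rewrite le_max wb.
    have t1' : 0 <= 1 - t by rewrite subr_ge0.
    have k1 := ler_wpM2l t1' m1; have k2 := ler_wpM2l t0 m2.
    have k3 := ler_wpM2l t1' m3; have k4 := ler_wpM2l t0 m4.
    by apply/andP; split; lra.
  by rewrite normrM ger0_norm// ler_piMl.
have gc : continuous_between 0 1 (fun t => f (1 + t%:C * (w - 1))).
  move=> t t01; apply: continuous_segment; apply: (analytic_cont fa).
  by have [/andP[h _] _] := seg t t01; rewrite /right_half_plane /= (lt_le_trans a'0).
have gb t : 0 <= t <= 1 -> normc (f (1 + t%:C * (w - 1))) <= M * expR (s' * `|Im w|).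
  move=> t01; have [h1 h2] := seg t t01; apply: le_trans (MP _ h1) _.
  rewrite ler_wpM2l// ler_expR.
  apply: (@le_trans _ _ (s' * `|Im (1 + t%:C * (w - 1))|)).
    by rewrite ler_wpM2r// le_max lexx.
  by rewrite ler_wpM2l.
have B1 := normc_cintegral_bound ler01 gc gb.
rewrite /segment_integral normcM.
have B2 : normc (w - 1) <= (`|b| + 2) * expR `|Im w|.
  apply: le_trans (normc_le_ReIm _) _; rewrite !cRI.
  have e1 := expR_ge1Dx `|Im w|; have i0 := normr_ge0 (Im w).
  have r1 : `|Re w - 1| <= `|b| + 1.
    have := ler_norm b; rewrite ler_norml; move: w0 wb; have := normr_ge0 b; move=> *; apply/andP; split; lra.
  have b0 := normr_ge0 b.
  have := ler_wpM2l b0 e1; have : 0 <= `|b| * `|Im w| by rewrite mulr_ge0.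
  lra.
apply: (@le_trans _ _ (((`|b| + 2) * expR `|Im w|) * (2 * (M * expR (s' * `|Im w|) * (1 - 0))))).
  by apply: ler_pM; rewrite ?normc_ge0.
rewrite subr0 mulr1 [(s' + 1) * _]mulrDl mul1r expRD.
rewrite le_eqVlt; apply/orP; left; apply/eqP; ring.
Qed.

Lemma segment_integral_half_plane f w : analytic_on (@right_half_plane R) f -> 0 < Re w ->
  cderiv (segment_integral f 1) w (f w).
Proof.
move=> fa w0; apply: (segment_integral_cderiv (@open_halfplane R) fa (star_halfplane _) w0).
by rewrite /= ltr01.
Qed.

Lemma cderiv_vertical F f z (x : R) : cderiv F (z + 'i * x%:C) (f (z + 'i * x%:C)) ->
  cderiv (fun w => F (z + 'i * w)) x%:C ('i * f (z + 'i * x%:C)).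
Proof.
move=> dF; have := cderiv_comp (g := F) (cderiv_affine z 'i x%:C) dF.
by move/cderiv_eq; apply; rewrite mulrC.
Qed.

Lemma Re_vertical z (x : R) : Re (z + 'i * x%:C) = Re z.
Proof. by rewrite !cRI. Qed.

Lemma line_integrable_weighted f z : analytic_on (@right_half_plane R) f -> line_integrable f ->
  0 < Re z -> weighted (fun u : R => f (z + 'i * u%:C)).
Proof.
move=> fa fl z0; split; last exact: fl.
move=> u; have zu : right_half_plane (z + 'i * u%:C) by rewrite /right_half_plane /= Re_vertical.
have Hc := cderiv_cont (analytic_cderiv fa zu).
apply: (ccont_comp (h := fun t : R => z + 'i * t%:C)); last exact: Hc.
apply: ccontD; first exact: ccont_cst.
by apply: ccontM; [exact: ccont_cst|exact: continuous_real_complex].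
Qed.

(** On a vertical line [F (z + 'i * u) - F z] is the primitive in [u] of ['i * f (z + 'i * u)] that
    vanishes at 0, and the Hardy inequality keeps the weight. *)
Lemma line_integrable_primitive f : analytic_on (@right_half_plane R) f -> line_integrable f ->
  line_integrable (segment_integral f 1).
Proof.
move=> fa fl z z0; set F := segment_integral f 1.
have dphi (x : R) : cderiv (fun w => F (z + 'i * w) - F z) x%:C ('i * f (z + 'i * x%:C)).
  have zx : 0 < Re (z + 'i * x%:C) by rewrite Re_vertical.
  have := cderivB (cderiv_vertical (segment_integral_half_plane fa zx)) (cderiv_cst (F z) x%:C).
  by move/cderiv_eq; apply; rewrite subr0.
have [|pw _] := weighted_primitive_spec (psi := fun w => 'i * f (z + 'i * w)) dphi _
  (weightedZ 'i (line_integrable_weighted fa fl z0)).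
  by rewrite mulr0 addr0 subrr.
have [_ H] := weightedD pw (weighted_cst (F z)).
by move: H; apply: (eq_integrable mT) => u _ /=; rewrite subrK.
Qed.

Lemma weight_pos (u : R) : 0 < u -> weight (2 * pi) 0 u = expR (- (2 * pi * `|u|)).
Proof. by move=> u0; rewrite /weight powRr0 mulr1 gtr0_norm. Qed.

Lemma weight_neg (u : R) : u < 0 -> weight (- (2 * pi)) 0 u = expR (- (2 * pi * `|u|)).
Proof. by move=> u0; rewrite /weight powRr0 mulr1 ltr0_norm// mulNr mulrN. Qed.

Lemma integrable_halflines (g : R -> R) : (forall u : R, {for u, continuous g}) ->
  (forall u, 0 <= g u) -> mu.-integrable `]0, +oo[ (EFin \o g) -> mu.-integrable `]-oo, 0[ (EFin \o g) ->
  mu.-integrable setT (EFin \o g) /\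
  \int[mu]_(u in setT) g u <= \int[mu]_(u in `]-oo, 0[) g u + \int[mu]_(u in `]0, +oo[) g u.
Proof.
move=> gc g0 ip im; apply: integrable_of_segments => // n.
have nseg : - n%:R <= (0 : R) <= n%:R by rewrite ler0n oppr_le0 ler0n.
have gi (a b : R) : mu.-integrable `[a, b] (EFin \o g).
  by apply: continuous_between_integrable => x _; exact: gc.
rewrite (Rintegral_split nseg (gi _ _)).
have mono (A B : set (measurableTypeR R)) : measurable A -> measurable B -> A `<=` B ->
    mu.-integrable B (EFin \o g) -> \int[mu]_(u in A) g u <= \int[mu]_(u in B) g u.
  move=> mA mB AB iB.
  rewrite (Rintegral_mkcond mu A) (Rintegral_mkcond mu B); apply: le_Rintegral => //.
  - by rewrite -restrict_EFin; apply: ((integrable_mkcond _ mA).1 (integrableS mB mA AB iB)).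
  - by rewrite -restrict_EFin; apply: ((integrable_mkcond _ mB).1 iB).
  - move=> u _; rewrite /patch; case: ifPn => [uA|_]; last by case: ifP.
    by rewrite ifT// inE; apply: AB; rewrite inE in uA.
apply: lerD.
- rewrite -(@Rintegral_itv_bndo_bndc _ (BLeft (- n%:R)) 0); last first.
    by apply: integrableS (gi (- n%:R) 0) => //; apply: subset_itvl; rewrite bnd_simp.
  apply: mono => //; apply: subset_itvr; rewrite bnd_simp//.
- rewrite -(@Rintegral_itv_obnd_cbnd _ 0 (BRight n%:R)); last first.
    by apply: integrableS (gi 0 n%:R) => //; apply: subset_itvr; rewrite bnd_simp.
  apply: mono => //; apply: subset_itvl; rewrite bnd_simp//.
Qed.

End TClass.

(** * From the half-line hypotheses to limits on the whole line *)

Section TaylorLimit.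
Variable R : realType.
Local Notation C := R[i].
Local Notation mu := (@lebesgue_measure R).
Implicit Types (w z y : C) (u v t : R) (f F : C -> C).
Local Notation Re := (@complex.Re R).
Local Notation Im := (@complex.Im R).

(** For the Taylor remainders, convergence at a single height is enough. Convergence to 0 in the
    extended reals also yields that the integrals are eventually finite. *)
Lemma cvg_locally_uniformly_ereal (J : R -> R -> \bar R) (y e : R) :
  cvg_locally_uniformly J (fun=> 0%E) -> 0 < e ->
  \forall x \near +oo, J x y \is a fin_num /\ `|fine (J x y)| < e.
Proof.
move=> Jl e0; have [A Ay JA] := Jl y.
have yA : [set y] `<=` A by move=> _ ->; exact: nbhs_singleton.
have lim0 : J x y @[x --> +oo] --> (0%R)%:E.
  have := uniform_subset_cvg _ yA JA; rewrite uniform_set1 => H; exact: H.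
have [fin lim] := (fine_cvgP (F := +oo%R) _ _).1 lim0.
have lim' : (fun x => fine (J x y)) x @[x --> +oo] --> (0 : R) by exact: lim.
move/cvgrPdist_lt : lim' => /(_ e e0) small.
apply: filterS2 fin small => x xf; rewrite sub0r normrN => xe; split; [exact: xf|exact: xe].
Qed.

Lemma cvg_locally_uniformly_complex (J : R -> R -> C) (y e : R) :
  cvg_locally_uniformly J (fun=> 0) -> 0 < e -> exists2 d : R, 0 < d &
  \forall x \near +oo, forall t, `|t - y| < d -> normc (J x t) < e.
Proof.
move=> Jl e0; have [A Ay JA] := Jl y.
have [d /= d0 dA] := (nbhs_ballP (y : R) _).1 Ay.
exists d => //.
pose E := [set ab : C * C | normc (ab.1 - ab.2) < e].
have EE : entourage E.
  rewrite -entourage_from_ballE; exists e%:C => /=; first by rewrite ltcR.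
  by move=> [a b]; rewrite /ball /= norm_normc ltcR.
have := JA [set h | forall t, A t -> E (0, h t)].
have : nbhs ((fun=> 0) : {uniform` A -> C}) [set h | forall t, A t -> E (0, h t)].
  by apply/uniform_nbhs; exists E; split.
move=> nb /(_ nb) JE.
have {}JE : \forall x \near +oo, forall t, A t -> E (0, J x t) by exact: JE.
apply: filterS JE => x Ht t ty.
have /Ht : A t by apply: dA; rewrite /ball /= distrC.
by rewrite /E /= sub0r normcN.
Qed.

Lemma T_line_integrable p f : T_class p (- (2 * pi)) 0 (2 * pi) 0 f -> line_integrable f.
Proof.
move=> Tf z z0.
have gc (u : R) : {for u, continuous (fun u : R => normc (f (z + 'i * u%:C)) * expR (- (2 * pi * `|u|)))}.
  apply: weighted_continuous.
  have zu : right_half_plane (z + 'i * u%:C) by rewrite /right_half_plane /= Re_vertical.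
  have Hc := cderiv_cont (analytic_cderiv (T_analytic Tf) zu).
  apply: (ccont_comp (h := fun t : R => z + 'i * t%:C)); last exact: Hc.
  apply: ccontD; first exact: ccont_cst.
  by apply: ccontM; [exact: ccont_cst|exact: continuous_real_complex].
apply: (integrable_halflines gc _ _ _).1.
- by move=> u; rewrite mulr_ge0 ?normc_ge0 ?expR_ge0.
- have mI : measurable (`]0%R, +oo[%classic : set (measurableTypeR R)) by exact: measurable_itv.
  have := T_integrable_pos Tf z0; apply: (eq_integrable mI) => u; rewrite inE /= in_itv /= andbT => u0.
  by rewrite weight_pos.
- have mI : measurable (`]-oo, 0%R[%classic : set (measurableTypeR R)) by exact: measurable_itv.
  have := T_integrable_neg Tf z0; apply: (eq_integrable mI) => u; rewrite inE /= in_itv /= => u0.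
  by rewrite weight_neg.
Qed.

Lemma half_line_small (A : set (measurableTypeR R)) (h : R -> R) : measurable A ->
  (forall u : R, {for u, continuous h}) -> (forall u, 0 <= h u) ->
  (\int[mu]_(u in A) (h u)%:E)%E \is a fin_num -> mu.-integrable A (EFin \o h).
Proof.
move=> mA hc h0 fin; apply/integrableP; split.
  by apply/measurable_EFinP; apply: measurable_funTS; exact: continuous_measurable.
have -> : (\int[mu]_(u in A) `|(EFin \o h) u| = \int[mu]_(u in A) (h u)%:E)%E.
  by apply: eq_integral => u _; rewrite /= ger0_norm.
by rewrite ltey_eq fin.
Qed.

Lemma weighted_taylor_remainder p f z : analytic_on (@right_half_plane R) f -> line_integrable f ->
  0 < Re z -> weighted (taylor_remainder p f z).
Proof.
move=> fa fl z0; apply: weightedB; first exact: line_integrable_weighted.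
apply: (@weighted_sum R p (fun j u => derive1n j f z / (j`!)%:R * ('i * u%:C) ^+ j)) => j.
have H := weightedZ (derive1n j f z / (j`!)%:R * 'i ^+ j) (weighted_pow R j).
apply: (weighted_ext _ H) => u.
by rewrite exprMn mulrA.
Qed.

(** Far to the right both half-line integrals are finite and below [e / 2]. As the integrand is
    continuous and nonnegative, this gives integrability on each half-line, and then the bound on
    the line. *)
Lemma T_remainder_limit p f (y e : R) : T_class p (- (2 * pi)) 0 (2 * pi) 0 f -> 0 < e ->
  \forall x \near +oo,
    \int[mu]_(u in setT) (normc (taylor_remainder p f (x +i* y) u) * expR (- (2 * pi * `|u|))) <= e.
Proof.
move=> Tf e0.
have e2 : 0 < e / 2 by rewrite divr_gt0.
have fl := T_line_integrable Tf.
have Hp := cvg_locally_uniformly_ereal y (T_limit_pos Tf) e2.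
have Hn := cvg_locally_uniformly_ereal y (T_limit_neg Tf) e2.
apply: filterS3 (nbhs_pinfty_gt (num_real 0)) Hp Hn => x x0 [fp sp] [fn sn].
have x0' : 0 < Re (x +i* y) by [].
set h := fun u : R => normc (taylor_remainder p f (x +i* y) u) * expR (- (2 * pi * `|u|)).
have [rc _] := weighted_taylor_remainder p (T_analytic Tf) fl x0'.
have hc (u : R) : {for u, continuous h} := weighted_continuous (rc u).
have h0 u : 0 <= h u by rewrite mulr_ge0 ?normc_ge0 ?expR_ge0.
have mp : measurable (`]0%R, +oo[%classic : set (measurableTypeR R)) by exact: measurable_itv.
have mn : measurable (`]-oo, 0%R[%classic : set (measurableTypeR R)) by exact: measurable_itv.
have Ep : (\int[mu]_(u in `]0%R, +oo[) (normc (taylor_remainder p f (x +i* y) u) * weight (2 * pi) 0 u)%:E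
    = \int[mu]_(u in `]0%R, +oo[) (h u)%:E)%E.
  by apply: eq_integral => u; rewrite inE /= in_itv /= andbT => u0; rewrite weight_pos.
have En : (\int[mu]_(u in `]-oo, 0%R[) (normc (taylor_remainder p f (x +i* y) u) * weight (- (2 * pi)) 0 u)%:E
    = \int[mu]_(u in `]-oo, 0%R[) (h u)%:E)%E.
  by apply: eq_integral => u; rewrite inE /= in_itv /= => u0; rewrite weight_neg.
rewrite Ep in fp sp; rewrite En in fn sn.
have [_] := integrable_halflines hc h0 (half_line_small mp hc h0 fp) (half_line_small mn hc h0 fn).
move/le_trans; apply; rewrite /Rintegral.
move: (ltW (le_lt_trans (ler_norm _) sp)) (ltW (le_lt_trans (ler_norm _) sn)); lra.
Qed.

End TaylorLimit.

(** * Taylor expansions at integers and of the line transform *)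

Section TaylorExpansion.
Variable R : realType.
Local Notation C := R[i].
Local Notation mu := (@lebesgue_measure R).
Implicit Types (w z y : C) (u v t : R) (f F : C -> C).
Local Notation Re := (@complex.Re R).
Local Notation Im := (@complex.Im R).

Let mT : measurable (setT : set (measurableTypeR R)).
Proof. exact: measurableT. Qed.

Lemma cderiv_sum (n : nat) (g g' : nat -> C -> C) z : (forall j, cderiv (g j) z (g' j z)) ->
  cderiv (fun w => \sum_(j < n) g j w) z (\sum_(j < n) g' j z).
Proof.
move=> dg; elim: n => [|n IH].
  apply: (cderiv_eq (cderiv_ext _ (cderiv_cst 0 z))) => [w|]; by rewrite big_ord0.
apply: (cderiv_eq (cderiv_ext _ (cderivD IH (dg n)))) => [w|]; by rewrite big_ord_recr.
Qed.

Lemma fact_neq0 (n : nat) : (n`!%:R : C) != 0.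
Proof. by rewrite pnatr_eq0 -lt0n fact_gt0. Qed.

Lemma cderiv_monomial (k : C -> C) z l (a : C) (j : nat) : cderiv k z l ->
  cderiv (fun w => a / (j.+1`!)%:R * k w ^+ j.+1) z (l * (a / (j`!)%:R * k z ^+ j)).
Proof.
move=> dk; apply: (cderiv_eq (cderivZ (a / (j.+1`!)%:R) (cderivX j dk))).
have f0 := fact_neq0 j; have j0 : (j.+1%:R : C) != 0 by rewrite pnatr_eq0.
rewrite factS natrM; move: f0 j0; move: (j.+1%:R : C) (j`!%:R : C) => x y' y0 x0.
by field; rewrite y0 x0.
Qed.

Section Uniform.
Variables (Gd : nat -> C -> C) (p : nat).
Hypothesis dG : forall j w, 0 < Re w -> cderiv (Gd j) w (Gd j.+1 w).
Hypothesis lim : forall (a : C) (e : R), 0 < e -> exists N : nat, forall n : nat, (N <= n)%N ->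
  forall s : R, 0 <= s <= 1 -> normc (Gd p (n%:R + s%:C * a)) <= e.

(** Induction on the number [m] of Taylor terms: the derivative of the error of [Gd j] with [m.+1]
    terms is the error of [Gd j.+1] with [m] terms, and it is integrated from [n], where the error
    vanishes. The start [m = 0] is the decay of [Gd p]. *)
Lemma taylor_uniform (m j : nat) : (j + m)%N = p -> forall (a : C) (e : R), 0 < e ->
  exists N : nat, forall n : nat, (N <= n)%N -> forall s : R, 0 <= s <= 1 ->
    normc (Gd j (n%:R + s%:C * a) - \sum_(i < m) Gd (j + i)%N n%:R / (i`!)%:R * (s%:C * a) ^+ i) <= e.
Proof.
elim: m j => [|m IH] j jm a e e0.
  rewrite addn0 in jm; have [N NP] := lim a e0; exists N => n Nn s s01.
  by rewrite big_ord0 subr0 jm; exact: NP.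
have A0 : 0 < 2 * (normc a + 1) by rewrite mulr_gt0// ltr_wpDl ?normc_ge0.
have jm' : (j.+1 + m)%N = p by rewrite addSnnS.
have [N NP] := IH j.+1 jm' a _ (divr_gt0 e0 A0).
(* The second summand keeps the segment from [n] to [n + a] in the right half-plane. *)
exists (N + (Num.bound `|Re a|).+1)%N => n Nn s s01.
have Nn' : (N <= n)%N by apply: leq_trans Nn; rewrite leq_addr.
have nb : `|Re a| < n%:R.
  apply: lt_le_trans (archi_boundP (normr_ge0 (Re a))) _.
  by rewrite ler_nat (leq_trans _ Nn)// addnS (leq_trans (leq_addl N _)).
case/andP: (s01) => s0 s1.
have pos (r : R) : 0 <= r <= 1 -> 0 < Re (n%:R + r%:C * (s%:C * a)).
  move=> /andP[r0 r1]; rewrite -real_complex_nat !cRI.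
  have h1 : `|r * (s * Re a)| <= `|Re a|.
    by rewrite !normrM (ger0_norm r0) (ger0_norm s0) mulrA ler_piMl// mulr_ile1.
  by move: h1 nb; rewrite ler_norml; have := normr_ge0 (Re a); lra.
pose tay (q l : nat) w := \sum_(i < l) Gd (q + i)%N n%:R / (i`!)%:R * (w - n%:R) ^+ i.
pose g w := Gd j w - tay j m.+1 w.
pose g' w := Gd j.+1 w - tay j.+1 m w.
pose g'' w := Gd j.+2 w - tay j.+2 m.-1 w.
have dn w : cderiv (fun w => w - n%:R) w 1.
  by apply: (cderiv_eq (cderivB (cderiv_id w) (cderiv_cst n%:R w))); rewrite subr0.
have dtay q l w : cderiv (tay q l.+1) w (tay q.+1 l w).
  have D := @cderiv_sum l (fun i w => Gd (q.+1 + i)%N n%:R / (i.+1`!)%:R * (w - n%:R) ^+ i.+1)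
    (fun i w => 1 * (Gd (q.+1 + i)%N n%:R / (i`!)%:R * (w - n%:R) ^+ i)) w
    (fun i => cderiv_monomial (Gd (q.+1 + i)%N n%:R) i (dn w)).
  have D2 := cderivD (cderiv_cst (Gd q n%:R) w) D.
  apply: (cderiv_eq (cderiv_ext _ D2)) => [z|].
    rewrite /tay big_ord_recl addn0 fact0 divr1 expr0 mulr1; congr (_ + _).
    by apply: eq_bigr => i _; rewrite /= /bump /= add1n addSnnS.
  by rewrite add0r; apply: eq_bigr => i _; rewrite mul1r.
have dg w : 0 < Re w -> cderiv g w (g' w).
  by move=> w0; exact: (cderivB (dG j w0) (dtay j m w)).
have g'c w : 0 < Re w -> {for w, continuous g'}.
  move=> w0; have [l dl] : exists l, cderiv (tay j.+1 m) w l.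
    case: (m) => [|m']; last by exists (tay j.+2 m' w); exact: dtay.
    by exists 0; apply: (cderiv_ext _ (cderiv_cst 0 w)) => z; rewrite /tay big_ord0.
  exact: (cderiv_cont (cderivB (dG j.+1 w0) dl)).
have g0 : g n%:R = 0.
  rewrite /g /tay big_ord_recl addn0 fact0 divr1 expr0 mulr1 big1 ?addr0 ?subrr// => i _.
  by rewrite expr0n mulr0.
have E := cintegral_segment (F := g) (f := g') (w := n%:R) (k := s%:C * a)
  (fun r r01 => conj (dg _ (pos r r01)) (g'c _ (pos r r01))).
have gE : g (n%:R + s%:C * a) = Gd j (n%:R + s%:C * a) -
    \sum_(i < m.+1) Gd (j + i)%N n%:R / (i`!)%:R * (s%:C * a) ^+ i.
  rewrite /g /tay; congr (_ - _); apply: eq_bigr => i _; congr (_ * _ ^+ _).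
  by rewrite addrC addKr.
rewrite -gE -[g _]subr0 -g0 -E.
have cc : continuous_between 0 1 (fun r : R => s%:C * a * g' (n%:R + r%:C * (s%:C * a))).
  move=> r r01; apply: ccontM; first exact: ccont_cst.
  by apply: continuous_segment; exact: (g'c _ (pos r r01)).
have bb (r : R) : 0 <= r <= 1 -> normc (s%:C * a * g' (n%:R + r%:C * (s%:C * a))) <=
    normc a * (e / (2 * (normc a + 1))).
  move=> /andP[r0 r1]; rewrite !normcM normc_real (ger0_norm s0).
  apply: ler_pM; rewrite ?mulr_ge0 ?normc_ge0//.
    by rewrite ler_piMl ?normc_ge0.
  (* The integral runs over the points [n + r * s * a], which is why the statement is uniform in
     [s]. *)
  have := NP n Nn' (r * s); rewrite mulr_ge0// mulr_ile1// => /(_ isT).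
  rewrite /g' /tay real_complexM mulrA.
  by under [in X in _ -> X]eq_bigr do rewrite [_ - n%:R]addrC addKr.
apply: le_trans (normc_cintegral_bound ler01 cc bb) _.
have q0 := ltW (divr_gt0 e0 A0); have qE := divfK (lt0r_neq0 A0) e.
rewrite subr0 mulr1 -[leRHS]qE; move: q0; set q := e / _; lra.
Qed.

End Uniform.

(** The imaginary parts of [s * a] fill a compact segment, so local uniformity provides one
    threshold for all of them. In the property fed to [segment_uniform] the scale [ep] stands for
    the threshold [ep^-1]. *)
Lemma locally_uniform_nat (h : C -> C) : cvg_locally_uniformly (fun x y : R => h (x +i* y)) (fun=> 0) ->
  forall (a : C) (e : R), 0 < e -> exists N : nat, forall n : nat, (N <= n)%N ->
  forall s : R, 0 <= s <= 1 -> normc (h (n%:R + s%:C * a)) <= e.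
Proof.
move=> hl a e e0.
have [t _|d d0 dP] := @segment_uniform R (- `|Im a|) `|Im a|
    (fun ep t => forall x : R, ep^-1 < x -> normc (h (x +i* t)) <= e).
  have [d d0 [M [_ MP]]] := cvg_locally_uniformly_complex t hl e0.
  have M0 : 0 < Num.max M 1 by rewrite lt_max ltr01 orbT.
  exists (Num.min d (Num.max M 1)^-1) => [|ep s]; first by rewrite lt_min d0 invr_gt0.
  rewrite !lt_min => /and3P[ep0 _ epM] /andP[sd _] x xep.
  apply: ltW; apply: MP; last exact: sd.
  apply: le_lt_trans xep; apply: (@le_trans _ _ (Num.max M 1)); first by rewrite le_max lexx.
  by rewrite -[leLHS]invrK lef_pV2 ?posrE ?invr_gt0// ltW.
pose X := (d / 2)^-1 + `|Re a|.
have X0 : 0 <= X by rewrite addr_ge0 ?invr_ge0 ?divr_ge0 ?(ltW d0).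
exists (Num.bound X) => n Nn s /andP[s0 s1].
have nX : X < n%:R by apply: lt_le_trans (archi_boundP X0) _; rewrite ler_nat.
have -> : n%:R + s%:C * a = (n%:R + s * Re a) +i* (s * Im a).
  by rewrite -real_complex_nat; apply: complex_eqP; rewrite !cRI.
have sa (b : R) : `|s * b| <= `|b| by rewrite normrM ger0_norm// ler_piMl.
apply: (dP (d / 2)).
- by rewrite divr_gt0//= ltr_pdivrMr// mulr2n mulrDr mulr1 ltrDl.
- by rewrite -ler_norml.
- by move: nX (sa (Re a)); rewrite /X ler_norml; lra.
Qed.

Section LineTaylor.
Variables (F f : C -> C) (p : nat) (v : R).
Hypothesis fa : analytic_on (@right_half_plane R) f.
Hypothesis fl : line_integrable f.
Hypothesis dF : forall w, 0 < Re w -> cderiv F w (f w).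
Hypothesis v01 : -1 < v < 0.

Definition kap_moment (j : nat) : C :=
  cintegral setT (fun u : R => kap (u%:C + 'i * v%:C) * ('i * u%:C) ^+ j).

Lemma kap_moment0 : kap_moment 0 = 1.
Proof.
rewrite -(kap_integral v01); apply: eq_cintegral => u _.
by rewrite expr0 mulr1.
Qed.

Lemma weighted_monomial (a : C) (j : nat) : weighted (fun u : R => a * ('i * u%:C) ^+ j).
Proof.
have H := weightedZ (a * 'i ^+ j) (weighted_pow R j).
by apply: (weighted_ext _ H) => u; rewrite exprMn mulrA.
Qed.

(** Subtract from [F] on the vertical line its Taylor polynomial [L] at [T = y - v]. The derivative
    of the difference is ['i] times the Taylor remainder of [f], so the Hardy inequality bounds the
    difference by that remainder in the weighted norm. Integrating [L] against the kernel produces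
    the moments. *)
Lemma line_transform_taylor : exists2 K : R, 0 <= K & forall y, v < Re y ->
  normc (line_transform F y v - F (y - v%:C)
    - \sum_(j < p) derive1n j f (y - v%:C) / (j.+1`!)%:R * kap_moment j.+1) <=
  K * \int[mu]_(u in setT) (normc (taylor_remainder p f (y - v%:C) u) * expR (- (2 * pi * `|u|))).
Proof.
have [K K0 KP] := transform_bound v01.
exists (K * (2 * (2 * pi)^-1)) => [|y vy].
  by rewrite !mulr_ge0// invr_ge0 mulr_ge0// pi_ge0.
have : 0 < Re (y - v%:C) by rewrite !cRI subr_gt0.
set T := y - v%:C => T0.
pose c j := derive1n j f T.
pose L z := F T + \sum_(j < p) c j / (j.+1`!)%:R * ('i * z) ^+ j.+1.
pose phi z := F (T + 'i * z) - L z.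
pose psi z := 'i * (f (T + 'i * z) - \sum_(j < p) c j / (j`!)%:R * ('i * z) ^+ j).
have di w : cderiv (fun z => 'i * z) w 'i.
  by apply: (cderiv_eq (cderivZ 'i (cderiv_id w))); rewrite mulr1.
have dphi (x : R) : cderiv phi x%:C (psi x%:C).
  have Tx : 0 < Re (T + 'i * x%:C) by rewrite Re_vertical.
  have dS := @cderiv_sum p (fun j z => c j / (j.+1`!)%:R * ('i * z) ^+ j.+1)
    (fun j z => 'i * (c j / (j`!)%:R * ('i * z) ^+ j)) x%:C
    (fun j => cderiv_monomial (c j) j (di x%:C)).
  have D := cderivB (cderiv_vertical (dF Tx)) (cderivD (cderiv_cst (F T) x%:C) dS).
  by apply: (cderiv_eq D); rewrite /psi add0r -mulr_sumr mulrBr.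
have phi0 : phi 0 = 0.
  rewrite /phi /L mulr0 addr0 big1 ?addr0 ?subrr// => j _.
  by rewrite expr0n mulr0.
have wrem := weighted_taylor_remainder p fa fl T0.
have wpsi : weighted (fun x : R => psi x%:C) by exact: (weightedZ 'i wrem).
have [[phic phii] phib] := weighted_primitive_spec dphi phi0 wpsi.
have wL : weighted (fun x : R => L x%:C).
  apply: weightedD; first exact: weighted_cst.
  apply: (@weighted_sum R p (fun j u => c j / (j.+1`!)%:R * ('i * u%:C) ^+ j.+1)) => j.
  exact: weighted_monomial.
have Lint : cintegral setT (fun u : R => kap (u%:C + 'i * v%:C) * L u%:C) =
    F T + \sum_(j < p) c j / (j.+1`!)%:R * kap_moment j.+1.
  have i1 j : cintegrable setT (fun u : R => kap (u%:C + 'i * v%:C) * ('i * u%:C) ^+ j).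
    apply: (kap_mul_integrable v01).
    by apply: (weighted_ext _ (weighted_monomial 1 j)) => u; rewrite mul1r.
  pose g j (u : R) := c j / (j.+1`!)%:R * (kap (u%:C + 'i * v%:C) * ('i * u%:C) ^+ j.+1).
  have i2 j : cintegrable setT (g j) := cintegrableZ (c j / (j.+1`!)%:R) mT (i1 j.+1).
  have i3 := cintegrableZ (F T) mT (kap_line_integrable v01).
  have iS := cintegrable_sum (n := p) mT (fun j _ => i2 j).
  transitivity (cintegral setT (fun u : R => F T * kap (u%:C + 'i * v%:C) + \sum_(j < p) g j u)).
    apply: eq_cintegral => u _; rewrite /L mulrDr mulrC; congr (_ + _).
    by rewrite mulr_sumr; apply: eq_bigr => j _; rewrite /g mulrCA.
  rewrite (cintegralD mT i3 iS) (cintegralZ _ mT (kap_line_integrable v01)) (kap_integral v01) mulr1.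
  have S := @cintegral_sum R setT p g mT (fun j _ => i2 j).
  congr (_ + _); apply: (etrans S); apply: eq_bigr => j _.
  exact: (cintegralZ _ mT (i1 j.+1)).
have iF : cintegrable setT (fun u : R => kap (u%:C + 'i * v%:C) * (phi u%:C + L u%:C)).
  by apply: (kap_mul_integrable v01); apply: weightedD.
have iL := kap_mul_integrable v01 wL.
have E : cintegral setT (fun u : R => kap (u%:C + 'i * v%:C) * phi u%:C) =
    line_transform F y v - F T - \sum_(j < p) c j / (j.+1`!)%:R * kap_moment j.+1.
  rewrite -addrA -opprD -Lint.
  rewrite [line_transform _ _ _](eq_cintegral (g := fun u : R => kap (u%:C + 'i * v%:C) * (phi u%:C + L u%:C))).
    rewrite -(cintegralB mT iF iL); apply: eq_cintegral => u _.
    by rewrite -mulrBr addrK.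
  by move=> u _; rewrite /phi subrK rotated_line.
rewrite -E; apply: le_trans (KP _ phic phii) _.
rewrite -mulrA ler_wpM2l//; apply: le_trans phib _.
rewrite le_eqVlt; apply/orP; left; apply/eqP; congr (_ * _).
by apply: eq_Rintegral => u _; rewrite /psi normcM normci mul1r.
Qed.

End LineTaylor.
End TaylorExpansion.

(** * Uniqueness of the Mueller-Schleicher sum *)

Section Uniqueness.
Variable R : realType.
Local Notation C := R[i].
Implicit Types (w z y : C) (f : C -> C).
Local Notation Re := (@complex.Re R).
Local Notation Im := (@complex.Im R).

Definition vanishing (u : nat -> C) : Prop := forall e : R, 0 < e ->
  exists N : nat, forall n : nat, (N <= n)%N -> normc (u n) <= e.

Lemma vanishing_cvg (u : nat -> C) (l : C) : vanishing (fun n => u n - l) <-> u @ \oo --> l.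
Proof.
split=> [H|ul].
  apply/cvg_normc => e e0; have [N NP] := H _ (divr_gt0 e0 ltr02).
  exists N => // n /= /NP; move/le_lt_trans; apply.
  by rewrite ltr_pdivrMr// mulr2n mulrDr mulr1 ltrDl.
move=> e e0; have /cvg_normc/(_ e e0)[N _ NP] := ul.
by exists N => n Nn; rewrite ltW//; exact: NP.
Qed.

Lemma vanishingD (u w : nat -> C) : vanishing u -> vanishing w -> vanishing (fun n => u n + w n).
Proof.
move=> uv wv e e0; have [N NP] := uv _ (divr_gt0 e0 ltr02).
have [M MP] := wv _ (divr_gt0 e0 ltr02).
exists (N + M)%N => n nNM; rewrite [leRHS](splitr e); apply: le_trans (normcD _ _) _.
apply: lerD; [apply: NP|apply: MP]; apply: leq_trans nNM; [exact: leq_addr|exact: leq_addl].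
Qed.

Lemma vanishingZ (a : C) (u : nat -> C) : vanishing u -> vanishing (fun n => a * u n).
Proof.
move=> uv e e0; have a0 : 0 < normc a + 1 by rewrite ltr_wpDl ?normc_ge0.
have [N NP] := uv _ (divr_gt0 e0 a0); exists N => n /NP H.
rewrite normcM -[leRHS](divfK (lt0r_neq0 a0)) mulrC ler_pM ?normc_ge0// lerDl//.
Qed.

Lemma vanishing_ext (u w : nat -> C) : (forall n, u n = w n) -> vanishing u -> vanishing w.
Proof. by move=> /funext ->. Qed.

Lemma vanishing_sum (q : nat) (b : nat -> C) (u : nat -> nat -> C) :
  (forall j, (j < q)%N -> vanishing (u j)) -> vanishing (fun n => \sum_(j < q) b j * u j n).
Proof.
elim: q => [|q IH] H.
  by move=> e e0; exists 0%N => n _; rewrite big_ord0 normc0 ltW.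
have uq := vanishingZ (b q) (H q (ltnSn q)).
have us := IH (fun j jq => H j (ltnW jq)).
by apply: (vanishing_ext _ (vanishingD us uq)) => n; rewrite big_ord_recr.
Qed.

(** Lagrange interpolation at the nodes [0, ..., d - 1]; what matters is that the coefficients do
    not depend on [q]. For the new node [d], write [q = q1 * ('X - d) + q.[d]] and apply the
    induction hypothesis to [q1]. *)
Lemma interpolation (d : nat) z : exists l : nat -> C, forall q : {poly C}, (size q <= d)%N ->
  q.[z] = \sum_(i < d) l i * q.[i%:R].
Proof.
elim: d => [|d [l lP]].
  by exists (fun=> 0) => q; rewrite leqn0 size_poly_eq0 => /eqP ->; rewrite horner0 big_ord0.
pose m i := (z - d%:R) * l i / (i%:R - d%:R).
exists (fun i => if i == d then 1 - \sum_(k < d) m k else m i) => q qd.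
have /factor_theorem[q1 qE] : root (q - (q.[d%:R])%:P) d%:R.
  by rewrite /root hornerD hornerN hornerC subrr.
have {}qE : q = q1 * ('X - d%:R%:P) + (q.[d%:R])%:P by rewrite -qE subrK.
have q1d : (size q1 <= d)%N.
  have [->|q10] := eqVneq q1 0; first by rewrite size_poly0.
  have : (size (q1 * ('X - d%:R%:P))%R <= d.+1)%N.
    have -> : q1 * ('X - d%:R%:P) = q - (q.[d%:R])%:P by rewrite {1}qE addrK.
    rewrite (leq_trans (size_polyD _ _))// geq_max qd size_polyN.
    by rewrite (leq_trans (size_polyC_leq1 _)).
  by rewrite size_Mmonic ?monicXsubC// size_XsubC addn2.
have qi i : q.[i] = q1.[i] * (i - d%:R) + q.[d%:R].
  by rewrite {1}qE hornerD hornerM hornerXsubC hornerC.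
rewrite big_ord_recr /= eqxx.
have -> : \sum_(i < d) (if i == d :> nat then 1 - \sum_(k < d) m k else m i) * q.[i%:R] =
    (\sum_(i < d) l i * q1.[i%:R]) * (z - d%:R) + (\sum_(k < d) m k) * q.[d%:R].
  rewrite !mulr_suml -big_split; apply: eq_bigr => i _ /=.
  have iD : (i%:R - d%:R : C) != 0 by rewrite subr_eq0 eqr_nat ltn_eqF.
  rewrite (ltn_eqF (ltn_ord i)) (qi i%:R) /m.
  by field.
rewrite qi (lP q1 q1d); ring.
Qed.

(** At the integers the limit is [D 0] by periodicity. Interpolation expresses [(q n).[z]] by
    finitely many such values, with coefficients of sum 1, so the limit at [z] is again [D 0]. *)
Lemma periodic_limit_constant (d : nat) (q : nat -> {poly C}) (D : C -> C) z :
  (forall n, (size (q n) <= d)%N) ->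
  (forall y, -1 < Re y -> vanishing (fun n => (q n).[y] - D y)) ->
  (forall y, -1 < Re y -> D (y + 1) = D y) -> -1 < Re z -> D z = D 0.
Proof.
move=> qd qD Dp z1.
have Dn (n : nat) : D n%:R = D 0.
  elim: n => [//|n IH]; rewrite -natr1 Dp// -real_complex_nat !cRI.
  by rewrite (lt_le_trans (ltrN10 _)).
(* With [d.+1] nodes the constant polynomial 1 is covered even if [d = 0]; it gives the sum of the
   coefficients. *)
have [l lP] := interpolation d.+1 z.
have l1 : \sum_(i < d.+1) l i = 1.
  have := lP 1; rewrite size_poly1 => /(_ isT); rewrite hornerE => E.
  by rewrite [RHS]E; apply: eq_bigr => i _; rewrite hornerE mulr1.
have S : vanishing (fun n => \sum_(i < d.+1) l i * ((q n).[i%:R] - D 0)).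
  apply: (@vanishing_sum d.+1 l (fun i n => (q n).[i%:R] - D 0)) => j _.
  by rewrite -(Dn j); apply: qD; rewrite -real_complex_nat !cRI (lt_le_trans (ltrN10 _)).
have {}S : vanishing (fun n => (q n).[z] - D 0).
  apply: (vanishing_ext _ S) => n.
  rewrite (lP (q n) (leqW (qd n))) -[in RHS](mul1r (D 0)) -l1 mulr_suml -sumrB.
  by apply: eq_bigr => i _; rewrite mulrBr.
move/vanishing_cvg: S => S; have /vanishing_cvg S' := qD z z1.
exact: (ccvg_unique S' S).
Qed.

(** Subtracting the two limits eliminates the sums of [f]: the polynomials [P n - P' n] converge to
    [Q - Q'], which has period 1 by the two shift equations. *)
Lemma MS_data_unique f P Q P' Q' z : MS_data (@right_half_plane R) f P Q ->
  MS_data (@right_half_plane R) f P' Q' -> -1 < Re z -> Q z - Q 0 = Q' z - Q' 0.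
Proof.
move=> [[d dP] lP sP] [[d' dP'] lP' sP'] z1.
have U1 y : -1 < Re y -> right_half_plane (y + 1).
  by rewrite /right_half_plane /= !cRI; lra.
have := @periodic_limit_constant (d + d')%N (fun n => P n - P' n) (fun y => Q y - Q' y) z.
move=> H; suff E : Q z - Q' z = Q 0 - Q' 0.
  have -> : Q z - Q 0 = (Q z - Q' z) + Q' z - Q 0 by ring.
  rewrite E; ring.
apply: H z1 => [n|y /U1 y1|y /U1 y1].
- rewrite (leq_trans (size_polyD _ _))// geq_max size_polyN.
  rewrite (leq_trans (dP n)) ?leq_addr// (leq_trans (dP' n)) ?leq_addl//.
- have /vanishing_cvg A := lP y y1; have /vanishing_cvg B := lP' y y1.
  apply: (vanishing_ext _ (vanishingD B (vanishingZ (-1) A))) => n.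
  rewrite hornerD hornerN; ring.
- have A := sP y y1; have B := sP' y y1.
  have -> : Q (y + 1) = Q (y + 1) - Q y + Q y by ring.
  rewrite A -B; ring.
Qed.

End Uniqueness.

(** * Umbral evaluation and summation *)

Section UmbraSum.
Variable R : realType.
Local Notation C := R[i].
Local Notation mu := (@lebesgue_measure R).
Implicit Types (w z y : C).
Local Notation Re := (@complex.Re R).
Local Notation Im := (@complex.Im R).
Variables (f : C -> C) (p : nat).
Hypothesis Tf : T_class p (- (2 * pi)) 0 (2 * pi) 0 f.
Hypothesis fp0 : cvg_locally_uniformly (fun x y : R => derive1n p f (x +i* y)) (fun=> 0).

Let mT : measurable (setT : set (measurableTypeR R)).
Proof. exact: measurableT. Qed.

Let F := segment_integral f 1.
Let h : R := - 2^-1.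
Let h01 : -1 < h < 0. Proof. by rewrite /h; apply/andP; split; lra. Qed.

Let fa : analytic_on (@right_half_plane R) f := T_analytic Tf.
Let fl : line_integrable f := T_line_integrable Tf.
Let dF w : 0 < Re w -> cderiv F w (f w).
Proof. exact: segment_integral_half_plane. Qed.
Let Fs : strip_bounded F.
Proof. exact: (strip_bounded_primitive fa (exponentially_bounded_strip (T_bounded Tf))). Qed.
Let Fl : line_integrable F := line_integrable_primitive fa fl.

(* F(B + y), expressed through F(B + y + 1) so that the line [Im w = - 1/2]
   serves every y with [-1 < Re y]. *)
Definition umbra_value_fun y := line_transform F (y + 1) h - f (y + 1).
Local Notation Q := umbra_value_fun.

Lemma line_transform_eq y (v v' : R) : -1 < v < 0 -> -1 < v' < 0 -> v < Re y -> v' < Re y ->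
  line_transform F y v = line_transform F y v'.
Proof.
move=> /andP[v1 v0] /andP[v'1 v'0] vy v'y.
have [vv|/ltW vv] := leP v v'; first exact: (line_transform_indep dF Fs Fl).
by apply/esym; exact: (line_transform_indep dF Fs Fl).
Qed.

Lemma umbra_value_line y (v : R) : -1 < Re y -> -1 < v < 0 -> v < Re y -> Q y = line_transform F y v.
Proof.
move=> y1 v01 vy.
have vy1 : v < Re (y + 1) by rewrite !cRI; lra.
have hy1 : h < Re (y + 1) by rewrite !cRI /h; lra.
by rewrite /Q (line_transform_eq h01 v01 hy1 vy1) (line_transform_shift dF Fs Fl y1 v01 vy) addrK.
Qed.

Lemma umbra_value_shift y : -1 < Re y -> Q (y + 1) - Q y = f (y + 1).
Proof.
move=> y1; have y2 : -1 < Re (y + 1) by rewrite !cRI; lra.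
have hy1 : h < Re (y + 1) by rewrite !cRI /h; lra.
rewrite (umbra_value_line y2 h01 hy1) /Q; ring.
Qed.

Lemma umbra_value_sum y (n : nat) : -1 < Re y ->
  \sum_(1 <= k < n.+1) f (k%:R + y) = Q (n%:R + y) - Q y.
Proof.
move=> y1; elim: n => [|n IH]; first by rewrite big_geq// add0r subrr.
have ny : -1 < Re (n%:R + y) by rewrite -real_complex_nat !cRI ltr_wpDl.
have nE : n.+1%:R + y = n%:R + y + 1 by rewrite -natr1 addrAC.
have S := canRL (subrK _) (umbra_value_shift ny).
by rewrite (@big_nat_recr _ _ _ n.+1 1 _ isT) IH nE S [LHS]addrC addrA.
Qed.

(** The successive derivatives starting from the primitive [F]. The index is shifted by one: the
    hypothesis on [derive1n p f] concerns [G p.+1], so expansions stop after [p.+1] terms. *)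
Let G (j : nat) : C -> C := if j is i.+1 then derive1n i f else F.

Let dG (j : nat) w : 0 < Re w -> cderiv (G j) w (G j.+1 w).
Proof.
case: j => [|j] w0; first exact: dF.
exact: (derive1n_cderiv j (@open_halfplane R) fa w0).
Qed.

Let b (j : nat) : C := kap_moment h j / (j`!)%:R.

(* Taylor polynomials at [n] of the [G j], at distance [y - h = y + 1/2]. *)
Definition umbra_poly (n : nat) : {poly C} :=
  \sum_(j < p.+1) b j *: \sum_(i < p.+1 - j) (G (j + i)%N n%:R / (i`!)%:R) *: ('X - h%:C%:P) ^+ i.

Lemma size_umbra_poly n : (size (umbra_poly n) <= p.+2)%N.
Proof.
apply: (leq_trans (size_sum _ _ _)); apply/bigmax_leqP => j _.
apply: (leq_trans (size_scale_leq _ _)).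
apply: (leq_trans (size_sum _ _ _)); apply/bigmax_leqP => i _.
apply: (leq_trans (size_scale_leq _ _)).
apply: (leq_trans (size_poly_exp_leq _ _)).
rewrite size_XsubC mul1n ltnS ltnW//; apply: leq_trans (ltn_ord i) _.
exact: leq_subr.
Qed.

Lemma vanishing_taylor y (j : nat) : (j <= p.+1)%N ->
  vanishing (fun n => G j (n%:R + (y - h%:C)) -
    \sum_(i < p.+1 - j) G (j + i)%N n%:R / (i`!)%:R * (y - h%:C) ^+ i).
Proof.
move=> jp e e0.
have [N NP] := taylor_uniform (Gd := G) (p := p.+1) dG (locally_uniform_nat fp0)
  (subnKC jp) (y - h%:C) e0.
exists N => n Nn; have := NP n Nn 1; rewrite ler01 lexx => /(_ isT).
by rewrite (_ : 1%:C = 1) ?mul1r.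
Qed.

Lemma vanishing_line y : vanishing (fun n => Q (n%:R + y) -
  \sum_(j < p.+1) b j * G j (n%:R + (y - h%:C))).
Proof.
have [K K0 KP] := line_transform_taylor p fa fl dF h01.
move=> e e0; have K1 : 0 < K + 1 by rewrite ltr_wpDl.
have [X [_ XP]] := T_remainder_limit (Im y) Tf (divr_gt0 e0 K1).
exists (Num.bound (`|X| + `|Re y| + 1)) => n Nn.
have nX : `|X| + `|Re y| + 1 < n%:R.
  apply: lt_le_trans (archi_boundP _) _; last by rewrite ler_nat.
  by rewrite !addr_ge0.
have hE : h = - 2^-1 by [].
have yn : - `|Re y| <= Re y by rewrite lerNl -normrN ler_norm.
have Xn := ler_norm X; have X0 := normr_ge0 X; have y0 := normr_ge0 (Re y).
have h2 : 0 < 2^-1 :> R by rewrite invr_gt0.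
have nRe : Re (n%:R + y) = n%:R + Re y by rewrite -real_complex_nat !cRI.
have ny1 : -1 < Re (n%:R + y) by rewrite nRe; lra.
have hny : h < Re (n%:R + y) by rewrite nRe hE; lra.
rewrite (umbra_value_line ny1 h01 hny).
have TE : n%:R + y - h%:C = n%:R + (y - h%:C) by rewrite addrA.
(* The term [j = 0] is [F] itself, since the moment of order 0 is 1; the others are the terms of
   [line_transform_taylor], shifted by one. *)
have -> : \sum_(j < p.+1) b j * G j (n%:R + (y - h%:C)) = F (n%:R + y - h%:C) +
    \sum_(j < p) derive1n j f (n%:R + y - h%:C) / (j.+1`!)%:R * kap_moment h j.+1.
  rewrite big_ord_recl /b (kap_moment0 h01) fact0 divr1 mul1r TE; congr (_ + _).
  by apply: eq_bigr => j _; rewrite /= /bump /= add1n mulrAC [RHS]mulrAC (mulrC (kap_moment _ _)).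
rewrite opprD addrA; apply: le_trans (KP _ hny) _.
have -> : n%:R + y - h%:C = (n%:R + Re y - h) +i* Im y.
  by rewrite -real_complex_nat; apply: complex_eqP; rewrite !cRI.
have Xb : X < n%:R + Re y - h by rewrite hE; lra.
have := ler_wpM2l K0 (XP _ Xb); move/le_trans; apply.
rewrite mulrA ler_pdivrMr// mulrC ler_wpM2l ?lerDl//.
exact: ltW.
Qed.

Lemma vanishing_umbra_poly y : vanishing (fun n => Q (n%:R + y) - (umbra_poly n).[y]).
Proof.
have T := @vanishing_sum R p.+1 b (fun j n => G j (n%:R + (y - h%:C)) -
    \sum_(i < p.+1 - j) G (j + i)%N n%:R / (i`!)%:R * (y - h%:C) ^+ i)
  (fun j jp => vanishing_taylor y (ltnW jp)).
apply: (vanishing_ext _ (vanishingD (vanishing_line y) T)) => n.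
pose A (j : nat) := G j (n%:R + (y - h%:C)).
pose B (j : nat) := \sum_(i < p.+1 - j) G (j + i)%N n%:R / (i`!)%:R * (y - h%:C) ^+ i.
have -> : \sum_(j < p.+1) b j * (A j - B j) = \sum_(j < p.+1) b j * A j - \sum_(j < p.+1) b j * B j.
  by rewrite -sumrB; apply: eq_bigr => j _; exact: mulrBr.
have -> : (umbra_poly n).[y] = \sum_(j < p.+1) b j * B j.
  rewrite /umbra_poly horner_sum; apply: eq_bigr => j _.
  rewrite hornerZ horner_sum; congr (_ * _); apply: eq_bigr => i _.
  by rewrite hornerZ horner_exp hornerXsubC.
by rewrite addrA subrK.
Qed.

(** The sum of [f (k + y) - f k] telescopes to [Q (n + y) - Q y - (Q n - Q 0)]. The constant [Q n]
    is put into the polynomial, [umbra_poly n] cancels [Q (n + y)] in the limit, and the rest is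
    [- (Q y - Q 0)]. *)
Lemma umbra_MS_data : MS_data (@right_half_plane R) f
  (fun n => umbra_poly n - (Q n%:R)%:P) (fun y => Q y - Q 0).
Proof.
have U1 y : right_half_plane (y + 1) -> -1 < Re y.
  by rewrite /right_half_plane /= !cRI; lra.
split.
- exists p.+2 => n; rewrite (leq_trans (size_polyD _ _))// geq_max size_umbra_poly size_polyN.
  by rewrite (leq_trans (size_polyC_leq1 _)).
- move=> y /U1 y1; apply/vanishing_cvg.
  have z1 : -1 < Re 0 by rewrite cRe0 ltrN10.
  apply: (vanishing_ext _ (vanishing_umbra_poly y)) => n.
  rewrite sumrB (umbra_value_sum _ y1).
  have := umbra_value_sum n z1; under eq_bigr do rewrite addr0; rewrite addr0 => ->.
  rewrite hornerD hornerN hornerC.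
  have alg (r s t u q : C) : r - q = r - s - (t - u) - (q - t) - - (s - u) by ring.
  exact: alg.
- move=> y /U1 y1; apply: (etrans _ (umbra_value_shift y1)).
  have alg (r s t : C) : r - s - (t - s) = r - t by ring.
  exact: alg.
Qed.

(** The factor [sqrt (2 * pi)] of [bernoulli_hatE] cancels the normalization, and [umbra_value_line]
    identifies the integrals on all admissible lines. *)
Lemma umbra_evalP z : -1 < Re z -> umbra_eval F z (Q z).
Proof.
move=> z1.
have s0 : (Num.sqrt (2 * pi))%:C != 0 :> C.
  by rewrite real_complex_eq0 gt_eqF// sqrtr_gt0 mulr_gt0// pi_gt0.
have tE (t u : R) : 0 < t < 1 -> umbra_integrand F z t u =
    (Num.sqrt (2 * pi))%:C * (kap (u%:C + 'i * (- t)%:C) * F ('i * (u%:C + 'i * (- t)%:C) + z)).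
  move=> t01; rewrite /umbra_integrand (bernoulli_hatE u t01) (complexE' u (- t)); exact: (esym (mulrA _ _ _)).
have t01N (t : R) : 0 < t < 1 -> -1 < - t < 0 by rewrite ltrN2 oppr_lt0 andbC.
have tz (t : R) : 0 < t + Re z -> - t < Re z by rewrite ltrNl; lra.
split.
- exact: z1.
- by move=> w w0; exact: (cderiv_derivable (dF w0)).
- exact: strip_exponentially_bounded.
- move=> t t01 tz0; have I := line_transform_integrable dF Fl (t01N t t01) (tz t tz0).
  apply: (eq_cintegrable mT _ (cintegrableZ (Num.sqrt (2 * pi))%:C mT I)) => u _.
  by rewrite tE.
- move=> t t01 tz0; have I := line_transform_integrable dF Fl (t01N t t01) (tz t tz0).
  rewrite (eq_cintegral (fun u _ => tE t u t01)) (cintegralZ _ mT I) real_complexV mulKf//.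
  by rewrite (umbra_value_line z1 (t01N t t01) (tz t tz0)).
Qed.

End UmbraSum.

Theorem theorem9 (R : realType) (f : R[i] -> R[i])
    (hf : analytic_on (@right_half_plane R) f) :
  (exists p : nat,
     T_class p (- (2 * pi)) 0 (2 * pi) 0 f /\
     cvg_locally_uniformly (fun t xi : R => derive1n p f (t +i* xi)) (fun=> 0)) ->
  forall z : R[i], -1 < complex.Re z ->
    exists v : R[i],
      MS_sum (@right_half_plane R) f 1 z v /\ umbra_integral f z v.
Proof.
move=> [p [Tf fp0]] z z1; set Q := umbra_value_fun f.
have z01 : -1 < complex.Re (0 : R[i]) by rewrite cRe0 ltrN10.
exists (Q z - Q 0); split; last first.
  by exists (Q z), (Q 0); exact: (And3 (umbra_evalP Tf z1) (umbra_evalP Tf z01) erefl).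
have D := umbra_MS_data Tf fp0.
split.
- by rewrite /right_half_plane /= ltr01.
- by move=> u; rewrite /right_half_plane /= !cRI => u0; rewrite addr_gt0.
- by rewrite /right_half_plane /= ltr01.
- by move: z1; rewrite /right_half_plane /= !cRI; lra.
- exact: (ex_intro _ _ (ex_intro _ _ D)).
(* The lower limit of summation is 1, so the value is [Q' z - Q' 0], which is the same for all
   admissible data. *)
- move=> P' Q' D'; rewrite subrr; apply: (etrans (MS_data_unique D' D z1)).
  by rewrite [X in _ - X]subrr subr0.
Qed.
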